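(* Let $\sum_{j=0}^\infty|a(j)|<\infty$, $\sum_{j=0}^\infty(j+1)|a(j)|^2<\infty$, $P_0>0$, and $$D_0=\left\{f(\lambda):\frac1{2\pi}\int_{-\pi}^\pi f(\lambda)d\lambda\le P_0\right\}.$$ Let $A$ be the operator in $\ell_2$ given by $(Ad)_k=\sum_{l=0}^\infty a(k+l)d(l)$, $k\ge 0$. Let $d^0=\{d^0(k):k=0,1,\dots\}$ be a solution of the equation $$Ad=\alpha\overline d\quad(\alpha\in\mathbb C),\qquad \|d\|^2=\sum_{k=0}^\infty|d(k)|^2=P_0,$$ which gives the maximum value $\|Ad^0\|^2=\nu^2P_0$ of the quantity $\|Ad\|^2$ among such solutions. Then the spectral density $$f^0(\lambda)=\left|\sum_{k=0}^\infty d^0(k)e^{-ik\lambda}\right|^2$$ of the one-sided moving average sequence $\xi(j)=\sum_{u=-\infty}^jd^0(j-u)\varepsilon(u)$ is least favourable in $D_0$ for the optimal extrapolation of $A\xi=\sum_{j=0}^\infty a(j)\xi(j)$ from observations of $\xi(j)$, $j=-1,-2,\dots$. The minimax spectral characteristic of the optimal estimate of $A\xi$ is $$h^0=\sum_{j=0}^\infty a(j)e^{ij\lambda}-\left(\sum_{k=0}^\infty d^0(k)e^{-ik\lambda}\right)^{-1}\sum_{k=0}^\infty(Ad^0)_ke^{ik\lambda}.$$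
   Context: $\overline d$ is the coordinatewise complex conjugate; $\varepsilon$ is white noise, $E\varepsilon(i)\overline{\varepsilon(j)}=\delta_{ij}$. $\xi$ is a zero mean wide sense stationary sequence with spectral density $f$: $E\xi(j+k)\overline{\xi(j)}=\frac1{2\pi}\int_{-\pi}^\pi e^{ik\lambda}f(\lambda)d\lambda$. $L_2^-(f)$ is the closed subspace of $L_2(f)$ generated by $e^{in\lambda}$, $n\le-1$; $\Delta(h,f)=\frac1{2\pi}\int_{-\pi}^\pi|A(e^{i\lambda})-h(e^{i\lambda})|^2f(\lambda)d\lambda$, $A(e^{i\lambda})=\sum_{j\ge0}a(j)e^{ij\lambda}$; $h(f)$ minimizes $\Delta(\cdot,f)$ over $L_2^-(f)$. For a class $D$ of densities, $f^0\in D$ is least favourable if $\Delta(h(f^0),f^0)=\max_{f\in D}\min_{h\in L_2^-(f)}\Delta(h,f)$. A spectral characteristic $h^0$ is minimax (robust) if $h^0\in H_D=\bigcap_{f\in D}L_2^-(f)$ and $\min_{h\in H_D}\max_{f\in D}\Delta(h,f)=\max_{f\in D}\Delta(h^0,f)$. *)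

(* Defs.v *)
From HB Require Import structures.
From mathcomp Require Import all_boot all_order all_algebra.
From mathcomp Require Import complex.
From mathcomp Require Import all_classical all_reals all_analysis.

Set Implicit Arguments.
Unset Strict Implicit.
Unset Printing Implicit Defensive.

Import Order.TTheory GRing.Theory Num.Theory.
Import numFieldNormedType.Exports.

Local Open Scope classical_set_scope.
Local Open Scope ring_scope.
Local Open Scope complex_scope.

Section ComplexPreliminaries.
Context {R : realType}.

Definition normc2 (z : R[i]) : R := ComplexField.Normc.normc z ^+ 2.

Definition expi (x : R) : R[i] := cos x +i* sin x.

(* The sum of a complex series; meaningful when the series converges. *)
Definition csum (u : nat -> R[i]) : R[i] :=
  limn (series (fun k => complex.Re (u k))) +i* limn (series (fun k => complex.Im (u k))).

Definition cmeasurable d (T : measurableType d) (D : set T) (g : T -> R[i]) :=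
  measurable_fun D (fun x => complex.Re (g x)) /\ measurable_fun D (fun x => complex.Im (g x)).

(* Meaningful when the real and imaginary parts are integrable. *)
Definition Cintegral d (T : measurableType d) (mu : {measure set T -> \bar R})
    (D : set T) (g : T -> R[i]) : R[i] :=
  (\int[mu]_(x in D) complex.Re (g x)) +i* (\int[mu]_(x in D) complex.Im (g x)).

End ComplexPreliminaries.

Section SpectralSpaces.
Context {R : realType}.

(* The unit circle is parametrized by lambda in [-pi, pi]. *)
Definition circ : set R := `[- pi, pi].

Definition density (f : R -> R) : Prop :=
  (forall x, circ x -> 0 <= f x) /\
  (@lebesgue_measure R).-integrable circ (EFin \o f).

Definition wnorm2 (f : R -> R) (g : R -> R[i]) : \bar R :=
  (\int[@lebesgue_measure R]_(x in circ) (normc2 (g x) * f x)%:E)%E.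

Definition L2 (f : R -> R) : set (R -> R[i]) :=
  [set g | cmeasurable circ g /\ (wnorm2 f g < +oo)%E].

Definition neg_trig_poly (n : nat) (c : nat -> R[i]) (x : R) : R[i] :=
  \sum_(k < n) c k * expi (- (k.+1%:R * x)).

(* The closed linear span of e^{in lambda}, n <= -1, in L2 f. *)
Definition L2minus (f : R -> R) : set (R -> R[i]) :=
  [set g | L2 f g /\ forall e : R, 0 < e -> exists n c,
     (wnorm2 f (fun x => g x - neg_trig_poly n c x)%R < e%:E)%E].

(* phi represents the sum in L2([-pi, pi], d lambda) of \sum_k u k e_k. *)
Definition is_L2sum (u : nat -> R[i]) (e : nat -> R -> R[i]) (phi : R -> R[i]) :=
  cmeasurable circ phi /\
  (fun n => wnorm2 (fun=> 1) (fun x => phi x - \sum_(k < n) u k * e k x))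
    @ \oo --> 0%E.

End SpectralSpaces.

Section Extrapolation.
Context {R : realType}.

Definition Afun (a : nat -> R[i]) (x : R) : R[i] :=
  csum (fun j => a j * expi (j%:R * x)).

Definition Delta (a : nat -> R[i]) (h : R -> R[i]) (f : R -> R) : \bar R :=
  (((2 * pi)^-1)%:E * wnorm2 f (fun x => Afun a x - h x)%R)%E.

Definition optimal_char (a : nat -> R[i]) (f : R -> R) (h : R -> R[i]) : Prop :=
  L2minus f h /\ forall g, L2minus f g -> (Delta a h f <= Delta a g f)%E.

(* The minimum over the closed subspace L2minus f is attained, by orthogonal
   projection, so it is the infimum. *)
Definition min_error (a : nat -> R[i]) (f : R -> R) : \bar R :=
  ereal_inf [set Delta a h f | h in L2minus f].

Definition least_favourable (a : nat -> R[i]) (D : set (R -> R)) (f0 : R -> R) :=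
  D f0 /\
  exists h, optimal_char a f0 h /\
    Delta a h f0 = ereal_sup [set min_error a f | f in D].

Definition Hclass (D : set (R -> R)) : set (R -> R[i]) :=
  [set h | forall f, D f -> L2minus f h].

(* For a general h in Hclass D the supremum over D need not be attained. *)
Definition max_error (a : nat -> R[i]) (D : set (R -> R)) (h : R -> R[i]) :=
  ereal_sup [set Delta a h f | f in D].

Definition minimax_char (a : nat -> R[i]) (D : set (R -> R)) (h0 : R -> R[i]) :=
  [/\ Hclass D h0,
      exists2 f, D f & Delta a h0 f = max_error a D h0 &
      ereal_inf [set max_error a D h | h in Hclass D] = max_error a D h0].

Definition D_0 (P0 : R) : set (R -> R) :=
  [set f | density f /\
    (2 * pi)^-1 * (\int[@lebesgue_measure R]_(x in circ) f x) <= P0].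

End Extrapolation.

Section HankelOperator.
Context {R : realType}.

Definition l2norm2 (d : nat -> R[i]) : \bar R :=
  (\sum_(0 <= k <oo) (normc2 (d k))%:E)%E.

Definition hankel (a d : nat -> R[i]) : nat -> R[i] :=
  fun k => csum (fun l => a (k + l)%N * d l).

Definition coneigen_sol (a : nat -> R[i]) (P0 : R) (d : nat -> R[i]) : Prop :=
  (exists alpha : R[i], forall k, hankel a d k = alpha * (d k)^*) /\
  l2norm2 d = P0%:E.

End HankelOperator.

Section Sequences.
Context {R : realType} {disp : measure_display} {T : measurableType disp}.
Variable P : probability T R.

Definition cexpect (X : T -> R[i]) : R[i] := Cintegral P setT X.

Definition square_integrable (X : T -> R[i]) : Prop :=
  cmeasurable setT X /\ (\int[P]_t (normc2 (X t))%:E < +oo)%E.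

Definition white_noise (eps : int -> T -> R[i]) : Prop :=
  [/\ forall i, square_integrable (eps i),
      forall i, cexpect (eps i) = 0 &
      forall i j, cexpect (fun t => eps i t * (eps j t)^*) = (i == j)%:R].

(* xi j = \sum_(u <= j) d (j - u) eps u in mean square, with u = j - k. *)
Definition moving_average (d : nat -> R[i]) (eps xi : int -> T -> R[i]) : Prop :=
  forall j : int, square_integrable (xi j) /\
    (fun n : nat => \int[P]_t
      (normc2 (xi j t - \sum_(k < n) d k * eps (j - k%:Z) t))%:E)%E
      @ \oo --> 0%E.

Definition has_spectral_density (xi : int -> T -> R[i]) (f : R -> R) : Prop :=
  [/\ density f,
      forall j, square_integrable (xi j),
      forall j, cexpect (xi j) = 0 &
      forall j k : int, cexpect (fun t => xi (j + k) t * (xi j t)^*) =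
        ((2 * pi)^-1)%:C *
        Cintegral (@lebesgue_measure R) circ
          (fun x => expi (k%:~R * x) * (f x)%:C)].

End Sequences.

(* Main.v *)
(* Write phi for the sum of d^0(k) e^{-ik lambda}. The con-eigenvalue equation
   says that psi = alpha conj(phi), so A - h^0 = alpha conj(phi) / phi has
   constant modulus |alpha| and Delta(h^0, f) <= |alpha|^2 P_0 on D_0. For h in
   L_2^-(f^0), the nonnegative frequencies of (A - h) phi are those of psi, so
   Delta(h, f^0) >= |alpha|^2 P_0, with equality only if (A - h) phi = psi. What
   remains is that h^0 belongs to L_2^-(f) for every integrable f; as h^0 is
   bounded, Fejer means reduce this to the vanishing of its Fourier coefficients
   of index n >= 0. The Hankel form attains its norm at a con-eigenvector
   (Takagi), so by maximality |alpha| is that norm. With the inner-outer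
   factorization of phi, obtained from its wandering vector, the bilinear Hankel
   form has equality at (outer part, phi times inner part); the first variation
   shows that h^0 times the outer part has only negative frequencies, and
   cyclicity of the outer part gives the same for h^0. *)

Require Import Defs.
From mathcomp Require Import all_boot all_order all_algebra.
From mathcomp Require Import complex.
From mathcomp Require Import all_classical all_reals all_analysis.
From mathcomp Require Import measurable_realfun ring lra.

Import Order.TTheory GRing.Theory Num.Theory.
Import numFieldNormedType.Exports.

Local Open Scope classical_set_scope.
Local Open Scope ring_scope.
Local Open Scope complex_scope.
Set Implicit Arguments.
Unset Strict Implicit.
Unset Printing Implicit Defensive.

Local Notation re := complex.Re.
Local Notation im := complex.Im.

(** * Complex-valued square-integrable functions *)

Section ComplexNumbers.
Context {R : realType}.
Implicit Types x y z : R[i].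

(** The variation at the pair (phi, phi) only returns the con-eigenvalue equation:
    [A * phi - alpha * conj phi], which is [h^0 * phi], has negative frequencies. This does not
    settle [h^0] itself, since division by the inner factor of phi could create nonnegative
    frequencies. The bilinear form depends only on the product of its two arguments, so the inner
    factor may be moved from one argument to the other; maximality of |alpha| makes equality there a
    stationarity condition, now involving the outer part, which can be cancelled. Membership of
    [h^0] is required for every integrable weight, where mean-square approximation does not suffice;
    a uniform bound on the approximants is needed where the weight is large. No factorization theory
    is assumed. The wandering vector [g] has constant modulus and stands in for the inner factor,
    and [conj g * phi] for the outer one. Cyclicity is used as the fact that [g] is a limit of
    [(1 - p) phi] with [p] of negative frequencies. The same fact shows that phi is nonzero almost
    everywhere, so that the convention [0^-1 = 0] is harmless in [h^0] and equality of errors at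
    [f^0] gives uniqueness. *)

Lemma complexP x y : re x = re y -> im x = im y -> x = y.
Proof. by case: x y => a b [c d] /= -> ->. Qed.

Lemma reD x y : re (x + y) = re x + re y. Proof. by case: x y => a b []. Qed.
Lemma imD x y : im (x + y) = im x + im y. Proof. by case: x y => a b []. Qed.
Lemma reN x : re (- x) = - re x. Proof. by case: x. Qed.
Lemma imN x : im (- x) = - im x. Proof. by case: x. Qed.
Lemma reM x y : re (x * y) = re x * re y - im x * im y.
Proof. by case: x y => a b []. Qed.
Lemma imM x y : im (x * y) = re x * im y + im x * re y.
Proof. by case: x y => a b []. Qed.
Lemma re_conj x : re (Num.conj x) = re x. Proof. by case: x. Qed.
Lemma im_conj x : im (Num.conj x) = - im x. Proof. by case: x. Qed.
Lemma reC (r : R) : re r%:C = r. Proof. by []. Qed.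
Lemma imC (r : R) : im r%:C = 0. Proof. by []. Qed.

Definition cE := (reD, imD, reN, imN, reM, imM, re_conj, im_conj, reC, imC).

Lemma re_sum I (s : seq I) (P : pred I) (F : I -> R[i]) :
  re (\sum_(i <- s | P i) F i) = \sum_(i <- s | P i) re (F i).
Proof. by elim/big_ind2 : _ => // x1 x2 y1 y2 <- <-; rewrite reD. Qed.

Lemma im_sum I (s : seq I) (P : pred I) (F : I -> R[i]) :
  im (\sum_(i <- s | P i) F i) = \sum_(i <- s | P i) im (F i).
Proof. by elim/big_ind2 : _ => // x1 x2 y1 y2 <- <-; rewrite imD. Qed.

Lemma normc2E z : normc2 z = re z ^+ 2 + im z ^+ 2.
Proof. by case: z => a b; rewrite /normc2 /= sqr_sqrtr// addr_ge0// sqr_ge0. Qed.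

Lemma normc2_ge0 z : 0 <= normc2 z.
Proof. by rewrite normc2E addr_ge0// sqr_ge0. Qed.

Lemma normc2M x y : normc2 (x * y) = normc2 x * normc2 y.
Proof. by rewrite !normc2E !cE; ring. Qed.

Lemma normc2_conj x : normc2 (Num.conj x) = normc2 x.
Proof. by rewrite !normc2E !cE; ring. Qed.

Lemma normc2N x : normc2 (- x) = normc2 x.
Proof. by rewrite !normc2E !cE; ring. Qed.

Lemma normc2C (r : R) : normc2 r%:C = r ^+ 2.
Proof. by rewrite normc2E !cE; ring. Qed.

Lemma normc2_0 : normc2 (0 : R[i]) = 0.
Proof. by rewrite normc2E /= expr0n/= addr0. Qed.

Lemma normc2_1 : normc2 (1 : R[i]) = 1.
Proof. by rewrite normc2E /= expr1n expr0n/= addr0. Qed.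

Lemma normc2_eq0 z : (normc2 z == 0) = (z == 0).
Proof.
rewrite normc2E paddr_eq0 ?sqr_ge0// !sqrf_eq0; apply/andP/eqP.
  by move=> [/eqP h1 /eqP h2]; apply: complexP.
by move=> ->.
Qed.

Lemma normc2V z : normc2 z^-1 = (normc2 z)^-1.
Proof.
have [->|z0] := eqVneq z 0; first by rewrite invr0 normc2_0 invr0.
have n0 : normc2 z != 0 by rewrite normc2_eq0.
by apply: (mulfI n0); rewrite -normc2M !mulfV// normc2_1.
Qed.

Lemma normc2D_le x y : normc2 (x + y) <= 2 * normc2 x + 2 * normc2 y.
Proof.
rewrite !normc2E !cE.
by have := (sqr_ge0 (re x - re y), sqr_ge0 (im x - im y)) => -[]; nra.
Qed.

Lemma mul_conj z : z * Num.conj z = (normc2 z)%:C.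
Proof. by apply: complexP; rewrite !cE ?normc2E; ring. Qed.

Lemma normr_re_mul_le x y : `|re (x * y)| <= normc2 x + normc2 y.
Proof.
case: x y => a b [c e]; rewrite !normc2E !cE /= ler_norml.
have := (sqr_ge0 (a - c), sqr_ge0 (a + c), sqr_ge0 (b - e), sqr_ge0 (b + e)).
by move=> [[[h1 h2] h3] h4]; apply/andP; split; nra.
Qed.

Lemma normr_im_mul_le x y : `|im (x * y)| <= normc2 x + normc2 y.
Proof.
case: x y => a b [c e]; rewrite !normc2E !cE /= ler_norml.
have := (sqr_ge0 (a - e), sqr_ge0 (a + e), sqr_ge0 (b - c), sqr_ge0 (b + c)).
by move=> [[[h1 h2] h3] h4]; apply/andP; split; nra.
Qed.

Lemma re_conj_mul_i x : re (x * Num.conj ('i)) = im x.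
Proof. by rewrite !cE /= mulr0 mulrN1 opprK add0r. Qed.

End ComplexNumbers.

Section ComplexMeasurable.
Context {R : realType} {d : measure_display} {T : measurableType d}.
Variable D : set T.
Implicit Types f g : T -> R[i].

Lemma eq_cmeasurable f g : (forall x, D x -> f x = g x) ->
  cmeasurable D f -> cmeasurable D g.
Proof.
move=> fg [mf1 mf2]; split.
- by apply: eq_measurable_fun mf1 => x /set_mem/fg ->.
- by apply: eq_measurable_fun mf2 => x /set_mem/fg ->.
Qed.

Lemma cmeasurable_cst (z : R[i]) : cmeasurable D (fun=> z).
Proof. by split; exact: measurable_cst. Qed.

Lemma cmeasurableD f g : cmeasurable D f -> cmeasurable D g ->
  cmeasurable D (fun x => f x + g x).
Proof.
move=> [f1 f2] [g1 g2]; split.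
- by under eq_fun do rewrite reD; exact: measurable_funD.
- by under eq_fun do rewrite imD; exact: measurable_funD.
Qed.

Lemma cmeasurableM f g : cmeasurable D f -> cmeasurable D g ->
  cmeasurable D (fun x => f x * g x).
Proof.
move=> [f1 f2] [g1 g2]; split.
- under eq_fun do rewrite reM.
  by apply: measurable_funB; exact: measurable_funM.
- under eq_fun do rewrite imM.
  by apply: measurable_funD; exact: measurable_funM.
Qed.

Lemma cmeasurable_conj f : cmeasurable D f ->
  cmeasurable D (fun x => Num.conj (f x)).
Proof.
move=> [f1 f2]; split.
- by under eq_fun do rewrite re_conj.
- by under eq_fun do rewrite im_conj; exact: measurableT_comp.
Qed.

Lemma cmeasurableB f g : cmeasurable D f -> cmeasurable D g ->
  cmeasurable D (fun x => f x - g x).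
Proof.
move=> mf mg; apply: cmeasurableD => //.
apply: (@eq_cmeasurable (fun x => - 1 * g x)) => [x _|]; first by rewrite mulN1r.
by apply: cmeasurableM => //; exact: cmeasurable_cst.
Qed.

Lemma cmeasurable_sum (I : Type) (s : seq I) (F : I -> T -> R[i]) :
  (forall i, cmeasurable D (F i)) ->
  cmeasurable D (fun x => \sum_(i <- s) F i x).
Proof.
move=> mF; elim: s => [|i s ih].
  by under eq_fun do rewrite big_nil; exact: cmeasurable_cst.
by under eq_fun do rewrite big_cons; exact: cmeasurableD.
Qed.

Lemma measurable_normc2 f : cmeasurable D f ->
  measurable_fun D (fun x => normc2 (f x)).
Proof.
move=> [f1 f2]; under eq_fun do rewrite normc2E.
by apply: measurable_funD; exact: measurable_funX.
Qed.

Lemma cmeasurable_real (u : T -> R) : measurable_fun D u ->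
  cmeasurable D (fun x => (u x)%:C).
Proof. by split => //; exact: measurable_cst. Qed.

End ComplexMeasurable.

(** * Square-integrable complex functions and their inner product *)

Section SquareIntegrable.
Context {R : realType} {d : measure_display} {T : measurableType d}.
Variables (mu : {measure set T -> \bar R}) (D : set T).
Hypothesis mD : measurable D.
Implicit Types f g h : T -> R[i].

Definition cintegrable f :=
  mu.-integrable D (EFin \o (fun x => re (f x))) /\
  mu.-integrable D (EFin \o (fun x => im (f x))).

Local Notation I := (Cintegral mu D).

Lemma cintegrable_cm f : cintegrable f -> cmeasurable D f.
Proof.
by move=> [/measurable_int/measurable_EFinP h1 /measurable_int/measurable_EFinP h2].
Qed.

Lemma eq_Cintegral f g : (forall x, D x -> f x = g x) -> I f = I g.
Proof.
move=> fg; rewrite /Cintegral; congr (_ +i* _); apply: eq_Rintegral => x;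
  by move=> /set_mem/fg ->.
Qed.

Lemma eq_cintegrable f g : (forall x, D x -> f x = g x) ->
  cintegrable f -> cintegrable g.
Proof.
move=> fg [h1 h2]; split.
- by apply: eq_integrable h1 => // x /set_mem/fg /= ->.
- by apply: eq_integrable h2 => // x /set_mem/fg /= ->.
Qed.

Lemma cintegrable0 : cintegrable (fun=> 0 : R[i]).
Proof. by split; exact: integrable0. Qed.

Lemma integrable_funD (u v : T -> R) :
  mu.-integrable D (EFin \o u) -> mu.-integrable D (EFin \o v) ->
  mu.-integrable D (EFin \o (fun x => u x + v x)).
Proof.
by move=> hu hv; exact: (@integrableD _ _ _ mu D mD (EFin \o u) (EFin \o v)).
Qed.

Lemma integrable_funZ (c : R) (u : T -> R) : mu.-integrable D (EFin \o u) ->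
  mu.-integrable D (EFin \o (fun x => c * u x)).
Proof. by move=> hu; exact: (@integrableZl _ _ _ mu D mD c (EFin \o u) hu). Qed.

Lemma integrable_funB (u v : T -> R) :
  mu.-integrable D (EFin \o u) -> mu.-integrable D (EFin \o v) ->
  mu.-integrable D (EFin \o (fun x => u x - v x)).
Proof.
by move=> hu hv; exact: (@integrableB _ _ _ mu D mD (EFin \o u) (EFin \o v)).
Qed.

Lemma cintegrableD f g : cintegrable f -> cintegrable g ->
  cintegrable (fun x => f x + g x).
Proof.
move=> [f1 f2] [g1 g2]; split.
- by under eq_fun do rewrite reD; exact: integrable_funD.
- by under eq_fun do rewrite imD; exact: integrable_funD.
Qed.

Lemma CintegralD f g : cintegrable f -> cintegrable g ->
  I (fun x => f x + g x) = I f + I g.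
Proof.
move=> [f1 f2] [g1 g2]; apply: complexP => /=.
- by under eq_Rintegral do rewrite reD; exact: RintegralD.
- by under eq_Rintegral do rewrite imD; exact: RintegralD.
Qed.

Lemma cintegrableZ z f : cintegrable f -> cintegrable (fun x => z * f x).
Proof.
move=> [f1 f2]; split.
- under eq_fun do rewrite reM.
  by apply: integrable_funB; exact: integrable_funZ.
- under eq_fun do rewrite imM.
  by apply: integrable_funD; exact: integrable_funZ.
Qed.

Lemma CintegralZ z f : cintegrable f -> I (fun x => z * f x) = z * I f.
Proof.
move=> [f1 f2]; apply: complexP; rewrite ?reM ?imM /=.
- under eq_Rintegral do rewrite reM.
  by rewrite RintegralB ?RintegralZl//; exact: integrable_funZ.
- under eq_Rintegral do rewrite imM.
  by rewrite RintegralD ?RintegralZl//; exact: integrable_funZ.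
Qed.

Lemma Cintegral0 : I (fun=> 0 : R[i]) = 0.
Proof. by rewrite /Cintegral Rintegral_cst// mul0r. Qed.

Lemma cintegrable_sum (J : Type) (s : seq J) (F : J -> T -> R[i]) :
  (forall i, cintegrable (F i)) -> cintegrable (fun x => \sum_(i <- s) F i x).
Proof.
move=> hF; elim: s => [|i s ih].
  by under eq_fun do rewrite big_nil; exact: cintegrable0.
by under eq_fun do rewrite big_cons; exact: cintegrableD.
Qed.

Lemma Cintegral_sum (J : Type) (s : seq J) (F : J -> T -> R[i]) :
  (forall i, cintegrable (F i)) ->
  I (fun x => \sum_(i <- s) F i x) = \sum_(i <- s) I (F i).
Proof.
move=> hF; elim: s => [|i s ih].
  by under eq_fun do rewrite big_nil; rewrite big_nil Cintegral0.
under eq_fun do rewrite big_cons.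
by rewrite big_cons -ih CintegralD//; exact: cintegrable_sum.
Qed.

Lemma Cintegral_conj f : cintegrable f ->
  I (fun x => Num.conj (f x)) = Num.conj (I f).
Proof.
move=> [f1 f2]; apply: complexP; rewrite ?re_conj ?im_conj /=.
- by under eq_Rintegral do rewrite re_conj.
- under eq_Rintegral do rewrite im_conj -mulN1r.
  by rewrite RintegralZl// mulN1r.
Qed.

Definition sqint f :=
  cmeasurable D f /\ (\int[mu]_(x in D) (normc2 (f x))%:E < +oo)%E.

Lemma eq_sqint f g : (forall x, D x -> f x = g x) -> sqint f -> sqint g.
Proof.
move=> fg [mf hf]; split; first exact: eq_cmeasurable mf.
by under eq_integral => x /set_mem hx do rewrite -fg//.
Qed.

Lemma sqint_dom f g (c : R) : sqint f -> cmeasurable D g -> 0 <= c ->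
  (forall x, D x -> normc2 (g x) <= c * normc2 (f x)) -> sqint g.
Proof.
move=> [mf hf] mg c0 gf; split => //.
apply: (@le_lt_trans _ _ (\int[mu]_(x in D) (c%:E * (normc2 (f x))%:E))%E).
  apply: ge0_le_integral => //.
  - by move=> x _; rewrite lee_fin normc2_ge0.
  - by apply/measurable_EFinP; exact: measurable_normc2.
  - apply/measurable_EFinP; apply: measurable_funM => //.
    exact: measurable_normc2.
rewrite ge0_integralZl//.
- by rewrite lte_mul_pinfty// ?lee_fin.
- by apply/measurable_EFinP; exact: measurable_normc2.
- by move=> x _; rewrite lee_fin normc2_ge0.
Qed.

Lemma sqint_integrable f : cmeasurable D f ->
  sqint f <-> mu.-integrable D (EFin \o (fun x => normc2 (f x))).
Proof.
move=> mf; split.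
  move=> [_ hf]; apply/integrableP; split.
    by apply/measurable_EFinP; exact: measurable_normc2.
  by under eq_integral do rewrite /= ger0_norm ?normc2_ge0//.
move=> /integrableP[_ hf]; split => //.
by under eq_integral do rewrite -[X in (X%:E)%E]ger0_norm ?normc2_ge0//.
Qed.

Lemma sqint_conj f : sqint f -> sqint (fun x => Num.conj (f x)).
Proof.
move=> hf; apply: (@sqint_dom f _ 1) => //; first exact: cmeasurable_conj hf.1.
by move=> x _; rewrite mul1r normc2_conj.
Qed.

Lemma sqintZ z f : sqint f -> sqint (fun x => z * f x).
Proof.
move=> hf; apply: (@sqint_dom f _ (normc2 z)) => //; rewrite ?normc2_ge0//.
- by apply: cmeasurableM hf.1; exact: cmeasurable_cst.
- by move=> x _; rewrite normc2M.
Qed.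

Lemma sqintD f g : sqint f -> sqint g -> sqint (fun x => f x + g x).
Proof.
move=> hf hg; have mfg := cmeasurableD hf.1 hg.1.
apply/sqint_integrable => //.
have hf' := (sqint_integrable hf.1).1 hf.
have hg' := (sqint_integrable hg.1).1 hg.
have := @integrableD _ _ _ mu D mD _ _ (integrable_funZ 2 hf') (integrable_funZ 2 hg').
apply: le_integrable => //.
  by apply/measurable_EFinP; exact: measurable_normc2.
move=> x _ /=; rewrite lee_fin ger0_norm ?normc2_ge0//.
by rewrite (le_trans _ (ler_norm _))// normc2D_le.
Qed.

Lemma sqintB f g : sqint f -> sqint g -> sqint (fun x => f x - g x).
Proof.
move=> hf hg; apply: sqintD => //.
by apply: (@eq_sqint (fun x => - 1 * g x)) (sqintZ _ hg) => x _; rewrite mulN1r.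
Qed.

Lemma sqint0 : sqint (fun=> 0 : R[i]).
Proof.
split; first exact: cmeasurable_cst.
by rewrite integral0_eq// => x _; rewrite normc2_0.
Qed.

Lemma sqint_sum (J : Type) (s : seq J) (F : J -> T -> R[i]) :
  (forall i, sqint (F i)) -> sqint (fun x => \sum_(i <- s) F i x).
Proof.
move=> hF; elim: s => [|i s ih].
  by under eq_fun do rewrite big_nil; exact: sqint0.
by under eq_fun do rewrite big_cons; exact: sqintD.
Qed.

Lemma sqint_mul_cintegrable f g : sqint f -> sqint g ->
  cintegrable (fun x => f x * g x).
Proof.
move=> hf hg; have [m1 m2] := cmeasurableM hf.1 hg.1.
have hf' := (sqint_integrable hf.1).1 hf.
have hg' := (sqint_integrable hg.1).1 hg.
have h := @integrableD _ _ _ mu D mD _ _ hf' hg'.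
split; apply: le_integrable h => //; try exact/measurable_EFinP.
- move=> x _ /=; rewrite lee_fin (le_trans (normr_re_mul_le _ _))//.
  exact: ler_norm.
- move=> x _ /=; rewrite lee_fin (le_trans (normr_im_mul_le _ _))//.
  exact: ler_norm.
Qed.

Definition cip f g := I (fun x => f x * Num.conj (g x)).
(** Squared norms are used throughout, so that no square roots appear. The integral is real valued
    and sends infinity to 0, hence [n2] is meaningful only together with [sqint]. *)
Definition n2 f := \int[mu]_(x in D) normc2 (f x).

Lemma eq_cip f f' g g' : (forall x, D x -> f x = f' x) ->
  (forall x, D x -> g x = g' x) -> cip f g = cip f' g'.
Proof. by move=> hf hg; apply: eq_Cintegral => x hx; rewrite hf// hg. Qed.

Lemma eq_n2 f f' : (forall x, D x -> f x = f' x) -> n2 f = n2 f'.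
Proof. by move=> hf; apply: eq_Rintegral => x /set_mem hx; rewrite hf. Qed.

Lemma n2_ge0 f : 0 <= n2 f.
Proof. by apply: Rintegral_ge0 => x _; exact: normc2_ge0. Qed.

Lemma integral_n2 f : sqint f ->
  (\int[mu]_(x in D) (normc2 (f x))%:E = (n2 f)%:E)%E.
Proof.
move=> [_ hf]; rewrite /n2 /Rintegral fineK// ge0_fin_numE//.
by apply: integral_ge0 => x _; rewrite lee_fin normc2_ge0.
Qed.

Lemma cipDl f g h : sqint f -> sqint g -> sqint h ->
  cip (fun x => f x + g x) h = cip f h + cip g h.
Proof.
move=> hf hg hh; rewrite /cip; under eq_fun do rewrite mulrDl.
by apply: CintegralD; apply: sqint_mul_cintegrable => //; exact: sqint_conj.
Qed.

Lemma cipZl z f h : sqint f -> sqint h ->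
  cip (fun x => z * f x) h = z * cip f h.
Proof.
move=> hf hh; rewrite /cip; under eq_fun do rewrite -mulrA.
by apply: CintegralZ; apply: sqint_mul_cintegrable => //; exact: sqint_conj.
Qed.

Lemma cip_conj f g : sqint f -> sqint g -> cip g f = Num.conj (cip f g).
Proof.
move=> hf hg; rewrite /cip -Cintegral_conj.
  by apply: eq_Cintegral => x _; rewrite rmorphM /= conjCK mulrC.
by apply: sqint_mul_cintegrable => //; exact: sqint_conj.
Qed.

Lemma cipZr z f h : sqint f -> sqint h ->
  cip f (fun x => z * h x) = Num.conj z * cip f h.
Proof.
move=> hf hh.
by rewrite cip_conj ?cipZl// ?rmorphM/= -?cip_conj//; exact: sqintZ.
Qed.

Lemma cipDr f g h : sqint f -> sqint g -> sqint h ->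
  cip f (fun x => g x + h x) = cip f g + cip f h.
Proof.
move=> hf hg hh.
by rewrite cip_conj ?cipDl// ?rmorphD/= -?cip_conj//; exact: sqintD.
Qed.

Lemma cipBl f g h : sqint f -> sqint g -> sqint h ->
  cip (fun x => f x - g x) h = cip f h - cip g h.
Proof.
move=> hf hg hh; under eq_fun do rewrite -mulN1r.
by rewrite cipDl ?cipZl// ?mulN1r//; exact: sqintZ.
Qed.

Lemma cipBr f g h : sqint f -> sqint g -> sqint h ->
  cip f (fun x => g x - h x) = cip f g - cip f h.
Proof.
move=> hf hg hh; under eq_fun do rewrite -mulN1r.
by rewrite cipDr ?cipZr// ?rmorphN1 ?mulN1r//; exact: sqintZ.
Qed.

Lemma cip_suml (J : Type) (s : seq J) (F : J -> T -> R[i]) g :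
  (forall i, sqint (F i)) -> sqint g ->
  cip (fun x => \sum_(i <- s) F i x) g = \sum_(i <- s) cip (F i) g.
Proof.
move=> hF hg; elim: s => [|i s ih].
  rewrite big_nil /cip; under eq_fun do rewrite big_nil mul0r.
  exact: Cintegral0.
under [X in cip X]eq_fun do rewrite big_cons.
by rewrite cipDl// ?ih ?big_cons//; exact: sqint_sum.
Qed.

Lemma cip_sumr (J : Type) (s : seq J) (F : J -> T -> R[i]) g :
  (forall i, sqint (F i)) -> sqint g ->
  cip g (fun x => \sum_(i <- s) F i x) = \sum_(i <- s) cip g (F i).
Proof.
move=> hF hg; rewrite cip_conj ?cip_suml//; last exact: sqint_sum.
by rewrite rmorph_sum /=; apply: eq_bigr => i _; rewrite -cip_conj.
Qed.

Lemma cip_diag f : sqint f -> cip f f = (n2 f)%:C.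
Proof.
move=> hf; rewrite /cip; under eq_fun do rewrite mul_conj.
by rewrite /Cintegral /= Rintegral_cst// mul0r.
Qed.

Lemma n2_conj f : n2 (fun x => Num.conj (f x)) = n2 f.
Proof. by rewrite /n2; under eq_Rintegral do rewrite normc2_conj. Qed.

Lemma n2Z z f : sqint f -> n2 (fun x => z * f x) = normc2 z * n2 f.
Proof.
move=> hf; rewrite /n2; under eq_Rintegral do rewrite normc2M.
by rewrite RintegralZl//; exact: (sqint_integrable hf.1).1.
Qed.

Lemma n2D f g : sqint f -> sqint g ->
  n2 (fun x => f x + g x) = n2 f + n2 g + 2 * re (cip f g).
Proof.
move=> hf hg; apply: (@complexI R); rewrite -cip_diag; last exact: sqintD.
rewrite cipDl// ?cipDr// ?(cip_conj hf hg) ?cip_diag//; try exact: sqintD.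
by apply: complexP; rewrite !cE; ring.
Qed.

Lemma n2N f : n2 (fun x => - f x) = n2 f.
Proof. by rewrite /n2; under eq_Rintegral do rewrite normc2N. Qed.

Lemma n2C f g : n2 (fun x => f x - g x) = n2 (fun x => g x - f x).
Proof. by rewrite -n2N; apply: eq_n2 => x _; rewrite opprB. Qed.

Lemma n2B f g : sqint f -> sqint g ->
  n2 (fun x => f x - g x) = n2 f + n2 g - 2 * re (cip f g).
Proof.
move=> hf hg; under eq_fun do rewrite -mulN1r.
rewrite n2D ?cipZr ?n2Z//; last exact: sqintZ.
by rewrite normc2N normc2_1 mul1r rmorphN1 mulN1r reN mulrN.
Qed.

Lemma n2D_le f g : sqint f -> sqint g ->
  n2 (fun x => f x + g x) <= 2 * n2 f + 2 * n2 g.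
Proof.
move=> hf hg; have := n2_ge0 (fun x => f x - g x).
by rewrite n2B// n2D//; lra.
Qed.

Lemma n2B_le f g : sqint f -> sqint g ->
  n2 (fun x => f x - g x) <= 2 * n2 f + 2 * n2 g.
Proof.
move=> hf hg; have := n2_ge0 (fun x => f x + g x).
by rewrite n2B// n2D//; lra.
Qed.

Lemma n2_triangle g f h : sqint f -> sqint g -> sqint h ->
  n2 (fun x => f x - h x) <=
  2 * n2 (fun x => f x - g x) + 2 * n2 (fun x => g x - h x).
Proof.
move=> hf hg hh; have := n2D_le (sqintB hf hg) (sqintB hg hh).
by rewrite (@eq_n2 _ (fun x => f x - h x))// => x _; rewrite addrA subrK.
Qed.

Lemma discriminant_le (a b c : R) : 0 <= a -> 0 <= c ->
  (forall t, 0 <= a + 2 * t * b + t ^+ 2 * c) -> b ^+ 2 <= a * c.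
Proof.
move=> a0 c0 h; have [c00|cn0] := eqVneq c 0.
  rewrite c00 mulr0; have [->|b0] := eqVneq b 0; first by rewrite expr0n.
  (* At this [t] the polynomial, affine since [c = 0], takes the value -1. *)
  have := h (- (a + 1) / (2 * b)).
  rewrite c00 mulr0 addr0.
  have -> : 2 * (- (a + 1) / (2 * b)) * b = - (a + 1) by field.
  by lra.
have cp : 0 < c by rewrite lt_def cn0.
have := h (- b / c).
have -> : a + 2 * (- b / c) * b + (- b / c) ^+ 2 * c = (a * c - b ^+ 2) / c by field.
by rewrite pmulr_lge0 ?invr_gt0// subr_ge0.
Qed.

Lemma re_cip_CauchySchwarz f g : sqint f -> sqint g ->
  re (cip f g) ^+ 2 <= n2 f * n2 g.
Proof.
move=> hf hg; apply: discriminant_le; rewrite ?n2_ge0// => t.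
have := n2_ge0 (fun x => f x + t%:C * g x).
rewrite n2D ?cipZr ?n2Z//; last exact: sqintZ.
rewrite normc2C !cE; lra.
Qed.

Lemma CauchySchwarz f g : sqint f -> sqint g ->
  normc2 (cip f g) <= n2 f * n2 g.
Proof.
move=> hf hg; set z := cip f g.
have [z0|z0] := eqVneq z 0.
  by rewrite z0 normc2_0 mulr_ge0// n2_ge0.
have zp : 0 < normc2 z by rewrite lt_def normc2_eq0 z0 normc2_ge0.
(* Scaling [g] by [z] makes the inner product equal to [|z|^2], so the real inequality applies; one
   factor [|z|^2] then cancels. *)
have := re_cip_CauchySchwarz hf (sqintZ z hg).
rewrite cipZr// n2Z// -/z.
rewrite mulrC mul_conj reC.
by rewrite mulrCA expr2 ler_pM2l.
Qed.

(** Continuity of the inner product: the set of [f] with [cip f g = z] is closed. Identities checked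
    on polynomials pass to mean-square limits in this way. *)
Lemma cip_approx f g z : sqint f -> sqint g ->
  (forall e, 0 < e -> exists f', [/\ sqint f', n2 (fun x => f x - f' x) < e &
     cip f' g = z]) -> cip f g = z.
Proof.
move=> hf hg happ; apply/eqP; rewrite -subr_eq0 -normc2_eq0; apply/eqP.
apply/eqP; rewrite eq_le normc2_ge0 andbT.
have n1 : 0 < n2 g + 1 by have := n2_ge0 g; lra.
apply/ler_addgt0Pr => e e0; rewrite add0r.
have [f' [hf' fe <-]] := happ (e / (n2 g + 1)) (divr_gt0 e0 n1).
rewrite -cipBl//; apply: (le_trans (CauchySchwarz (sqintB hf hf') hg)).
apply: (@le_trans _ _ (e / (n2 g + 1) * (n2 g + 1))); last by rewrite divfK ?gt_eqF.
by apply: ler_pM; rewrite ?n2_ge0//; [exact: ltW|lra].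
Qed.

Lemma n2_eq0_ae f : sqint f -> n2 f = 0 -> {ae mu, forall x, D x -> f x = 0}.
Proof.
move=> hf f0; have := integral_n2 hf; rewrite f0.
under eq_integral do rewrite -[X in (X%:E)%E]ger0_norm ?normc2_ge0//.
have mf : measurable_fun D (fun x => (normc2 (f x))%:E).
  by apply/measurable_EFinP; apply: measurable_normc2 hf.1.
move=> /(ae_eq_integral_abs mu mD mf).1.
apply: filterS => x h /h /= [] /eqP; rewrite normc2_eq0 => /eqP; exact.
Qed.

Lemma ae_eq_n2 f g : cmeasurable D f -> cmeasurable D g ->
  {ae mu, forall x, D x -> f x = g x} -> n2 f = n2 g.
Proof.
move=> mf mg fg; rewrite /n2 /Rintegral; congr fine.
apply: ae_eq_integral => //; try (apply/measurable_EFinP; exact: measurable_normc2).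
by apply: filterS fg => x h /h /= ->.
Qed.

Lemma ae_eq_Cintegral f g : cmeasurable D f -> cmeasurable D g ->
  {ae mu, forall x, D x -> f x = g x} -> I f = I g.
Proof.
move=> [mf1 mf2] [mg1 mg2] fg; rewrite /Cintegral /Rintegral.
congr (_ +i* _); congr fine; apply: ae_eq_integral => //;
  try exact/measurable_EFinP.
- by apply: filterS fg => x h /h /= ->.
- by apply: filterS fg => x h /h /= ->.
Qed.

End SquareIntegrable.

Lemma ae_mono d (T : measurableType d) (R : realType)
    (mu : {measure set T -> \bar R}) (P Q : T -> Prop) :
  (forall x, P x -> Q x) ->
  {ae mu, forall x, P x} -> {ae mu, forall x, Q x}.
Proof. by move=> PQ; exact: filterS. Qed.

Lemma ae_mono2 d (T : measurableType d) (R : realType)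
    (mu : {measure set T -> \bar R}) (P Q S : T -> Prop) :
  (forall x, P x -> Q x -> S x) ->
  {ae mu, forall x, P x} -> {ae mu, forall x, Q x} -> {ae mu, forall x, S x}.
Proof. by move=> PQS; exact: filterS2. Qed.

Lemma ae_neq (R : realType) (a : R) :
  {ae (@lebesgue_measure R), forall x : R, x != a}.
Proof.
exists [set a]; split; first exact: measurable_set1.
  exact: lebesgue_measure_set1.
by move=> x /= /negP; rewrite negbK => /eqP.
Qed.

Lemma limn_einf_le {R : realType} (u : nat -> \bar R) (c : \bar R) :
  (forall n, u n <= c)%E -> (limn_einf u <= c)%E.
Proof.
move=> uc; rewrite limn_einf_lim; apply: lime_le; first exact: is_cvg_einfs.
apply: nearW => n; apply: le_trans (uc n); apply: ereal_inf_lbound.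
by exists n => //=.
Qed.

(** * Completeness of the space of square-integrable functions *)

Section L2Completeness.
Context {R : realType} {d : measure_display} {T : measurableType d}.
Variables (mu : {measure set T -> \bar R}) (D : set T).
Hypothesis mD : measurable D.

(** The sum of the absolute increments is integrable, hence finite almost everywhere, and there the
    sequence is an absolutely convergent telescoping series. The limit is written as an upper limit,
    which is measurable before any convergence is known. *)
Lemma ae_cvg_of_summable (v : nat -> T -> R) :
  (forall n, measurable_fun D (v n)) ->
  (\sum_(n <oo) \int[mu]_(x in D) `|v n.+1 x - v n x|%:E < +oo)%E ->
  exists2 u : T -> R, measurable_fun D u &
    {ae mu, forall x, D x -> v n x @[n --> \oo] --> u x}.
Proof.
move=> mv hs; exists (fun x => fine (limn_esup (fun n => (v n x)%:E))).
  apply: measurableT_comp => //.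
  by apply: measurable_fun_limn_esup => n; exact/measurable_EFinP.
have mw n : measurable_fun D (fun x => `|v n.+1 x - v n x|%:E).
  apply/measurable_EFinP; apply: measurableT_comp => //.
  exact: measurable_funB.
have w0 n x : D x -> (0 <= `|v n.+1 x - v n x|%:E)%E by rewrite lee_fin.
have ms : measurable_fun D (fun x => \sum_(n <oo) `|v n.+1 x - v n x|%:E)%E.
  by apply: ge0_emeasurable_sum => // n x Dx _; exact: w0.
have s0 x : (0 <= \sum_(n <oo) `|v n.+1 x - v n x|%:E)%E.
  by apply: nneseries_ge0 => n _ _; rewrite lee_fin.
have hi : mu.-integrable D (fun x => \sum_(n <oo) `|v n.+1 x - v n x|%:E)%E.
  apply/integrableP; split => //.
  under eq_integral do rewrite gee0_abs//.
  by rewrite integral_nneseries.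
apply: filterS (integrable_ae mD hi) => x hx /hx hfin.
have cs : cvgn (series (fun n => v n.+1 x - v n x)).
  apply: normed_cvg.
  rewrite /normed_series_of /=.
  apply: nondecreasing_is_cvgn.
    by apply: nondecreasing_series => n _ _; exact: normr_ge0.
  exists (fine (\sum_(n <oo) `|v n.+1 x - v n x|%:E)%E) => _ [N _ <-].
  rewrite -lee_fin fineK// /series /= -sumEFin.
  by apply: nneseries_lim_ge => n _; rewrite lee_fin.
have cv : cvgn (v^~ x).
  have -> : v^~ x = (fun n => v 0%N x + series (fun n => v n.+1 x - v n x) n).
    by apply/funext => n; rewrite /series /= telescope_sumr// addrC subrK.
  by apply: is_cvgD => //; exact: is_cvg_cst.
have cl : (v n x)%:E @[n --> \oo] --> (limn (v^~ x))%:E.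
  by apply: cvg_EFin; [exact: nearW|exact: cv].
have := cvg_limn_einf_sup cl.
by move=> [_ ->].
Qed.

(** On a set of finite measure the rate [4^-n] in squared norm gives summable increments in L1,
    through [|z| <= 2^n |z|^2 + 2^-n]. This yields a limit almost everywhere, and Fatou's lemma
    transfers the bound to it. *)
Lemma sqint_complete (u : nat -> T -> R[i]) (mufin : (mu D < +oo)%E) :
  (forall n, sqint mu D (u n)) ->
  (forall n k, (n <= k)%N -> n2 mu D (fun x => u n x - u k x) <= 4^-1 ^+ n) ->
  exists2 g, sqint mu D g &
    forall n, n2 mu D (fun x => u n x - g x) <= 4^-1 ^+ n.
Proof.
move=> hu hc.
have summ (p : R[i] -> R) : (forall z, p z ^+ 2 <= normc2 z) ->
    (forall x y, p (x - y) = p x - p y) ->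
    (forall n, measurable_fun D (fun x => p (u n x))) ->
    (\sum_(n <oo) \int[mu]_(x in D) `|p (u n.+1 x) - p (u n x)|%:E < +oo)%E.
  move=> hp pB mp.
  pose M := fine (mu D); have M0 : 0 <= M by apply: fine_ge0.
  have hM : mu D = M%:E by rewrite fineK// ge0_fin_numE.
  apply: (@le_lt_trans _ _ (\sum_(n <oo) ((1 + M) * 2^-1 ^+ n)%:E)%E).
    apply: lee_nneseries => [n _ _|n _].
      by apply: integral_ge0 => x _; rewrite lee_fin.
    apply: (@le_trans _ _ (\int[mu]_(x in D)
      ((2 ^+ n) * normc2 (u n x - u n.+1 x) + 2^-1 ^+ n)%:E)%E).
      apply: ge0_le_integral => //.
      - apply/measurable_EFinP; apply: measurableT_comp => //.
        exact: measurable_funB.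
      - apply/measurable_EFinP; apply: measurable_funD => //.
        apply: measurable_funM => //; apply: measurable_normc2.
        exact: cmeasurableB (hu n).1 (hu n.+1).1.
      - move=> x Dx; rewrite lee_fin -pB -[X in _ <= 2 ^+ n * X + _]normc2N opprB.
        set z := u n.+1 x - u n x; have := hp z; have := normr_ge0 (p z).
        have pn : 0 < (2 : R) ^+ n by rewrite exprn_gt0.
        have -> : p z ^+ 2 = `|p z| ^+ 2 by rewrite real_normK// num_real.
        rewrite exprVn; move: `|p z| => a a0 ha.
        apply: (@le_trans _ _ (2 ^+ n * a ^+ 2 + (2 ^+ n)^-1)); last first.
          by rewrite lerD2r ler_pM2l.
        rewrite -(ler_pM2l pn) mulrDr mulfV ?gt_eqF// mulrA -expr2 -exprMn.
        have := sqr_ge0 (2 ^+ n * a - 1); nra.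
    have -> : (fun x => (2 ^+ n * normc2 (u n x - u n.+1 x) + 2^-1 ^+ n)%:E) =
      (fun x => (2 ^+ n)%:E * (normc2 (u n x - u n.+1 x))%:E + (2^-1 ^+ n)%:E)%E.
      by apply/funext.
    have sB := sqintB mD (hu n) (hu n.+1).
    have mB : measurable_fun D (fun x => (normc2 (u n x - u n.+1 x))%:E).
      by apply/measurable_EFinP; apply: measurable_normc2 sB.1.
    have p0 x : D x -> (0 <= (normc2 (u n x - u n.+1 x))%:E)%E.
      by rewrite lee_fin normc2_ge0.
    have p1 x : D x -> (0 <= (2 ^+ n)%:E * (normc2 (u n x - u n.+1 x))%:E)%E.
      by move=> Dx; rewrite mule_ge0 ?p0// lee_fin exprn_ge0.
    have p2 x : D x -> (0 <= (2^-1 ^+ n : R)%:E)%E by rewrite lee_fin exprn_ge0.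
    have m1 : measurable_fun D
        (fun x => (2 ^+ n)%:E * (normc2 (u n x - u n.+1 x))%:E)%E.
      by apply: measurable_funeM.
    rewrite (ge0_integralD mu mD p1 m1 p2)// (ge0_integralZl mu mD mB p0); last first.
      by rewrite lee_fin exprn_ge0.
    rewrite integral_cst// hM (integral_n2 sB) -!EFinM -EFinD lee_fin.
    rewrite mulrDl mul1r [M * _]mulrC lerD2r.
    apply: (le_trans (ler_wpM2l _ (hc n n.+1 (leqnSn n)))); first exact: exprn_ge0.
    by rewrite -exprMn (_ : 2 * 4^-1 = 2^-1 :> R)//; field.
  apply: (@le_lt_trans _ _ ((1 + M) / (1 - 2^-1))%:E); last exact: ltry.
  apply: lime_le.
    by apply: is_cvg_nneseries => n _ _; rewrite lee_fin mulr_ge0 ?exprn_ge0 ?addr_ge0.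
  apply: nearW => n; rewrite /= sumEFin lee_fin.
  apply: (@geometric_le_lim R n (1 + M) 2^-1); rewrite ?addr_ge0//.
  by rewrite ger0_norm//; lra.
have [ur mur aer] := ae_cvg_of_summable (fun n => (hu n).1.1) (summ (@complex.Re R)
  (fun z => ltac:(by rewrite normc2E lerDl sqr_ge0))
  (fun x y => ltac:(by rewrite reD reN)) (fun n => (hu n).1.1)).
have [ui mui aei] := ae_cvg_of_summable (fun n => (hu n).1.2) (summ (@complex.Im R)
  (fun z => ltac:(by rewrite normc2E lerDr sqr_ge0))
  (fun x y => ltac:(by rewrite imD imN)) (fun n => (hu n).1.2)).
pose g x := ur x +i* ui x.
have mg : cmeasurable D g by split.
have hlim n : (\int[mu]_(x in D) (normc2 (u n x - g x))%:E <= (4^-1 ^+ n)%:E)%E.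
  pose F k x := (normc2 (u n x - u (n + k)%N x))%:E.
  have mF k : measurable_fun D (F k).
    by apply/measurable_EFinP; apply: measurable_normc2 (cmeasurableB (hu n).1 (hu _).1).
  have F0 k x : D x -> (0 <= F k x)%E by rewrite lee_fin normc2_ge0.
  have := fatou mu mD mF F0.
  rewrite (_ : (\int[mu]_(x in D) limn_einf (F^~ x))%E =
    (\int[mu]_(x in D) (normc2 (u n x - g x))%:E)%E); last first.
    apply: ae_eq_integral => //.
    - rewrite (_ : (fun x => _) = (fun x => - limn_esup (-%E \o F^~ x))%E); last first.
        by apply/funext => x; rewrite limn_esupN oppeK.
      apply: measurableT_comp => //; apply: measurable_fun_limn_esup => k.
      by apply: measurableT_comp => //; exact: mF.
    - by apply/measurable_EFinP; apply: measurable_normc2 (cmeasurableB (hu n).1 mg).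
    - apply: filterS2 aer aei => x h1 h2 Dx.
      have {}h1 := h1 Dx; have {}h2 := h2 Dx.
      apply: (cvg_limn_einf_sup _).1.
      apply: cvg_EFin; first exact: nearW.
      rewrite /F /=.
      under eq_fun do rewrite normc2E !cE !expr2.
      rewrite normc2E !cE !expr2 /=.
      have s1 : re (u (n + k)%N x) @[k --> \oo] --> ur x.
        rewrite -(cvg_shiftn n) in h1; apply: cvg_trans h1.
        by apply: near_eq_cvg; apply: nearW => k; rewrite /= addnC.
      have s2 : im (u (n + k)%N x) @[k --> \oo] --> ui x.
        rewrite -(cvg_shiftn n) in h2; apply: cvg_trans h2.
        by apply: near_eq_cvg; apply: nearW => k; rewrite /= addnC.
      by apply: cvgD; apply: cvgM; apply: cvgB => //; exact: cvg_cst.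
  move=> /le_trans; apply.
  apply: limn_einf_le => k; rewrite /F integral_n2//; last exact: sqintB.
  by rewrite lee_fin hc// leq_addr.
have sB n : sqint mu D (fun x => u n x - g x).
  split; first exact: cmeasurableB (hu n).1 mg.
  by rewrite (le_lt_trans (hlim n))// ltry.
exists g; last by move=> n; rewrite -lee_fin -integral_n2.
apply: (eq_sqint _ (sqintB mD (hu 0%N) (sB 0%N))) => x _.
by rewrite opprB addrC subrK.
Qed.
End L2Completeness.

(** * Orthogonal projection on the closure of a subspace *)

Section Projection.
Context {R : realType} {d : measure_display} {T : measurableType d}.
Variables (mu : {measure set T -> \bar R}) (D : set T).
Hypotheses (mD : measurable D) (mufin : (mu D < +oo)%E).
Variable V : set (T -> R[i]).
Hypotheses (V0 : V !=set0) (Vsq : forall v, V v -> sqint mu D v).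
Hypothesis VZD : forall z v w, V v -> V w -> V (fun x => z * v x + w x).

Local Notation N := (n2 mu D).

Lemma ge0_eps (a : R) : (forall e : R, 0 < e -> a <= e) -> a <= 0.
Proof. by move=> h; apply/ler_addgt0Pr => e e0; rewrite add0r h. Qed.

(** [V] need not be closed, so the projection may lie outside it. What is produced is the residual
    [g], the limit of [f - v n] along a minimizing sequence, which is Cauchy by the parallelogram
    law. *)
Lemma exists_projection f : sqint mu D f ->
  exists g, [/\ sqint mu D g,
    forall e, 0 < e -> exists2 v, V v & N (fun x => f x - v x - g x) < e &
    forall v, V v -> cip mu D g v = 0].
Proof.
move=> hf.
pose S := [set N (fun x => f x - v x) | v in V].
have S0 : S !=set0 by have [v Vv] := V0; exists (N (fun x => f x - v x)), v.
have lbS : lbound S 0 by move=> _ [v Vv <-]; exact: n2_ge0.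
have hS : has_inf S by split => //; exists 0.
pose m := inf S.
have mle v : V v -> m <= N (fun x => f x - v x).
  by move=> Vv; apply: ge_inf => //; [exists 0|exists v].
(* An excess of [4^-n / 4] over the infimum becomes at most [4^-n] in the parallelogram identity,
   the rate that completeness asks for. *)
have ex n : exists v, V v /\ N (fun x => f x - v x) < m + 4^-1 ^+ n / 4.
  have /inf_adherent /(_ hS) : 0 < (4^-1 : R) ^+ n / 4 by rewrite divr_gt0 ?exprn_gt0.
  by move=> [_ [v Vv <-] h]; exists v.
have [v hv] := choice ex.
have Vv n : V (v n) := (hv n).1.
have sv n := Vsq (Vv n).
have su n : sqint mu D (fun x => f x - v n x) by apply: sqintB.
have p4 (n k : nat) : (n <= k)%N -> (4^-1 : R) ^+ k <= 4^-1 ^+ n.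
  by move=> nk; rewrite ler_wiXn2l//; lra.
have cauchy n k : (n <= k)%N ->
    N (fun x => (f x - v n x) - (f x - v k x)) <= 4^-1 ^+ n.
  move=> nk; pose w x := 2^-1 * v n x + 2^-1 * v k x.
  have Vw : V w.
    have [z Vz] := V0.
    have V0' : V (fun=> 0).
      by have := VZD (-1) Vz Vz; under eq_fun do rewrite mulN1r addNr.
    apply: VZD => //; have := VZD 2^-1 (Vv k) V0'.
    by under eq_fun do rewrite addr0.
  have par : N (fun x => (f x - v n x) - (f x - v k x)) =
      2 * N (fun x => f x - v n x) + 2 * N (fun x => f x - v k x) -
      4 * N (fun x => f x - w x).
    have -> : N (fun x => f x - w x) =
        normc2 2^-1 * N (fun x => (f x - v n x) + (f x - v k x)).
      rewrite -n2Z//; last exact: sqintD.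
      apply: eq_n2 => x _; rewrite /w.
      have h2 : (2 : R[i]) != 0 by rewrite pnatr_eq0.
      by field.
    rewrite normc2V (_ : normc2 2 = 4); last by rewrite normc2E /=; ring.
    by rewrite (n2B mD (su n) (su k)) (n2D mD (su n) (su k)); field.
  have := mle _ Vw; have := (hv n).2; have := (hv k).2; have := p4 _ _ nk.
  rewrite par; lra.
have [g sg hg] := sqint_complete mD mufin su cauchy.
exists g; split => //.
  move=> e e0.
  have : 4^-1 ^+ n @[n --> \oo] --> (0 : R) by apply: cvg_expr; rewrite ger0_norm//; lra.
  move=> /cvgr_lt /(_ _ e0) [n _ /(_ n (leqnn n)) /= hn].
  by exists (v n) => //; exact: le_lt_trans (hg n) hn.
have ortho w : V w -> forall z, re (cip mu D g (fun x => z * w x)) = 0.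
  move=> Vw z; have sw : sqint mu D (fun x => z * w x) by apply: sqintZ => //; exact: Vsq.
  pose c := N (fun x => z * w x); have c0 : 0 <= c by exact: n2_ge0.
  have bnd n : re (cip mu D g (fun x => z * w x)) ^+ 2 <= 4 * c * 4^-1 ^+ n.
    have h1 := re_cip_CauchySchwarz mD (sqintB mD (su n) sg) sw.
    rewrite cipBl// -/c reD reN in h1.
    (* Moving [v n] by a multiple of [z * w] stays in [V], so the squared distance to [f] cannot
       drop below [m]; this makes a quadratic polynomial in [t] nonnegative. *)
    have h2 : re (cip mu D (fun x => f x - v n x) (fun x => z * w x)) ^+ 2
        <= (4^-1 ^+ n) * c.
      apply: discriminant_le => //.
      move=> t.
      have Vt : V (fun x => (- (t%:C * z)) * w x + v n x) by apply: VZD.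
      have := mle _ Vt.
      rewrite (@eq_n2 _ _ _ _ _ _ (fun x => (f x - v n x) + t%:C * (z * w x))); last first.
        by move=> x _; rewrite opprD mulNr opprK mulrA; ring.
      rewrite n2D//; last exact: sqintZ.
      rewrite cipZr// n2Z// normc2C -/c.
      have -> : re (Num.conj t%:C * cip mu D (fun x => f x - v n x) (fun x => z * w x))
        = t * re (cip mu D (fun x => f x - v n x) (fun x => z * w x)).
        by rewrite !cE oppr0 mul0r subr0.
      have := (hv n).2; have : 0 <= (4^-1 : R) ^+ n by exact: exprn_ge0.
      lra.
    have := ler_wpM2r c0 (hg n); move: h1 h2; set A := re _; set B := re _.
    have := sqr_ge0 (A - 2 * (A - B)); nra.
  apply/eqP; rewrite -sqrf_eq0 eq_le sqr_ge0 andbT.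
  apply: ge0_eps => e e0.
  have : 4 * c * 4^-1 ^+ n @[n --> \oo] --> (4 * c * 0 : R).
    by apply: cvgMr; apply: cvg_expr; rewrite ger0_norm//; lra.
  rewrite mulr0 => /cvgr_lt /(_ _ e0) [n _ /(_ n (leqnn n)) /= hn].
  exact: le_trans (bnd n) (ltW hn).
move=> w Vw; apply: complexP => /=.
  by have := ortho w Vw 1; under eq_fun do rewrite mul1r.
(* The factor [i] turns the imaginary part into a real part. *)
have := ortho w Vw 'i; rewrite cipZr//; last exact: Vsq.
by rewrite mulrC re_conj_mul_i.
Qed.

End Projection.

(** * Fourier series on the circle *)

Section TrigonometricSystem.
Context {R : realType}.

Local Notation mu := (@lebesgue_measure R).
Local Notation circ := (@circ R).

Definition E (n : int) (x : R) : R[i] := expi (n%:~R * x).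

Lemma expiD (x y : R) : expi (x + y) = expi x * expi y.
Proof.
by apply: complexP; rewrite !cE /= ?cosD ?sinD//; ring.
Qed.

Lemma E_add m n x : E (m + n) x = E m x * E n x.
Proof. by rewrite /E intrD mulrDl expiD. Qed.

Lemma E0 x : E 0 x = 1.
Proof. by rewrite /E mul0r /expi cos0 sin0. Qed.

Lemma E_conj n x : Num.conj (E n x) = E (- n) x.
Proof.
by apply: complexP; rewrite !cE /= mulrNz mulNr ?cosN ?sinN.
Qed.

Lemma normc2_E n x : normc2 (E n x) = 1.
Proof. by rewrite normc2E /= cos2Dsin2. Qed.

Lemma mcirc : measurable (circ : set (measurableTypeR R)). Proof. exact: measurable_itv. Qed.

Lemma mu_circ : mu circ = (2 * pi)%:E.
Proof.
rewrite /circ lebesgue_measure_itv /= lte_fin ifT; last by have := pi_gt0 R; lra.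
by rewrite -EFinB opprK mulr2n mulrDl mul1r.
Qed.

Lemma mu_circ_fin : (mu circ < +oo)%E.
Proof. by rewrite mu_circ ltry. Qed.

Lemma continuous_re_E n : continuous (fun x => re (E n x)).
Proof.
move=> x; apply: continuous_comp; last exact: continuous_cos.
by apply: mulrl_continuous.
Qed.

Lemma continuous_im_E n : continuous (fun x => im (E n x)).
Proof.
move=> x; apply: continuous_comp; last exact: continuous_sin.
by apply: mulrl_continuous.
Qed.

Lemma cmeasurable_E (D : set (measurableTypeR R)) n : cmeasurable D (E n).
Proof.
split; apply: measurable_funTS; apply: continuous_measurable_fun.
- exact: continuous_re_E.
- exact: continuous_im_E.
Qed.

Lemma sqint_bounded (g : measurableTypeR R -> R[i]) (c : R) : cmeasurable circ g ->
  (forall x, circ x -> normc2 (g x) <= c) -> sqint mu circ g.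
Proof.
move=> mg hg; apply/sqint_integrable => //.
apply: measurable_bounded_integrable => //; [exact: mcirc|exact: mu_circ_fin| |].
  exact: measurable_normc2.
exists c; split; first exact: num_real.
move=> y cy x cx /=; rewrite ger0_norm ?normc2_ge0//.
by rewrite (le_trans (hg _ cx))// ltW.
Qed.

Lemma sqint_E n : sqint mu circ (E n).
Proof.
apply: (@sqint_bounded _ 1); first exact: cmeasurable_E.
by move=> x _; rewrite normc2_E.
Qed.

Lemma sin_intpi (n : int) : sin (n%:~R * pi : R) = 0.
Proof.
have h (k : nat) : sin (k%:R * pi : R) = 0.
  elim: k => [|k ih]; first by rewrite mul0r sin0.
  by rewrite mulrSr mulrDl mul1r sinDpi ih oppr0.
by case: n => k; [exact: h|rewrite NegzE mulrNz mulNr sinN h oppr0].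
Qed.

Lemma Rintegral_circ_derive (F f : R -> R) :
  (forall x, is_derive x (1 : R) F (f x)) -> continuous f ->
  \int[mu]_(x in circ) f x = F pi - F (- pi).
Proof.
move=> dF cf; have pi0 := pi_gt0 R.
have dF' : derivable_oo_LRcontinuous F (- pi) pi.
  split.
  + by move=> x _; have [] := dF x.
  + apply: cvg_at_right_filter; apply: differentiable_continuous.
    by apply/derivable1_diffP; have [] := dF (- pi).
  + apply: cvg_at_left_filter; apply: differentiable_continuous.
    by apply/derivable1_diffP; have [] := dF pi.
rewrite /Rintegral /circ (@continuous_FTC2 _ f F)//; first by lra.
- exact: continuous_subspaceT.
- by move=> x _; rewrite derive1E; have [] := dF x.
Qed.

Lemma Cintegral_E n : n != 0 -> Cintegral mu circ (E n) = 0.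
Proof.
move=> n0; have nr : (n%:~R : R) != 0 by rewrite intr_eq0.
have hc : \int[mu]_(x in circ) cos (n%:~R * x : R) = 0.
  have := @Rintegral_circ_derive (fun x => (n%:~R)^-1 * sin (n%:~R * x))
    (fun x => cos (n%:~R * x)).
  rewrite mulrN sinN sin_intpi oppr0 mulr0 subrr; apply.
  - by move=> x; apply: is_derive_eq; rewrite /GRing.scale /=; field.
  - exact: continuous_re_E.
have hs : \int[mu]_(x in circ) sin (n%:~R * x : R) = 0.
  have := @Rintegral_circ_derive (fun x => - (n%:~R)^-1 * cos (n%:~R * x))
    (fun x => sin (n%:~R * x)).
  rewrite mulrN cosN subrr; apply.
  - by move=> x; apply: is_derive_eq; rewrite /GRing.scale /=; field.
  - exact: continuous_im_E.
by rewrite /Cintegral /= hc hs.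
Qed.

End TrigonometricSystem.

(** * Uniqueness of Fourier coefficients of integrable functions *)

Section FourierUniqueness.
Context {R : realType}.

Local Notation mu := (@lebesgue_measure R).
Local Notation circ := (@circ R).

Definition is_trigpoly (f : R -> R[i]) :=
  exists s : seq (R[i] * int), forall x, f x = \sum_(p <- s) p.1 * E p.2 x.

Lemma trigpoly_E z n : is_trigpoly (fun x => z * E n x).
Proof. by exists [:: (z, n)] => x; rewrite big_seq1. Qed.

Lemma trigpoly_cst z : is_trigpoly (fun=> z).
Proof.
by have [s hs] := trigpoly_E z 0; exists s => x; rewrite -hs E0 mulr1.
Qed.

Lemma trigpolyD f g : is_trigpoly f -> is_trigpoly g ->
  is_trigpoly (fun x => f x + g x).
Proof. by move=> [s hs] [t ht]; exists (s ++ t) => x; rewrite big_cat hs ht. Qed.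

Lemma trigpolyM f g : is_trigpoly f -> is_trigpoly g ->
  is_trigpoly (fun x => f x * g x).
Proof.
move=> [s hs] [t ht]; exists [seq (p.1 * q.1, p.2 + q.2) | p <- s, q <- t] => x.
rewrite hs ht big_allpairs_dep big_distrl /=; apply: eq_bigr => p _.
rewrite big_distrr /=; apply: eq_bigr => q _.
by rewrite E_add mulrACA.
Qed.

Lemma trigpolyX f n : is_trigpoly f -> is_trigpoly (fun x => f x ^+ n).
Proof.
move=> hf; elim: n => [|n ih]; first exact: trigpoly_cst.
by under eq_fun do rewrite exprS; exact: trigpolyM.
Qed.

Lemma trigpoly_cos (c : R) : is_trigpoly (fun x => (cos (x - c))%:C).
Proof.
have h := trigpolyD (trigpoly_E (2^-1 * expi (- c)) 1) (trigpoly_E (2^-1 * expi c) (-1)).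
have [s hs] := h; exists s => x; rewrite -hs -!mulrA /E -!expiD -mulrDr.
rewrite mulrNz mulNr mul1r (addrC (- c)) -(opprB x c).
have h2 : (2 : R[i]) = 2%:C by apply: complexP; rewrite /= ?addr0.
rewrite h2 -fmorphV; apply: complexP; rewrite !cE /= cosN sinN; first by field.
by rewrite subrr mul0r mulr0 add0r.
Qed.

Lemma Bernoulli_inequality (y : R) n : -1 <= y -> 1 + n%:R * y <= (1 + y) ^+ n.
Proof.
move=> y1; elim: n => [|n ih]; first by rewrite mul0r addr0 expr0.
rewrite exprS; have h : 0 <= 1 + y by lra.
apply: le_trans (ler_wpM2l h ih); rewrite -natr1.
have := ler0n R n; have := sqr_ge0 y; nra.
Qed.

(* The classical polynomial approximation of a step function at 1/2 used in
   the Brosowski-Deutsch proof of the Stone-Weierstrass theorem. *)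
Definition stepoly n (y : R) := (1 - y ^+ n) ^+ (2 ^ n).

Lemma stepoly_itv n (y : R) : 0 <= y <= 1 -> 0 <= stepoly n y <= 1.
Proof.
move=> /andP[y0 y1]; have : 0 <= y ^+ n <= 1 by rewrite exprn_ge0// exprn_ile1.
move=> /andP[h0 h1]; rewrite /stepoly exprn_ge0 ?exprn_ile1//; lra.
Qed.

(** Bernoulli's inequality gives [1 - (2 y)^n <= stepoly n y]; for [y > 1/2] it also bounds
    [stepoly n y], at most the inverse of [(1 + y^n)^(2^n)], by [(2 y)^-n]. *)
Lemma cvg_stepoly (y : R) : 0 <= y <= 1 -> y != 2^-1 ->
  stepoly n y @[n --> \oo] --> ((y < 2^-1)%R%:R : R).
Proof.
move=> hy yn; have /andP[y0 y1] := hy.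
have hyn n : 0 <= y ^+ n <= 1 by rewrite exprn_ge0// exprn_ile1.
case: ltrP => yh /=.
  apply: (@squeeze_cvgr _ _ _ _ (fun n => 1 - (2 * y) ^+ n) (fun=> 1)).
  - apply: nearW => n; have /andP[_ ->] := stepoly_itv n hy; rewrite andbT.
    rewrite /stepoly; have := @Bernoulli_inequality (- y ^+ n) (2 ^ n).
    rewrite exprMn natrX mulrN; apply; have := hyn n; lra.
  - rewrite -[X in _ --> X]subr0; apply: cvgB; first exact: cvg_cst.
    by apply: cvg_expr; rewrite ger0_norm; lra.
  - exact: cvg_cst.
have {}yh : 2^-1 < y by rewrite lt_def yn.
apply: (@squeeze_cvgr _ _ _ _ (fun=> 0) (fun n => (2 * y)^-1 ^+ n)).
- apply: nearW => n; have /andP[-> _] := stepoly_itv n hy.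
  have yp : 0 < 1 + y ^+ n by have := hyn n; lra.
  have h1 : stepoly n y * (1 + y ^+ n) ^+ (2 ^ n) <= 1.
    rewrite /stepoly -exprMn exprn_ile1//; have := hyn n; move: (y ^+ n) => a; nra.
  have h2 : (2 * y) ^+ n <= (1 + y ^+ n) ^+ (2 ^ n).
    have := @Bernoulli_inequality (y ^+ n) (2 ^ n).
    rewrite exprMn natrX => h; have {}h := h (ltac:(have := hyn n; lra)); lra.
  have p1 : 0 < (2 * y) ^+ n by rewrite exprn_gt0//; lra.
  rewrite exprVn -(ler_pM2r p1) mulVf ?gt_eqF//.
  apply: le_trans h1; rewrite ler_wpM2l//.
  by have /andP[-> _] := stepoly_itv n hy.
- exact: cvg_cst.
- apply: cvg_expr; rewrite ger0_norm ?invr_ge0; last by lra.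
  by rewrite invf_lt1; lra.
Qed.

(** The difference between a point of [[-pi, pi]] and the midpoint of an interval may exceed pi. The
    bound [2 pi - e] keeps it away from the translates of [[-e, e]] by a period; beyond pi, [s] is
    reflected to [2 pi - s]. *)
Lemma cos_gt_cos (t e : R) : 0 < e < pi -> `|t| < 2 * pi - e -> `|t| != e ->
  (cos e < cos t) = (`|t| < e) /\ cos t != cos e.
Proof.
move=> /andP[e0 epi]; have -> : cos t = cos `|t| by case: (ger0P t); rewrite ?cosN.
have := normr_ge0 t; move: `|t| => s s0 se sne.
have ee : e \in `[0, pi] by rewrite in_itv /=; lra.
have [spi|spi] := leP s pi.
  have ss : s \in `[0, pi] by rewrite in_itv /=; lra.
  by rewrite ltr_cos//; split=> //; rewrite (inj_in_eq (@cos_inj R)).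
have ss : 2 * pi - s \in `[0, pi] by rewrite in_itv /=; lra.
have -> : cos s = cos (2 * pi - s).
  have -> : 2 * pi - s = - s + pi *+ 2 by rewrite addrC mulr_natl.
  by rewrite cosD2pi cosN.
rewrite ltr_cos// (inj_in_eq (@cos_inj R))//; split; last by apply/eqP; lra.
by apply/idP/idP; lra.
Qed.

(** Off the two endpoints, the indicator of the interval is a bounded pointwise limit of
    trigonometric polynomials, so dominated convergence applies with bound [|u|]. *)
Lemma Rintegral_subitv_eq0 (u : R -> R) (a b : R) :
  mu.-integrable circ (EFin \o u) ->
  (forall p : R -> R, is_trigpoly (fun x => (p x)%:C) ->
     \int[mu]_(x in circ) (u x * p x) = 0) ->
  - pi < a -> a < b -> b < pi -> \int[mu]_(x in `]a, b[) u x = 0.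
Proof.
move=> iu hu pa ab bp; have pi0 := pi_gt0 R.
pose c := (a + b) / 2; pose e := (b - a) / 2.
have he : 0 < e < pi by rewrite /e; lra.
(* On the circle [Y x < 1/2] holds exactly for [x] in the interval, and the division by 4 keeps [Y]
   in [[0, 1]]; so [stepoly n (Y x)] tends to the indicator. *)
pose Y x := 2^-1 + (cos e - cos (x - c)) / 4.
have Y01 x : 0 <= Y x <= 1.
  have := (cos_le1 e, cos_geN1 e, cos_le1 (x - c), cos_geN1 (x - c)).
  by rewrite /Y => -[[[? ?] ?] ?]; lra.
have tY n : is_trigpoly (fun x => (stepoly n (Y x))%:C).
  have t1 : is_trigpoly (fun x => (Y x)%:C).
    have [s hs] := trigpolyD (trigpoly_cst (2^-1 + cos e / 4)%:C)
      (trigpolyM (trigpoly_cst (- (4^-1))%:C) (trigpoly_cos c)).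
    exists s => x; rewrite -hs -rmorphM -rmorphD /=; congr (_%:C).
    by rewrite /Y; lra.
  have [s hs] := trigpolyX (2 ^ n) (trigpolyD (trigpoly_cst 1)
    (trigpolyM (trigpoly_cst (-1)) (trigpolyX n t1))).
  exists s => x.
  by rewrite -hs mulN1r /stepoly rmorphXn /= rmorphB /= rmorphXn /= rmorph1.
have mY : measurable_fun circ Y.
  apply: measurable_funTS; apply: continuous_measurable_fun => x.
  apply: cvgD; first exact: cvg_cst.
  apply: cvgMl; apply: cvgB; first exact: cvg_cst.
  apply: continuous_comp; last exact: continuous_cos.
  by apply: cvgB; [exact: cvg_id|exact: cvg_cst].
have mu_ : measurable_fun circ u by apply/measurable_EFinP; exact: measurable_int iu.
pose F n x := (u x * stepoly n (Y x))%:E.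
have mF n : measurable_fun circ (F n).
  apply/measurable_EFinP; apply: measurable_funM => //.
  apply: measurable_funX; apply: measurable_funB => //.
  exact: measurable_funX.
have mP : measurable `]a, b[%classic by exact: measurable_itv.
pose L x := ((u \_ `]a, b[%classic) x)%:E.
have mL : measurable_fun circ L.
  apply/measurable_EFinP; apply/measurable_restrict => //; first exact: mcirc.
  by apply: measurable_funS mu_ => //; exact: mcirc.
have ig : mu.-integrable circ (fun x => `|u x|%:E) by exact: integrable_norm iu.
have Fu n x : circ x -> (`|F n x| <= `|u x|%:E)%E.
  move=> cx /=; rewrite lee_fin normrM ler_piMr//.
  by have /andP[h0 h1] := stepoly_itv n (Y01 x); rewrite ger0_norm.
have iF n : mu.-integrable circ (F n).
  apply: le_integrable ig; [exact: mcirc|exact: mF|].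
  by move=> x cx; rewrite (le_trans (Fu n x cx))// lee_fin ler_norm.
have [] := @dominated_convergence _ _ _ mu circ (@mcirc R) F L _ mF mL _ ig _.
- apply: ae_mono2 (ae_neq a) (ae_neq b) => x xa xb cx.
  have {}cx : - pi <= x <= pi by move: cx; rewrite /circ /= in_itv.
  apply: cvg_EFin; first exact: nearW.
  have xe : `|x - c| != e.
    apply/eqP => h; have := eqr_norml (x - c) e; rewrite h eqxx.
    move/esym => /andP[/orP[]/eqP h' _]; move: xa xb; rewrite /c /e in h' *.
      by move=> _ /eqP; apply; lra.
    by move=> /eqP + _; apply; lra.
  have xpi : `|x - c| < 2 * pi - e by rewrite ltr_norml /c /e; lra.
  have [h1 h2] := cos_gt_cos he xpi xe.
  have hY : Y x != 2^-1.
    apply: contra h2 => /eqP; rewrite /Y => h; apply/eqP; lra.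
  have := cvg_stepoly (Y01 x) hY.
  have -> : (Y x < 2^-1) = (x \in `]a, b[).
    rewrite in_itv /= /Y; transitivity (cos e < cos (x - c)).
      by apply/idP/idP; lra.
    by rewrite h1 ltr_norml /c /e; apply/idP/idP; lra.
  move=> hs.
  have -> : (u \_ `]a, b[%classic) x = u x * (x \in `]a, b[)%:R.
    rewrite patchE mem_setE; case: ifP => _; first by rewrite mulr1.
    by rewrite mulr0.
  by apply: cvgMr.
- by apply: aeW => x n; exact: Fu.
move=> iL _ hlim.
have h0 n : (\int[mu]_(x in circ) F n x)%E = 0%E.
  have := hu _ (tY n); rewrite /Rintegral => h.
  rewrite -[LHS]fineK; last first.
    by apply: integrable_fin_num (iF n); exact: mcirc.
  by rewrite h.
have hL : (\int[mu]_(x in circ) L x = 0)%E.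
  apply/esym; apply: cvg_unique hlim => //.
  rewrite (_ : [sequence _]_n = fun=> 0%E); first exact: cvg_cst.
  by apply/funext => n; exact: h0.
rewrite /Rintegral -[in RHS](fine0) -hL /L; congr fine.
rewrite (@integral_mkcond _ _ _ mu `]a, b[%classic) [in RHS]integral_mkcond.
apply: eq_integral => x _; rewrite !patchE /=.
case: ifPn => // xab; case: ifPn => //; apply: contraNeq => _.
by move: xab; rewrite !inE /circ /= !in_itv /=; lra.
Qed.

Lemma cintegrable_mul_trigpoly f p : cintegrable mu circ f -> is_trigpoly p ->
  cintegrable mu circ (fun x => f x * p x).
Proof.
move=> hf [s hs]; under eq_fun do rewrite hs big_distrr /=.
apply: cintegrable_sum; first exact: mcirc.
move=> i; under eq_fun do rewrite mulrCA; apply: cintegrableZ; first exact: mcirc.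
have [m1 m2] := cmeasurableM (cintegrable_cm hf) (@cmeasurable_E R circ i.2).
have bnd := integrable_funD (@mcirc R) (integrable_norm hf.1) (integrable_norm hf.2).
have hb (x : R) := normc2_E i.2 x.
split; apply: le_integrable bnd => //; try exact: mcirc; try exact/measurable_EFinP.
- move=> x _ /=; rewrite lee_fin [X in _ <= X]ger0_norm ?addr_ge0//.
  rewrite reM (le_trans (ler_normB _ _))// !normrM lerD// ler_piMr//;
  by rewrite ler_norml; have := hb x; rewrite normc2E; nra.
- move=> x _ /=; rewrite lee_fin [X in _ <= X]ger0_norm ?addr_ge0//.
  rewrite imM (le_trans (ler_normD _ _))// !normrM lerD// ler_piMr//;
  by rewrite ler_norml; have := hb x; rewrite normc2E; nra.
Qed.

Lemma Cintegral_mul_trigpoly_eq0 f p : cintegrable mu circ f ->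
  (forall n, Cintegral mu circ (fun x => f x * E n x) = 0) -> is_trigpoly p ->
  Cintegral mu circ (fun x => f x * p x) = 0.
Proof.
move=> hf hE [s hs]; under eq_fun do rewrite hs big_distrr /=.
have hi i : cintegrable mu circ (fun x => f x * E i x).
  apply: cintegrable_mul_trigpoly => //.
  by have [s1 hs1] := trigpoly_E 1 i; exists s1 => x; rewrite -hs1 mul1r.
rewrite Cintegral_sum ?big1//; try exact: mcirc.
- move=> i _; under eq_fun do rewrite mulrCA; rewrite CintegralZ ?hE ?mulr0//; exact: mcirc.
- move=> i; under eq_fun do rewrite mulrCA; apply: cintegrableZ => //; exact: mcirc.
Qed.

(** The primitive of [u], extended by 0, is constant on []-pi, pi[] because its increments are the
    vanishing integrals, while by Lebesgue differentiation its derivative is [u] almost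
    everywhere. *)
Lemma ae_eq0_of_subitv (u : R -> R) : mu.-integrable circ (EFin \o u) ->
  (forall a b, - pi < a -> a < b -> b < pi -> \int[mu]_(x in `]a, b[) u x = 0) ->
  {ae mu, forall x, circ x -> u x = 0}.
Proof.
move=> iu hu; pose v := u \_ circ.
have mc := @mcirc R.
have iv D : measurable D -> mu.-integrable D (EFin \o v).
  move=> mD; have : mu.-integrable setT (EFin \o v).
    rewrite (_ : EFin \o v = (EFin \o u) \_ circ); last first.
      by apply/funext => x; rewrite /v /= !patchE; case: ifP.
    by rewrite -integrable_mkcond.
  by apply: integrableS => //; exact: measurableT.
have lv : locally_integrable setT v by exact: integrable_locally.
pose F (y : R) := \int[mu]_(t in `]-oo, y]) v t.
have h : {ae mu, forall x : R, derivable F x 1 /\ F^`()%classic x = v x}.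
  exact: (@FTC1Ny R v (fun y => iv _ (measurable_itv _)) lv).
have h' : {ae mu, forall x : R, (derivable F x 1 /\ F^`()%classic x = v x) /\ x != - pi}.
  exact: ae_mono2 (fun _ a b => conj a b) h (ae_neq (- pi)).
apply: ae_mono2 h' (ae_neq pi) => x [[dF F'] xp] xn cx.
have {}cx : - pi < x < pi.
  by move: cx; rewrite /circ /= in_itv /= !le_eqVlt (negPf xn) eq_sym (negPf xp).
have vu (y : R) : - pi < y < pi -> v y = u y.
  by move=> hy; rewrite /v patchE mem_set// /circ /= in_itv /=; lra.
have Fcst (y z : R) : - pi < y -> y < z -> z < pi -> F y = F z.
  move=> py yz zp; apply/esym/eqP; rewrite -subr_eq0 /F Rintegral_itvB//.
  - rewrite -Rintegral_itv_bndo_bndc; last exact: iv.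
    rewrite -(hu y z)//; apply/eqP; apply: eq_Rintegral => t.
    by rewrite inE /= in_itv /= => ht; apply: vu; lra.
  - exact: iv.
  - by rewrite bnd_simp ltW.
have -> : u x = F^`()%classic x by rewrite F' vu.
rewrite derive1E (@near_eq_derive _ _ _ F (cst (F x)) x 1) ?derive_cst//.
near=> y.
have hy : - pi < y < pi.
  apply/andP; split; near: y.
  - by apply: lt_nbhsr; move/andP: cx => [].
  - by apply: lt_nbhsl; move/andP: cx => [].
have [xy|yx|->//] := ltgtP x y.
- by apply/esym/Fcst => //; [have := cx|have := hy]; lra.
- by apply/Fcst => //; [have := hy|have := cx]; lra.
Unshelve. all: by end_near.
Qed.

Lemma Fourier_uniqueness (f : measurableTypeR R -> R[i]) : cintegrable mu circ f ->
  (forall n, Cintegral mu circ (fun x => f x * E n x) = 0) ->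
  {ae mu, forall x, circ x -> f x = 0}.
Proof.
move=> hf h0.
(* Testing against real-valued polynomials separates the real and imaginary parts of [f]. *)
have hp (p : R -> R) : is_trigpoly (fun x => (p x)%:C) ->
    \int[mu]_(x in circ) (re (f x) * p x) = 0 /\
    \int[mu]_(x in circ) (im (f x) * p x) = 0.
  move=> tp; have := Cintegral_mul_trigpoly_eq0 hf h0 tp.
  rewrite /Cintegral => -[h1 h2]; split.
  - by rewrite -[RHS]h1; apply: eq_Rintegral => x _; rewrite reM reC imC mulr0 subr0.
  - by rewrite -[RHS]h2; apply: eq_Rintegral => x _; rewrite imM reC imC mulr0 add0r.
have h1 := ae_eq0_of_subitv hf.1 (fun a b => @Rintegral_subitv_eq0 _ a b hf.1 (fun p tp => (hp p tp).1)).
have h2 := ae_eq0_of_subitv hf.2 (fun a b => @Rintegral_subitv_eq0 _ a b hf.2 (fun p tp => (hp p tp).2)).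
by apply: ae_mono2 h1 h2 => x e1 e2 cx; apply: complexP; rewrite ?e1 ?e2.
Qed.

End FourierUniqueness.

(** * Approximation by polynomials with negative frequencies *)

Section AnalyticApproximation.
Context {R : realType}.

Local Notation mu := (@lebesgue_measure R).
Local Notation circ := (@circ R).
Local Notation sq := (sqint mu circ).
Local Notation N := (n2 mu circ).
Local Notation ip := (cip mu circ).
Local Notation T := (measurableTypeR R).
Let mc : measurable (circ : set T) := @mcirc R.

Lemma cip_E m n : ip (E m) (E n) = (2 * pi)%:C * (m == n)%:R.
Proof.
rewrite /cip; under eq_fun do rewrite E_conj -E_add.
have [->|mn] := eqVneq m n; last by rewrite mulr0 Cintegral_E// subr_eq0.
rewrite subrr mulr1; under eq_fun do rewrite E0.
rewrite /Cintegral /= !Rintegral_cst// mul0r mul1r.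
by congr (_ +i* _); exact: (congr1 fine (@mu_circ R)).
Qed.

Lemma sq_cintegrable (g : T -> R[i]) : sq g -> cintegrable mu circ g.
Proof.
move=> hg; have h := sqint_mul_cintegrable mc hg (sqint_E 0).
by apply: eq_cintegrable h => // x _; rewrite E0 mulr1.
Qed.

Lemma sqint_bounded_mul (g b : T -> R[i]) (K : R) : sq g -> cmeasurable circ b ->
  {ae mu, forall x, circ x -> normc2 (b x) <= K} -> sq (fun x => b x * g x).
Proof.
move=> [mg hg] mb hb; have mbg := cmeasurableM mb mg; split => //.
have K0 : (0 <= `|K|) by [].
apply: (@le_lt_trans _ _ (\int[mu]_(x in circ) (`|K|%:E * (normc2 (g x))%:E))%E).
  apply: ae_ge0_le_integral => //.
  - by move=> x _; rewrite lee_fin normc2_ge0.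
  - by apply/measurable_EFinP; exact: measurable_normc2.
  - by move=> x _; rewrite -EFinM lee_fin mulr_ge0 ?normc2_ge0.
  - by apply/measurable_EFinP; apply: measurable_funM => //; exact: measurable_normc2.
  - apply: ae_mono hb => x hx cx; rewrite -EFinM lee_fin normc2M.
    by apply: ler_wpM2r; rewrite ?normc2_ge0// (le_trans (hx cx))// ler_norm.
rewrite ge0_integralZl//.
- by rewrite lte_mul_pinfty// ?lee_fin.
- by apply/measurable_EFinP; exact: measurable_normc2.
- by move=> x _; rewrite lee_fin normc2_ge0.
Qed.

Lemma n2_bounded_mul_le (g b : T -> R[i]) (K : R) : 0 <= K -> sq g ->
  cmeasurable circ b ->
  {ae mu, forall x, circ x -> normc2 (b x) <= K} -> N (fun x => b x * g x) <= K * N g.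
Proof.
move=> K0 sg mb hb; have sbg := sqint_bounded_mul sg mb hb.
rewrite -lee_fin EFinM -!integral_n2// -ge0_integralZl//; first last.
- by move=> x _; rewrite lee_fin normc2_ge0.
- by apply/measurable_EFinP; exact: measurable_normc2 sg.1.
apply: ae_ge0_le_integral => //.
- by move=> x _; rewrite lee_fin normc2_ge0.
- by apply/measurable_EFinP; exact: measurable_normc2 sbg.1.
- by move=> x _; rewrite -EFinM lee_fin mulr_ge0 ?normc2_ge0.
- apply/measurable_EFinP; apply: measurable_funM => //.
  exact: measurable_normc2 sg.1.
- apply: ae_mono hb => x hx cx; rewrite -EFinM lee_fin normc2M.
  by apply: ler_wpM2r; rewrite ?normc2_ge0// hx.
Qed.

Lemma sqintM_E (g : T -> R[i]) n : sq g -> sq (fun x => E n x * g x).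
Proof.
move=> hg; apply: (@sqint_bounded_mul _ _ 1) => //; first exact: cmeasurable_E.
by apply: aeW => x _; rewrite normc2_E.
Qed.

Lemma cipM_El (g h : T -> R[i]) n : ip (fun x => E n x * g x) h = ip g (fun x => E (- n) x * h x).
Proof. by apply: eq_Cintegral => x _; rewrite rmorphM /= E_conj opprK; ring. Qed.

Lemma n2M_E (g : T -> R[i]) n : N (fun x => E n x * g x) = N g.
Proof. by apply: eq_Rintegral => x _; rewrite normc2M normc2_E mul1r. Qed.

Lemma cip_E_eq0_ae (g : T -> R[i]) : sq g -> (forall n, ip g (E n) = 0) ->
  {ae mu, forall x, circ x -> g x = 0}.
Proof.
move=> hg h0; apply: Fourier_uniqueness; first exact: sq_cintegrable.
move=> n; rewrite -(h0 (- n)); apply: eq_Cintegral => x _.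
by rewrite E_conj opprK.
Qed.

Lemma neg_trig_polyE n c (x : R) :
  neg_trig_poly n c x = \sum_(k < n) c k * E (- (k.+1)%:Z) x.
Proof.
by apply: eq_bigr => k _; rewrite /E mulrNz mulNr.
Qed.

Lemma neg_trig_poly_widen n m c (x : R) : (n <= m)%N ->
  neg_trig_poly n c x = neg_trig_poly m (fun k => if (k < n)%N then c k else 0) x.
Proof.
move=> nm; rewrite !neg_trig_polyE (big_ord_widen _ (fun k => c k * E (- (k.+1)%:Z) x) nm).
by rewrite big_mkcond; apply: eq_bigr => k _; case: ifP; rewrite ?mul0r.
Qed.

Definition is_neg_trig_poly (f : R -> R[i]) :=
  exists n c, forall x, f x = neg_trig_poly n c x.

Lemma is_neg_trig_polyZD z f g : is_neg_trig_poly f -> is_neg_trig_poly g ->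
  is_neg_trig_poly (fun x => z * f x + g x).
Proof.
move=> [n [c hc]] [m [c' hc']]; exists (maxn n m).
exists (fun k => z * (if (k < n)%N then c k else 0) + (if (k < m)%N then c' k else 0)) => x.
rewrite hc hc' (neg_trig_poly_widen _ _ (leq_maxl n m)) (neg_trig_poly_widen _ _ (leq_maxr n m)).
rewrite !neg_trig_polyE mulr_sumr -big_split /=; apply: eq_bigr => k _.
by rewrite mulrDl mulrA.
Qed.

Lemma neg_trig_poly0 (x : R) c : neg_trig_poly 0 c x = 0.
Proof. by rewrite /neg_trig_poly big_ord0. Qed.

Lemma is_neg_trig_poly_sum (I : Type) (s : seq I) (F : I -> R -> R[i]) z :
  (forall i, is_neg_trig_poly (F i)) ->
  is_neg_trig_poly (fun x => z * \sum_(i <- s) F i x).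
Proof.
move=> hF; elim: s => [|i s ih].
  by exists 0%N, (fun=> 0) => x; rewrite big_nil mulr0 neg_trig_poly0.
by under eq_fun do rewrite big_cons mulrDr; exact: is_neg_trig_polyZD.
Qed.

Lemma sqint_neg_trig_poly n c : sq (neg_trig_poly n c).
Proof.
apply: (@eq_sqint _ _ _ _ _ (fun x : T => \sum_(k < n) c k * E (- (k.+1)%:Z) x)).
  by move=> x _; rewrite neg_trig_polyE.
by apply: sqint_sum => // k; apply: sqintZ => //; exact: sqint_E.
Qed.

Lemma cip_neg_trig_poly n c m : ip (neg_trig_poly n c) (E m) =
  (2 * pi)%:C * \sum_(k < n) c k * (- (k.+1)%:Z == m)%:R.
Proof.
rewrite (@eq_cip _ _ _ _ _ _ (fun x : T => \sum_(k < n) c k * E (- (k.+1)%:Z) x) _ (E m))//; last first.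
  by move=> x _; rewrite neg_trig_polyE.
rewrite cip_suml//; last 2 first.
- by move=> k; apply: sqintZ => //; exact: sqint_E.
- exact: sqint_E.
rewrite mulr_sumr; apply: eq_bigr => k _.
by rewrite cipZl; [rewrite cip_E mulrCA|exact: mc|exact: sqint_E|exact: sqint_E].
Qed.

Lemma cip_neg_trig_poly_ge0 n c (m : nat) : ip (neg_trig_poly n c) (E m) = 0.
Proof. by rewrite cip_neg_trig_poly big1 ?mulr0// => k _; rewrite mulr0. Qed.

(** The residual of the projection of [h] on these polynomials has zero Fourier coefficients: the
    negative ones by construction, the others because neither [h] nor the polynomials have any. So
    it vanishes almost everywhere. *)
Lemma neg_trig_poly_dense (h : T -> R[i]) e : sq h ->
  (forall n : nat, ip h (E n) = 0) -> 0 < e ->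
  exists n c, N (fun x => h x - neg_trig_poly n c x) < e.
Proof.
move=> sh h0 e0.
have sv v : is_neg_trig_poly v -> sq v.
  by move=> [n [c hc]]; apply: eq_sqint (sqint_neg_trig_poly n c) => x _; rewrite hc.
have V0 : is_neg_trig_poly !=set0.
  by exists (fun=> 0); exists 0%N, (fun=> 0) => x; rewrite neg_trig_poly0.
have [g [sg gapp g0]] :=
  exists_projection mc (@mu_circ_fin R) V0 sv is_neg_trig_polyZD sh.
have gae : {ae mu, forall x, circ x -> g x = 0}.
  apply: cip_E_eq0_ae => // -[m|m].
    apply: cip_approx => //; first exact: sqint_E.
    move=> e1 e10; have [v Vv hv] := gapp _ e10; exists (fun x => h x - v x); split.
    - by apply: sqintB => //; exact: sv.
    - by rewrite n2C.
    - rewrite cipBl ?h0//; [|exact: sv|exact: sqint_E].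
      have [n [c hc]] := Vv.
      rewrite (@eq_cip _ _ _ _ _ v (neg_trig_poly n c) _ (E m))//.
        by rewrite cip_neg_trig_poly_ge0 subrr.
  rewrite NegzE; apply: g0; exists m.+1, (fun k => (k == m)%:R) => x.
  rewrite neg_trig_polyE (bigD1 ord_max)//= eqxx mul1r big1 ?addr0// => k km.
  by rewrite (_ : (k == m :> nat) = false) ?mul0r//; apply/negbTE.
have [v Vv hv] := gapp _ e0; have [n [c hc]] := Vv; exists n, c.
apply: le_lt_trans hv; rewrite le_eqVlt; apply/orP; left; apply/eqP.
apply: (ae_eq_n2 mc).
- by apply: cmeasurableB; [exact: sh.1|exact: (sqint_neg_trig_poly n c).1].
- apply: cmeasurableB; last exact: sg.1.
  by apply: cmeasurableB; [exact: sh.1|exact: (sv _ Vv).1].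
- by apply: ae_mono gae => x gx cx; rewrite gx// subr0 hc.
Qed.

(** * Fejer means of a function with negative frequencies *)

Section Fejer.
Variable h : T -> R[i].
Hypothesis sh : sq h.
Hypothesis h0 : forall n : nat, ip h (E n) = 0.

Definition fcoef (k : nat) : R[i] := (2 * pi)^-1%:C * ip h (E (- (k.+1)%:Z)).
(** Since [h] has no nonnegative frequencies, this is its symmetric partial sum of order [l]. *)
Definition partial_sum l := neg_trig_poly l fcoef.

Lemma pi2_neq0 : (2 * pi : R) != 0.
Proof. by rewrite gt_eqF// mulr_gt0// pi_gt0. Qed.

Lemma cip_sub_partial_sum l (k : nat) : (k < l)%N ->
  ip (fun x => h x - partial_sum l x) (E (- (k.+1)%:Z)) = 0.
Proof.
move=> kl; rewrite cipBl//; [|exact: sqint_neg_trig_poly|exact: sqint_E].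
rewrite cip_neg_trig_poly (bigD1 (Ordinal kl))//= eqxx mulr1 big1 ?addr0; last first.
  move=> i ik; rewrite eqr_opp eqz_nat eqSS (_ : (i == k :> nat) = false) ?mulr0//.
  by apply/negbTE.
by rewrite /fcoef mulrA -rmorphM /= mulfV ?pi2_neq0// mul1r subrr.
Qed.

(** The difference of the two polynomials has frequencies between [-l] and -1, to which the residual
    of the partial sum is orthogonal. *)
Lemma partial_sum_best l m c : (m <= l)%N ->
  N (fun x => h x - partial_sum l x) <= N (fun x => h x - neg_trig_poly m c x).
Proof.
move=> ml; pose c' k := fcoef k - (if (k < m)%N then c k else 0).
have sS := sqintB mc sh (sqint_neg_trig_poly l fcoef).
have -> : N (fun x => h x - neg_trig_poly m c x) =
    N (fun x => (h x - partial_sum l x) + neg_trig_poly l c' x).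
  apply: eq_n2 => x _; rewrite (neg_trig_poly_widen _ _ ml) /partial_sum.
  rewrite !neg_trig_polyE -addrA; congr (_ + _).
  rewrite -sumrN -sumrN -big_split /=; apply: eq_bigr => k _.
  by rewrite /c' mulrBl addKr.
rewrite (n2D mc sS (sqint_neg_trig_poly l c')).
rewrite (_ : ip _ _ = 0) /= ?mulr0 ?addr0 ?lerDl ?n2_ge0//.
rewrite (@eq_cip _ _ _ _ _ _ (fun x => h x - partial_sum l x) _
  (fun x : T => \sum_(k < l) c' k * E (- (k.+1)%:Z) x))//; last first.
  by move=> x _; rewrite neg_trig_polyE.
rewrite cip_sumr//; last by move=> k; apply: sqintZ => //; exact: sqint_E.
rewrite big1// => k _; rewrite cipZr//; last exact: sqint_E.
by rewrite cip_sub_partial_sum ?mulr0.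
Qed.

Definition fejer n x := n%:R^-1 * \sum_(l < n) partial_sum l x.

Lemma is_neg_trig_poly_fejer n : is_neg_trig_poly (fejer n).
Proof.
by apply: is_neg_trig_poly_sum => l; exists l, fcoef.
Qed.

Lemma normc2_sum_le n (z : 'I_n -> R[i]) :
  normc2 (\sum_(l < n) z l) <= n%:R * \sum_(l < n) normc2 (z l).
Proof.
elim: n z => [|n ih] z; first by rewrite !big_ord0 normc2_0 mulr0.
rewrite !big_ord_recr /=; have := ih (fun l => z (widen_ord (leqnSn n) l)).
set S := \sum_(i < n) z _; set Q := \sum_(i < n) normc2 _; set w := z _.
have Q0 : 0 <= Q by apply: sumr_ge0 => i _; exact: normc2_ge0.
rewrite -[n.+1%:R]natr1; set m := n%:R => hS.
have m0 : 0 <= m by rewrite ler0n.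
have key2 : 2 * (re S * re w + im S * im w) <= Q + m * normc2 w.
  have [m00|mn0] := eqVneq m 0.
    move: hS; rewrite m00 !mul0r => hS.
    have /eqP : normc2 S = 0 by apply/eqP; rewrite eq_le hS normc2_ge0.
    by rewrite normc2_eq0 => /eqP ->; rewrite /= !mul0r !addr0 mulr0.
  have mp : 0 < m by rewrite lt_def mn0.
  have key : m * (2 * (re S * re w + im S * im w)) <= normc2 S + m ^+ 2 * normc2 w.
    rewrite !normc2E; have := sqr_ge0 (re S - m * re w).
    have := sqr_ge0 (im S - m * im w); nra.
  rewrite -(ler_pM2l mp); nra.
have -> : normc2 (S + w) = normc2 S + normc2 w + 2 * (re S * re w + im S * im w).
  by rewrite !normc2E !cE; ring.
nra.
Qed.

(** Convexity of the squared norm, applied to the average of the errors of the partial sums. *)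
Lemma n2_sub_fejer_le n : (0 < n)%N ->
  N (fun x => h x - fejer n x) <= n%:R^-1 * \sum_(l < n) N (fun x => h x - partial_sum l x).
Proof.
move=> n0; have nC : (n%:R : R[i]) != 0 by rewrite pnatr_eq0 -lt0n.
have nR : 0 < (n%:R : R) by rewrite ltr0n.
have sS l := sqintB mc sh (sqint_neg_trig_poly l fcoef).
rewrite (@eq_n2 _ _ _ _ _ _ (fun x => n%:R^-1 * \sum_(l < n) (h x - partial_sum l x))); last first.
  move=> x _; rewrite /fejer sumrB big_const_ord iter_addr addr0 mulrBr.
  by rewrite -[h x *+ n]mulr_natl mulrA mulVf// mul1r.
rewrite n2Z//; last by apply: sqint_sum => // l; exact: sS.
rewrite normc2V (_ : normc2 n%:R = n%:R ^+ 2); last first.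
  by rewrite -normc2C rmorph_nat.
rewrite expr2 invfM -mulrA ler_pM2l ?invr_gt0// ler_pdivrMl//.
have iS l := (sqint_integrable mu (sS l).1).1 (sS l).
have iSS : mu.-integrable circ (EFin \o (fun x => \sum_(l < n) normc2 (h x - partial_sum l x))).
  rewrite (_ : _ \o _ = fun x => \sum_(l < n) (normc2 (h x - partial_sum l x))%:E)%E; last first.
    by apply/funext => x /=; rewrite sumEFin.
  by apply: integrable_sum => // l _; exact: iS.
have eqS : \sum_(l < n) N (fun x => h x - partial_sum l x) =
    \int[mu]_(x in circ) \sum_(l < n) normc2 (h x - partial_sum l x).
  rewrite /n2 [RHS]/Rintegral; under [in RHS]eq_integral do rewrite -sumEFin.
  rewrite integral_sum//; last by move=> l; exact: iS.
  by rewrite -sum_fine// => l _; apply: integrable_fin_num (iS l); exact: mc.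
rewrite eqS -RintegralZl//; apply: le_Rintegral => //.
- apply/sqint_integrable.
    by apply: cmeasurable_sum => l; exact: (sS l).1.
  by apply: sqint_sum => // l; exact: sS.
- exact: integrable_funZ.
- by move=> x _; exact: normc2_sum_le.
Qed.

Lemma fejer_dense e : 0 < e ->
  exists2 n, (0 < n)%N & N (fun x => h x - fejer n x) < e.
Proof.
move=> e0; have e2 : 0 < e / 2 by lra.
have [m [c hc]] := neg_trig_poly_dense sh h0 e2.
have Nh := n2_ge0 mu circ h.
(* The first [m] partial sums contribute at most [m * N h] in total; this [n] makes their share of
   the average less than [e / 2]. *)
have [n hn] : exists n, (m%:R * N h) / (e / 2) < n%:R.
  by exists (Num.truncn ((m%:R * N h) / (e / 2))).+1; exact: truncnS_gt.
rewrite ltr_pdivrMr// in hn.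
have n0 : (0 < n)%N.
  rewrite -(ltr_nat R) -(pmulr_lgt0 _ e2) (le_lt_trans _ hn)//.
  by rewrite mulr_ge0.
exists n => //.
apply: le_lt_trans (n2_sub_fejer_le n0) _.
rewrite ltr_pdivrMl ?ltr0n//.
have small l : (m <= l)%N -> N (fun x => h x - partial_sum l x) <= e / 2.
  by move=> ml; rewrite (le_trans (partial_sum_best c ml))// ltW.
have big l : N (fun x => h x - partial_sum l x) <= N h.
  apply: (le_trans (@partial_sum_best l 0 (fun=> 0) (leq0n l))).
  by rewrite le_eqVlt; apply/orP; left; apply/eqP/eq_n2 => x _; rewrite neg_trig_poly0 subr0.
have each l : N (fun x => h x - partial_sum l x) <= (l < m)%N%:R * N h + e / 2.
  have [ml|lm] := leqP m l; first by rewrite mul0r add0r small.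
  by rewrite mul1r (le_trans (big l))// lerDl ltW.
apply: (@le_lt_trans _ _ (\sum_(l < n) ((l < m)%N%:R * N h + e / 2))).
  by apply: ler_sum => l _; exact: each.
rewrite big_split /= sumr_const card_ord -mulr_natl.
have hm : \sum_(i < n) (i < m)%N%:R * N h <= m%:R * N h.
  rewrite -mulr_suml ler_wpM2r// -natr_sum ler_nat.
  rewrite -(big_mkord xpredT (fun i => (i < m)%N : nat)) /=.
  rewrite -big_mkcond /= sum1_count.
  rewrite -size_filter /index_iota subn0.
  have := @uniq_leq_size _ [seq x <- iota 0 n | (x < m)%N] (iota 0 m).
  rewrite size_iota; apply; first by rewrite filter_uniq ?iota_uniq.
  by move=> x; rewrite mem_filter !mem_iota /= !add0n => /andP[].
move: hm hn; set S := \sum_(i < n) _; lra.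
Qed.

Lemma fejer_bounded K n x : 0 <= K -> {ae mu, forall x, circ x -> normc2 (h x) <= K} ->
  (0 < n)%N -> normc2 (fejer n x) <= K.
Proof.
move=> K0 hK n0.
(* [fejer n x] integrates [h] against the nonnegative kernel |D|^2 / (2 pi n). *)
pose D (t : T) := \sum_(k < n) (E k x * E (- (k : int)) t).
have sD : sq D.
  by apply: sqint_sum => // k; apply: sqintZ => //; exact: sqint_E.
have ND : N D = 2 * pi * n%:R.
  apply: (@complexI R); rewrite -cip_diag// /D cip_suml//; last first.
    by move=> k; apply: sqintZ => //; exact: sqint_E.
  have cD (k : 'I_n) : ip (fun t => E k x * E (- (k : int)) t) D = (2 * pi)%:C.
    rewrite /D cip_sumr//; last 2 first.
    - by move=> l; apply: sqintZ => //; exact: sqint_E.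
    - by apply: sqintZ => //; exact: sqint_E.
    rewrite (bigD1 k)//= big1 ?addr0.
      rewrite cipZl ?cipZr ?cip_E//; try exact: sqint_E.
        by rewrite eqxx mulr1 mulrA mul_conj normc2_E mul1r.
      by apply: sqintZ => //; exact: sqint_E.
    move=> l lk; rewrite cipZl ?cipZr ?cip_E//; try exact: sqint_E.
      by rewrite eqr_opp eqz_nat eq_sym (_ : (l == k :> nat) = false) ?mulr0//; apply/negbTE.
    by apply: sqintZ => //; exact: sqint_E.
  under eq_bigr do rewrite cD.
  by rewrite sumr_const card_ord [RHS]rmorphM /= rmorph_nat mulr_natr.
have Dbnd t : normc2 (D t) <= n%:R * n%:R.
  apply: le_trans (normc2_sum_le _) _; rewrite ler_wpM2l//.
  under eq_bigr do rewrite normc2M !normc2_E mulr1.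
  by rewrite sumr_const card_ord.
have shD : sq (fun t => h t * D t).
  have hb : {ae mu, forall t, circ t -> normc2 (D t) <= n%:R * n%:R}.
    by apply: aeW => t _; exact: Dbnd.
  by apply: eq_sqint (sqint_bounded_mul sh sD.1 hb) => t _; rewrite mulrC.
have NhD : N (fun t => h t * D t) <= K * N D by exact: n2_bounded_mul_le sh.1 hK.
have fD : fejer n x = (2 * pi * n%:R)^-1%:C * ip (fun t => h t * D t) D.
  have -> : ip (fun t => h t * D t) D =
      ip h (fun t => \sum_(l < n) \sum_(k < n) E (l%:Z - k%:Z) x * E (k%:Z - l%:Z) t).
    apply: eq_Cintegral => t _; rewrite -mulrA; congr (_ * _).
    apply: (canRL conjCK); rewrite rmorphM /= conjCK [RHS]exchange_big /=.
    rewrite {1}/D rmorph_sum mulr_suml; apply: eq_bigr => k _.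
    rewrite /D mulr_sumr; apply: eq_bigr => l _.
    rewrite rmorphM /= !E_conj opprK !E_add.
    by rewrite mulrACA [X in X * _]mulrC.
  rewrite cip_sumr//; last first.
    by move=> l; apply: sqint_sum => // k; apply: sqintZ => //; exact: sqint_E.
  rewrite /fejer invfM rmorphM /= -mulrA mulrCA fmorphV rmorph_nat; congr (_ * _).
  rewrite mulr_sumr; apply: eq_bigr => l _.
  rewrite cip_sumr//; last by move=> k; apply: sqintZ => //; exact: sqint_E.
  rewrite /partial_sum neg_trig_polyE.
  transitivity ((2 * pi)^-1%:C * \sum_(k < n | (k < l)%N) (E (k%:Z - l%:Z) x * ip h (E (k%:Z - l%:Z)))).
    rewrite -(big_ord_widen n (fun k => E (k%:Z - l%:Z) x * ip h (E (k%:Z - l%:Z)))); last first.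
      by rewrite ltnW.
    rewrite (reindex_inj rev_ord_inj) mulr_sumr /=; apply: eq_bigr => k _.
    rewrite /fcoef -mulrA [X in _ * X]mulrC.
    have -> : - (l - k.+1).+1%:Z = k%:Z - l%:Z by rewrite subnSK// -subzn ?opprB// ltnW.
    by [].
  (* The kernel also has terms with [k >= l], but there the frequency [k - l] is nonnegative and the
     coefficient of [h] is 0. *)
  congr (_ * _); rewrite big_mkcond; apply: eq_bigr => k _.
  rewrite cipZr//; last exact: sqint_E.
  rewrite E_conj opprB; case: ltnP => // lk.
  have -> : k%:Z - l%:Z = (k - l)%N%:Z by rewrite subzn.
  by rewrite h0 mulr0.
rewrite fD normc2M normc2C exprVn.
have p0 : 0 < (2 * pi * n%:R : R) by rewrite !mulr_gt0 ?pi_gt0 ?ltr0n.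
rewrite ler_pdivrMl ?exprn_gt0//.
(* Cauchy-Schwarz for [h D] and [D] keeps the constant [K] itself, because [N D] is exactly
   [2 pi n]. *)
apply: le_trans (CauchySchwarz mc shD sD) _.
rewrite ND; apply: le_trans (ler_wpM2r (ltW p0) NhD) _.
by rewrite ND le_eqVlt; apply/orP; left; apply/eqP; ring.
Qed.

End Fejer.
End AnalyticApproximation.

(** * Bounded functions in spaces with integrable weight *)

Section BoundedAnalytic.
Context {R : realType}.

Local Notation mu := (@lebesgue_measure R).
Local Notation circ := (@circ R).
Local Notation sq := (sqint mu circ).
Local Notation N := (n2 mu circ).
Local Notation ip := (cip mu circ).
Local Notation T := (measurableTypeR R).
Let mc : measurable (circ : set T) := @mcirc R.

Lemma integral_excess_small (f : T -> R) e : (forall x, circ x -> 0 <= f x) ->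
  mu.-integrable circ (EFin \o f) -> 0 < e ->
  exists n : nat, (\int[mu]_(x in circ) (f x - Num.min (f x) n%:R)%:E < e%:E)%E.
Proof.
move=> f0 hf e0.
have mf : measurable_fun circ f by apply/measurable_EFinP; exact: measurable_int hf.
pose F (n : nat) (x : T) := (f x - Num.min (f x) n%:R)%:E.
have mF n : measurable_fun circ (F n).
  by apply/measurable_EFinP; apply: measurable_funB => //; exact: measurable_minr.
have mz : measurable_fun circ (cst 0%E : T -> \bar R) by exact: measurable_cst.
have hlim : {ae mu, forall x, circ x -> F n x @[n --> \oo] --> (cst 0%E : T -> \bar R) x}.
  apply: aeW => x cx; apply: cvg_near_cst.
  exists (Num.truncn (f x)).+1 => // n /= hn.
  rewrite /F min_l ?subrr// ltW// (lt_le_trans (truncnS_gt _))//.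
  by rewrite ler_nat.
have hb : {ae mu, forall x n, circ x -> (`|F n x| <= (EFin \o f) x)%E}.
  apply: aeW => x n cx; rewrite /F lee_fin ger0_norm ?subr_ge0 ?ge_min ?lexx//.
  by rewrite lerBlDr lerDl le_min f0 /=.
have [_ _ /=] := @dominated_convergence _ _ _ mu circ mc F _ _ mF mz hlim hf hb.
rewrite integral0_eq// => h.
have := h => /fine_cvgP [h1 h2].
have /cvgr_lt/(_ _ e0) := h2.
move=> h3; near \oo => n; exists n.
have h1n : (\int[mu]_(x in circ) F n x)%E \is a fin_num by near: n.
have h3n : fine (\int[mu]_(x in circ) F n x)%E < e by near: n.
by rewrite -[X in (X < _)%E](fineK h1n) lte_fin.
Unshelve. all: by end_near.
Qed.

(** The weight is cut at height [n]. Below it the Fejer means converge in mean square; above it the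
    bound [4 K] on the squared error is enough, since the excess of [f] has small integral. *)
Lemma bounded_L2minus (h : T -> R[i]) (K : R) (f : R -> R) : 0 <= K ->
  cmeasurable circ h -> {ae mu, forall x, circ x -> normc2 (h x) <= K} ->
  (forall n : nat, ip h (E n) = 0) -> density f -> L2minus f h.
Proof.
move=> K0 mh hK h0 [f0 hf].
have mf : measurable_fun (circ : set T) f by apply/measurable_EFinP; exact: measurable_int hf.
have sh : sq h.
  have s1 : sq (fun=> 1).
    by apply: eq_sqint (sqint_E 0) => x _; rewrite E0.
  by apply: eq_sqint (sqint_bounded_mul s1 mh hK) => x _; rewrite mulr1.
have mw (g : T -> R[i]) : cmeasurable circ g ->
    measurable_fun circ (fun x => (normc2 (g x) * f x)%:E).
  by move=> mg; apply/measurable_EFinP; apply: measurable_funM => //; exact: measurable_normc2.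
have w0 (g : T -> R[i]) x : circ x -> (0 <= (normc2 (g x) * f x)%:E)%E.
  by move=> cx; rewrite lee_fin mulr_ge0 ?normc2_ge0 ?f0.
have f0' x : circ x -> (0 <= (f x)%:E)%E by move=> cx; rewrite lee_fin f0.
have mfE : measurable_fun (circ : set T) (EFin \o f) by exact/measurable_EFinP.
have ifin : (\int[mu]_(x in circ) (f x)%:E < +oo)%E.
  have /integrableP[_] := hf; apply: le_lt_trans.
  apply: ge0_le_integral => //; first exact: measurableT_comp.
  by move=> x cx; rewrite lee_fin ler_norm.
split.
  split; first exact: mh.
  apply: (@le_lt_trans _ _ (\int[mu]_(x in circ) (K%:E * (f x)%:E))%E); last first.
    by rewrite ge0_integralZl// lte_mul_pinfty.
  apply: ae_ge0_le_integral => //; first exact: (w0 h).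
  - exact: mw.
  - by move=> x cx; rewrite mule_ge0// lee_fin// f0.
  - exact: measurable_funeM.
  - apply: ae_mono hK => x hx cx; rewrite -EFinM lee_fin.
    by apply: ler_wpM2r; [exact: f0|exact: hx].
move=> e e0.
(* The height [n] is fixed before the Fejer mean, because the precision required of that mean
   depends on [n]. *)
have e1 : 0 < e / (2 * (4 * K + 1)) by rewrite divr_gt0//; lra.
have [n hn] := integral_excess_small f0 hf e1.
have e2 : 0 < e / (2 * (n%:R + 1)) by rewrite divr_gt0// mulr_gt0// ltr_wpDl.
have [m m0 hm] := fejer_dense sh h0 e2.
have [k [c hc]] := is_neg_trig_poly_fejer h m.
exists k, c.
pose g x := h x - fejer h m x.
have mg : cmeasurable circ g.
  apply: cmeasurableB => //; apply: eq_cmeasurable (sqint_neg_trig_poly k c).1.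
  by move=> x _; rewrite hc.
have sg : sq g.
  apply: sqintB => //; apply: eq_sqint (sqint_neg_trig_poly k c).
  by move=> x _; rewrite hc.
rewrite (_ : wnorm2 f _ = wnorm2 f g); last first.
  by rewrite /wnorm2; apply: eq_integral => x _; rewrite /g hc.
have fb x := fejer_bounded sh h0 x K0 hK m0.
have gK : {ae mu, forall x, circ x -> normc2 (g x) <= 4 * K}.
  apply: ae_mono hK => x hx cx; have := hx cx; rewrite /g.
  have := fb x.
  have := normc2D_le (h x) (- fejer h m x); rewrite normc2N; lra.
have mex : measurable_fun (circ : set T) (fun x => (f x - Num.min (f x) n%:R)%:E).
  by apply/measurable_EFinP; apply: measurable_funB => //; exact: measurable_minr.
have ex0 x : circ x -> (0 <= (f x - Num.min (f x) n%:R)%:E)%E.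
  by move=> cx; rewrite lee_fin subr_ge0 ge_min lexx.
have mng : measurable_fun circ (fun x => (normc2 (g x))%:E).
  by apply/measurable_EFinP; exact: measurable_normc2.
have ng0 x : circ x -> (0 <= (normc2 (g x))%:E)%E by rewrite lee_fin normc2_ge0.
have K4 : (0 <= (4 * K)%:E)%E by rewrite lee_fin; lra.
have n0' : (0 <= (n%:R : R)%:E)%E by rewrite lee_fin.
apply: (@le_lt_trans _ _ (\int[mu]_(x in circ) (n%:R%:E * (normc2 (g x))%:E +
    (4 * K)%:E * (f x - Num.min (f x) n%:R)%:E))%E).
  apply: ae_ge0_le_integral => //; first exact: (w0 g).
  - exact: mw.
  - by move=> x cx; rewrite adde_ge0// mule_ge0// ?ng0 ?ex0.
  - by apply: emeasurable_funD; exact: measurable_funeM.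
  - apply: ae_mono gK => x hx cx; rewrite -!EFinM -EFinD lee_fin.
    have := hx cx; have := f0 _ cx; have := normc2_ge0 (g x).
    have : Num.min (f x) n%:R <= n%:R by rewrite ge_min lexx orbT.
    have : Num.min (f x) n%:R <= f x by rewrite ge_min lexx.
    have : 0 <= Num.min (f x) n%:R by rewrite le_min f0.
    move: (Num.min _ _) (normc2 _) => b s; nra.
rewrite ge0_integralD//; first last.
- exact: measurable_funeM.
- by move=> x cx; rewrite mule_ge0// ex0.
- exact: measurable_funeM.
- by move=> x cx; rewrite mule_ge0// ng0.
rewrite !ge0_integralZl// integral_n2// -EFinM.
have r0 : (0 <= \int[mu]_(x in circ) (f x - Num.min (f x) n%:R)%:E)%E by exact: integral_ge0.
move: hn r0; case: (\int[mu]_(x in circ) _)%E => // r; rewrite lte_fin lee_fin => hr r0.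
rewrite -EFinM -EFinD lte_fin.
have h1 : n%:R * N g <= e / 2.
  have hm' := ltW hm; rewrite ler_pdivlMr ?mulr_gt0 ?ltr_wpDl// in hm'.
  have := n2_ge0 mu circ g; rewrite -/g in hm' *; have := ler0n R n; nra.
have h2 : 4 * K * r < e / 2.
  rewrite ltr_pdivlMr in hr; last by lra.
  nra.
lra.
Qed.

End BoundedAnalytic.

(** * Hankel forms and their con-eigenvectors *)

Section ComplexLimits.
Context {R : realType}.
Local Notation normc := (@ComplexField.Normc.normc R).

(** The two parts converge separately, to match [csum], which is built from two real limits. *)
Definition ccvg (I : Type) (F : set_system I) (s : I -> R[i]) (z : R[i]) :=
  re (s i) @[i --> F] --> re z /\ im (s i) @[i --> F] --> im z.

Section Filter.
Variables (I : Type) (F : set_system I).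
Context {FF : Filter F}.
Implicit Types s t : I -> R[i].

Lemma ccvg_cst z : ccvg F (fun=> z) z.
Proof. by split; exact: cvg_cst. Qed.

Lemma ccvgD s t y z : ccvg F s y -> ccvg F t z -> ccvg F (fun i => s i + t i) (y + z).
Proof.
move=> [s1 s2] [t1 t2]; split.
- by rewrite reD; under eq_fun do rewrite reD; exact: cvgD.
- by rewrite imD; under eq_fun do rewrite imD; exact: cvgD.
Qed.

Lemma ccvgM s t y z : ccvg F s y -> ccvg F t z -> ccvg F (fun i => s i * t i) (y * z).
Proof.
move=> [s1 s2] [t1 t2]; split.
- by rewrite reM; under eq_fun do rewrite reM; apply: cvgB; exact: cvgM.
- by rewrite imM; under eq_fun do rewrite imM; apply: cvgD; exact: cvgM.
Qed.

Lemma ccvgN s z : ccvg F s z -> ccvg F (fun i => - s i) (- z).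
Proof.
move=> [s1 s2]; split.
- by rewrite reN; under eq_fun do rewrite reN; exact: cvgN.
- by rewrite imN; under eq_fun do rewrite imN; exact: cvgN.
Qed.

Lemma ccvg_conj s z : ccvg F s z -> ccvg F (fun i => Num.conj (s i)) (Num.conj z).
Proof.
move=> [s1 s2]; split.
- by rewrite re_conj; under eq_fun do rewrite re_conj.
- by rewrite im_conj; under eq_fun do rewrite im_conj; exact: cvgN.
Qed.

Lemma ccvg_sum (J : Type) (r : seq J) (P : pred J) (s : J -> I -> R[i]) (z : J -> R[i]) :
  (forall j, ccvg F (s j) (z j)) ->
  ccvg F (fun i => \sum_(j <- r | P j) s j i) (\sum_(j <- r | P j) z j).
Proof.
move=> h; elim: r => [|j r ih].
  by rewrite big_nil; under eq_fun do rewrite big_nil; exact: ccvg_cst.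
rewrite big_cons; under eq_fun do rewrite big_cons.
by case: (P j) => //; exact: ccvgD.
Qed.

Lemma cvg_normc2 s z : ccvg F s z -> normc2 (s i) @[i --> F] --> normc2 z.
Proof.
move=> [s1 s2]; rewrite normc2E !expr2; under eq_fun do rewrite normc2E !expr2.
by apply: cvgD; exact: cvgM.
Qed.

(** Interchange of limits: it carries limits of finite sums over to series whose tails are small
    uniformly in [i]. *)
Lemma cvg_unif_approx (s : I -> R) (l : R) :
  (forall e, 0 < e -> exists x l', [/\ forall i, `|s i - x i| <= e,
     x @ F --> l' & `|l' - l| <= e]) -> s @ F --> l.
Proof.
move=> h; apply/cvgrPdist_le => e e0.
have [|x [l' [h1 h2 h3]]] := h (e / 3); first by lra.
have e3 : 0 < e / 3 by lra.
have /cvgrPdist_le/(_ _ e3) := h2; apply: filterS => i hi.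
move: (h1 i) hi h3; rewrite !ler_norml => /andP[a1 a2] /andP[a3 a4] /andP[a5 a6].
by apply/andP; split; lra.
Qed.

Lemma normc_ge0 (z : R[i]) : 0 <= normc z.
Proof. by case: z => a b; exact: sqrtr_ge0. Qed.

Lemma normr_re_le (z : R[i]) : `|re z| <= normc z.
Proof.
rewrite -(ler_pXn2r (n := 2))// ?nnegrE ?normc_ge0//.
by rewrite -[leRHS]/(normc2 z) normc2E real_normK ?num_real// lerDl sqr_ge0.
Qed.

Lemma normr_im_le (z : R[i]) : `|im z| <= normc z.
Proof.
rewrite -(ler_pXn2r (n := 2))// ?nnegrE ?normc_ge0//.
by rewrite -[leRHS]/(normc2 z) normc2E real_normK ?num_real// lerDr sqr_ge0.
Qed.

Lemma ccvg_unif_approx s z :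
  (forall e, 0 < e -> exists x y, [/\ forall i, normc (s i - x i) <= e,
     ccvg F x y & normc (y - z) <= e]) -> ccvg F s z.
Proof.
move=> h; split; apply: cvg_unif_approx => e e0;
    have [x [y [h1 [c1 c2] h2]]] := h _ e0.
- exists (fun i => re (x i)), (re y); split => //.
  + by move=> i; rewrite -reN -reD (le_trans (normr_re_le _)).
  + by rewrite -reN -reD (le_trans (normr_re_le _)).
- exists (fun i => im (x i)), (im y); split => //.
  + by move=> i; rewrite -imN -imD (le_trans (normr_im_le _)).
  + by rewrite -imN -imD (le_trans (normr_im_le _)).
Qed.

End Filter.

Lemma normcD_le (x y : R[i]) : normc (x + y) <= normc x + normc y.
Proof. by have := ler_normD x y; rewrite lecE /= => /andP[]. Qed.

Lemma normc_sum_le (J : Type) (r : seq J) (P : pred J) (s : J -> R[i]) :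
  normc (\sum_(j <- r | P j) s j) <= \sum_(j <- r | P j) normc (s j).
Proof.
elim/big_ind2 : _ => //; first by rewrite ComplexField.Normc.normc0.
by move=> x1 x2 y1 y2 h1 h2; rewrite (le_trans (normcD_le _ _))// lerD.
Qed.

Lemma csum_ccvg (u : nat -> R[i]) z :
  ccvg \oo (fun n => \sum_(k < n) u k) z -> csum u = z.
Proof.
move=> [h1 h2]; apply: complexP; rewrite /csum /=; apply: cvg_lim => //.
- apply: cvg_trans h1; apply: near_eq_cvg; apply: nearW => n.
  by rewrite /series /= re_sum big_mkord.
- apply: cvg_trans h2; apply: near_eq_cvg; apply: nearW => n.
  by rewrite /series /= im_sum big_mkord.
Qed.

(** [W] is any bound of the partial sums of [w], not necessarily their limit. The real and the
    imaginary tails are each at most [W] minus the partial sum, whence the factor 2. *)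
Lemma csum_dominated (u : nat -> R[i]) (w : nat -> R) (W : R) :
  (forall n, normc (u n) <= w n) -> (forall n, \sum_(k < n) w k <= W) ->
  ccvg \oo (fun n => \sum_(k < n) u k) (csum u) /\
  forall L, normc (csum u - \sum_(k < L) u k) <= 2 * (W - \sum_(k < L) w k).
Proof.
move=> uw hW.
have w0 n : 0 <= w n by exact: le_trans (normc_ge0 _) (uw n).
have real_case (v : nat -> R) : (forall n, `|v n| <= w n) ->
    cvgn (series v) /\ forall L, `|limn (series v) - \sum_(k < L) v k| <= W - \sum_(k < L) w k.
  move=> vw.
  have cw : cvgn (series w).
    apply: nondecreasing_is_cvgn; first exact: nondecreasing_series.
    by exists W => _ [n _ <-]; rewrite /series /= big_mkord.
  have cv : cvgn (series v).
    by apply: normed_cvg; apply: (series_le_cvg _ w0 vw cw) => n; exact: normr_ge0.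
  split => // L.
  have d1 n : (L <= n)%N -> `|series v n - \sum_(k < L) v k| <= W - \sum_(k < L) w k.
    move=> Ln; have -> : series v n - \sum_(k < L) v k = \sum_(L <= k < n) v k.
      by rewrite /series /= -(big_mkord xpredT v) (big_cat_nat (leq0n L) Ln) /= addrAC subrr add0r.
    apply: le_trans (ler_norm_sum _ _ _) _.
    apply: (@le_trans _ _ (\sum_(L <= k < n) w k)).
      by apply: ler_sum => k _.
    rewrite lerBrDl; apply: le_trans (hW n).
    by rewrite -!(big_mkord xpredT w) -(big_cat_nat (leq0n L) Ln)/=.
  have lim1 : `|series v n - \sum_(k < L) v k| @[n --> \oo] --> `|limn (series v) - \sum_(k < L) v k|.
    by apply: cvg_norm; apply: cvgB => //; exact: cvg_cst.
  apply: (cvgr_to_le lim1).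
  by exists L.
have [c1 t1] := real_case (fun n => re (u n)) (fun n => le_trans (normr_re_le _) (uw n)).
have [c2 t2] := real_case (fun n => im (u n)) (fun n => le_trans (normr_im_le _) (uw n)).
split.
  split; rewrite /csum /=.
  - apply: cvg_trans c1; apply: near_eq_cvg; apply: nearW => n.
    by rewrite /series /= re_sum big_mkord.
  - apply: cvg_trans c2; apply: near_eq_cvg; apply: nearW => n.
    by rewrite /series /= im_sum big_mkord.
move=> L; have := t1 L; have := t2 L; set z := csum u - _ => h2 h1.
have hz : normc z <= `|re z| + `|im z|.
  rewrite -(ler_pXn2r (n := 2))// ?nnegrE ?normc_ge0 ?addr_ge0//.
  rewrite -[leLHS]/(normc2 z) normc2E sqrrD !real_normK ?num_real//.
  by rewrite [leRHS]addrAC lerDl mulrn_wge0// mulr_ge0.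
apply: le_trans hz _; rewrite mulr_natl mulr2n lerD//.
- by rewrite reD reN re_sum.
- by rewrite imD imN im_sum.
Qed.

End ComplexLimits.

(** * Tails of the summable sequence and of the Hankel operator *)

Section Summable.
Context {R : realType}.
Local Notation normc := (@ComplexField.Normc.normc R).
Variable a : nat -> R[i].
Hypothesis ha : (\sum_(0 <= j <oo) (normc (a j))%:E < +oo)%E.

Definition l1norm : R := fine (\sum_(0 <= j <oo) (normc (a j))%:E)%E.
Definition l1tail n : R := l1norm - \sum_(j < n) normc (a j).

Lemma l1_le n : \sum_(j < n) normc (a j) <= l1norm.
Proof.
rewrite -lee_fin /l1norm fineK; last first.
  rewrite ge0_fin_numE//; apply: nneseries_ge0 => j _ _; rewrite lee_fin.
  exact: normc_ge0.
rewrite -sumEFin -(big_mkord xpredT (fun j => (normc (a j))%:E)).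
by apply: nneseries_lim_ge => j _; rewrite lee_fin normc_ge0.
Qed.

Lemma l1tail_ge0 n : 0 <= l1tail n.
Proof. by rewrite subr_ge0 l1_le. Qed.

Lemma l1tail_cvg : l1tail n @[n --> \oo] --> (0 : R).
Proof.
have h : (\sum_(0 <= j < n) (normc (a j))%:E)%E @[n --> \oo] -->
    (\sum_(0 <= j <oo) (normc (a j))%:E)%E.
  apply: (@is_cvg_nneseries R (fun j => (normc (a j))%:E) xpredT) => j _ _.
  by rewrite lee_fin normc_ge0.
have fn : (\sum_(0 <= j <oo) (normc (a j))%:E)%E \is a fin_num.
  rewrite ge0_fin_numE//; apply: nneseries_ge0 => j _ _; rewrite lee_fin.
  exact: normc_ge0.
rewrite -(subrr l1norm); apply: cvgB; first exact: cvg_cst.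
rewrite -[X in _ --> X](fineK fn) -/l1norm in h.
rewrite (_ : (fun n => \sum_(j < n) normc (a j)) =
    fine \o (fun n => \sum_(0 <= j < n) (normc (a j))%:E)%E); first exact: fine_cvg.
by apply/funext => n /=; rewrite sumEFin /= big_mkord.
Qed.

Lemma l1tail_lt e : 0 < e -> exists n, l1tail n < e.
Proof.
by move=> e0; have /cvgr_lt/(_ _ e0) [n _ /(_ n (leqnn n)) h] := l1tail_cvg; exists n.
Qed.

Lemma l1_shift_le k K n :
  \sum_(l < n | (K <= k + l)%N) normc (a (k + l)) <= l1tail K.
Proof.
have h m : \sum_(l < m | (K <= k + l)%N) normc (a (k + l)) <=
    \sum_(K <= j < k + m) normc (a j).
  elim: m => [|m ih].
    by rewrite big_ord0; apply: sumr_ge0 => j _; exact: normc_ge0.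
  rewrite big_mkcond big_ord_recr -big_mkcond /= addnS.
  have [Kkm|kmK] := leqP K (k + m); first by rewrite big_nat_recr//= lerD2r.
  by rewrite addr0 (le_trans ih)// !big_geq// ltnW.
apply: le_trans (h n) _; rewrite /l1tail lerBrDl.
have [Kkn|knK] := leqP K (k + n).
  apply: le_trans (l1_le (k + n)).
  rewrite -!(big_mkord xpredT (fun j => normc (a j))).
  by rewrite (big_cat_nat (leq0n K) Kkn).
by rewrite [X in _ + X]big_geq ?addr0 ?l1_le// ltnW.
Qed.

Lemma normcM (x y : R[i]) : normc (x * y) = normc x * normc y.
Proof. exact: ComplexField.Normc.normcM. Qed.

(** For [l >= L] the index [k + l] is at least [L], so the tail of [a] bounds the error uniformly in
    [k] and in all sequences with the same bound [b]. Passing to coordinatewise limits relies on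
    this uniformity. *)
Lemma hankel_approx (d : nat -> R[i]) b k : (forall l, normc (d l) <= b) ->
  ccvg \oo (fun n => \sum_(l < n) a (k + l) * d l) (hankel a d k) /\
  forall L, normc (hankel a d k - \sum_(l < L) a (k + l) * d l) <= 2 * b * l1tail L.
Proof.
move=> db; have b0 : 0 <= b by exact: le_trans (normc_ge0 _) (db 0%N).
pose w l := b * normc (a (k + l)).
have uw l : normc (a (k + l) * d l) <= w l.
  by rewrite normcM mulrC /w ler_wpM2r// normc_ge0.
have hW L n : \sum_(l < n) w l <= \sum_(l < L) w l + b * l1tail L.
  have w0 l : 0 <= w l by rewrite mulr_ge0 ?normc_ge0.
  rewrite (bigID (fun l : 'I_n => (l < L)%N)) /=; apply: lerD.
    have [nL|Ln] := leqP n L.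
      apply: (@le_trans _ _ (\sum_(l < n) w l)).
        by rewrite [leLHS]big_mkcond; apply: ler_sum => l _; case: ifP.
      rewrite (big_ord_widen _ w nL) [leLHS]big_mkcond.
      by apply: ler_sum => l _; case: ifP.
    by rewrite -(big_ord_widen _ w (ltnW Ln)).
  rewrite -mulr_sumr ler_wpM2l//; apply: le_trans (l1_shift_le k L n).
  rewrite [leLHS]big_mkcond [leRHS]big_mkcond /=; apply: ler_sum => l _.
  rewrite -leqNgt; case: ifP => [Ll|_].
    by rewrite ifT// (leq_trans Ll)// leq_addl.
  by case: ifP => // _; exact: normc_ge0.
split; first by have [] := csum_dominated uw (hW 0%N).
move=> L; have [_ /(_ L)] := csum_dominated uw (hW L).
by rewrite addrAC subrr add0r mulrA.
Qed.

End Summable.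

(** * The Hankel quadratic form on finite sequences *)

Section HankelForm.
Context {R : realType}.
Local Notation normc := (@ComplexField.Normc.normc R).
Variable a : nat -> R[i].
Hypothesis ha : (\sum_(0 <= j <oo) (normc (a j))%:E < +oo)%E.

Definition hform n (c e : nat -> R[i]) :=
  \sum_(k < n) \sum_(l < n) a (k + l) * (c k * e l).
Definition fnorm2 n (c : nat -> R[i]) : R := \sum_(k < n) normc2 (c k).

Lemma fnorm2_ge0 n c : 0 <= fnorm2 n c.
Proof. by apply: sumr_ge0 => k _; exact: normc2_ge0. Qed.

(** Schur's test: [|c k c l|] is at most the half sum of the squares, and the kernel is symmetric
    with row sums bounded by the tail of [a]. *)
Lemma hform_tail_le n (c : nat -> R[i]) K :
  normc (\sum_(k < n) \sum_(l < n | (K <= k + l)%N) a (k + l) * (c k * c l)) <=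
  l1tail a K * fnorm2 n c.
Proof.
have t1 : normc (\sum_(k < n) \sum_(l < n | (K <= k + l)%N) a (k + l) * (c k * c l)) <=
    \sum_(k < n) \sum_(l < n | (K <= k + l)%N)
      (normc (a (k + l)) * normc2 (c k) / 2 + normc (a (k + l)) * normc2 (c l) / 2).
  apply: le_trans (normc_sum_le _ _ _) _; apply: ler_sum => k _.
  apply: le_trans (normc_sum_le _ _ _) _; apply: ler_sum => l _.
  rewrite !normcM; have na0 := normc_ge0 (a (k + l)).
  rewrite -[normc2 (c k)]/(normc (c k) ^+ 2) -[normc2 (c l)]/(normc (c l) ^+ 2).
  have := sqr_ge0 (normc (c k) - normc (c l)); nra.
apply: le_trans t1 _.
under eq_bigr do rewrite big_split /=.
rewrite big_split /=.
have sw : \sum_(k < n) \sum_(l < n | (K <= k + l)%N) normc (a (k + l)) * normc2 (c l) / 2 =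
    \sum_(k < n) \sum_(l < n | (K <= k + l)%N) normc (a (k + l)) * normc2 (c k) / 2.
  rewrite (exchange_big_dep xpredT) //=; apply: eq_bigr => k _.
  by apply: eq_big => [l|l _]; rewrite addnC.
rewrite sw -big_split /=.
rewrite /fnorm2 mulr_sumr; apply: ler_sum => k _.
rewrite -big_split /=.
under eq_bigr do rewrite -splitr.
by rewrite -mulr_suml ler_wpM2r ?normc2_ge0// l1_shift_le.
Qed.

Lemma re_hform_le n c : re (hform n c c) <= l1norm a * fnorm2 n c.
Proof.
apply: le_trans (ler_norm _) _; apply: le_trans (normr_re_le _) _.
have := hform_tail_le n c 0; rewrite /l1tail big_ord0 subr0.
by apply: le_trans; rewrite le_eqVlt; apply/orP; left.
Qed.

Lemma hform_scale (r : R) n c :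
  hform n (fun k => r%:C * c k) (fun k => r%:C * c k) = (r ^+ 2)%:C * hform n c c.
Proof.
rewrite /hform mulr_sumr; apply: eq_bigr => k _; rewrite mulr_sumr.
by apply: eq_bigr => l _; rewrite rmorphXn /=; ring.
Qed.

Lemma fnorm2_scale (z : R[i]) n c : fnorm2 n (fun k => z * c k) = normc2 z * fnorm2 n c.
Proof. by rewrite /fnorm2 mulr_sumr; apply: eq_bigr => k _; rewrite normc2M. Qed.

(** A unimodular factor on [c] rotates the form by its square, so the real part has the same
    supremum as the modulus. *)
Definition hsup : R := sup [set x | exists n c, fnorm2 n c <= 1 /\ x = re (hform n c c)].

Let S : set R := [set x | exists n c, fnorm2 n c <= 1 /\ x = re (hform n c c)].

Lemma l1norm_ge0 : 0 <= l1norm a.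
Proof. by have := l1_le ha 0; rewrite big_ord0. Qed.

Lemma hsup_has_sup : has_sup S.
Proof.
split; first by exists 0, 0%N, (fun=> 0); rewrite /hform /fnorm2 !big_ord0; split.
exists (l1norm a) => _ [n [c [hc ->]]].
apply: le_trans (re_hform_le n c) _.
have := l1norm_ge0; have := fnorm2_ge0 n c; nra.
Qed.

Lemma re_hform_le_hsup n c : re (hform n c c) <= hsup * fnorm2 n c.
Proof.
have [f0|f0] := eqVneq (fnorm2 n c) 0.
  by have := re_hform_le n c; rewrite f0 !mulr0.
have fp : 0 < fnorm2 n c by rewrite lt_def f0 fnorm2_ge0.
pose r := Num.sqrt (fnorm2 n c)^-1.
have r2 : r ^+ 2 = (fnorm2 n c)^-1 by rewrite sqr_sqrtr// invr_ge0 ltW.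
have h : re (hform n (fun k => r%:C * c k) (fun k => r%:C * c k)) <= hsup.
  apply: ub_le_sup; first exact: hsup_has_sup.2.
  exists n, (fun k => r%:C * c k); split => //.
  by rewrite fnorm2_scale normc2C r2 mulVf.
rewrite hform_scale reM reC imC mul0r subr0 r2 in h.
by rewrite -ler_pdivrMr// mulrC.
Qed.

End HankelForm.

(** * Bounded families along an ultrafilter *)

Section UltraLimit.
Context {R : realType}.

(** The cluster point given by compactness is a limit, because an ultrafilter contains each set or
    its complement. One ultrafilter then serves all coordinates of a sequence at once, without
    diagonal extraction. *)
Lemma ultra_cvg_bounded (I : Type) (U : set_system I) (x : I -> R) (M : R) :
  UltraFilter U -> (forall i, `|x i| <= M) -> exists l : R, x @ U --> l.
Proof.
move=> UU xM; have UP : ProperFilter U by exact: ultra_proper.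
have cpt := @segment_compact R (- M) M.
have xU : (x @ U) `[- M, M]%classic.
  apply: (@filterE _ U _ (fun i => `[- M, M]%classic (x i))) => i.
  by rewrite /= in_itv /= -ler_norml.
have [p [_ clp]] := cpt (x @ U) _ xU.
exists p => B Bp.
have [//|nB] := in_ultra_setVsetC (x @^-1` B) UU.
have [y [/= yB By]] := clp (~` B) B nB Bp.
by exfalso; exact: yB.
Qed.

Lemma ultra_ccvg_bounded (I : Type) (U : set_system I) (x : I -> R[i]) (M : R) :
  UltraFilter U -> (forall i, normc2 (x i) <= M) -> exists l : R[i], ccvg U x l.
Proof.
move=> UU xM.
have bnd (u : R) (i : I) : u ^+ 2 <= normc2 (x i) -> `|u| <= M + 1.
  move=> h; rewrite ler_norml; have := xM i; have := sqr_ge0 (u - 1); have := sqr_ge0 (u + 1).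
  by move=> h1 h2 h3; apply/andP; split; nra.
have [|l1 h1] := @ultra_cvg_bounded _ _ (fun i => re (x i)) (M + 1) UU.
  by move=> i; apply: (@bnd _ i); rewrite normc2E lerDl sqr_ge0.
have [|l2 h2] := @ultra_cvg_bounded _ _ (fun i => im (x i)) (M + 1) UU.
  by move=> i; apply: (@bnd _ i); rewrite normc2E lerDr sqr_ge0.
by exists (l1 +i* l2); split.
Qed.

End UltraLimit.

Lemma cvg_sum_seq (R : realType) (I : Type) (F : set_system I) {FF : Filter F}
    (J : Type) (r : seq J) (s : J -> I -> R) (z : J -> R) :
  (forall j, s j i @[i --> F] --> z j) ->
  \sum_(j <- r) s j i @[i --> F] --> \sum_(j <- r) z j.
Proof.
move=> h; elim: r => [|j r ih].
  by rewrite big_nil; under eq_fun do rewrite big_nil; exact: cvg_cst.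
by rewrite big_cons; under eq_fun do rewrite big_cons; exact: cvgD.
Qed.

(** * Extremal vectors of the Hankel form *)

Section Takagi.
Context {R : realType}.
Local Notation normc := (@ComplexField.Normc.normc R).
Variable a : nat -> R[i].
Hypothesis ha : (\sum_(0 <= j <oo) (normc (a j))%:E < +oo)%E.

Lemma sum_ord_support (V : zmodType) n m (F : nat -> V) : (n <= m)%N ->
  (forall k, (n <= k)%N -> F k = 0) -> \sum_(k < m) F k = \sum_(k < n) F k.
Proof.
move=> nm F0; rewrite (big_ord_widen _ F nm) [RHS]big_mkcond; apply: eq_bigr => k _.
by case: ltnP => // /F0.
Qed.

Lemma hform_support n m c : (n <= m)%N -> (forall k, (n <= k)%N -> c k = 0) ->
  hform a m c c = hform a n c c.
Proof.
move=> nm c0; rewrite /hform.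
rewrite (@sum_ord_support _ n m (fun k => \sum_(l < m) a (k + l)%N * (c k * c l)))//.
  apply: eq_bigr => k _.
  rewrite (@sum_ord_support _ n m (fun l => a (k + l)%N * (c k * c l)))// => l nl.
  by rewrite (c0 l nl) !mulr0.
by move=> k nk; rewrite big1// => l _; rewrite (c0 k nk) mul0r mulr0.
Qed.

Lemma fnorm2_support n m (c : nat -> R[i]) : (n <= m)%N ->
  (forall k, (n <= k)%N -> c k = 0) -> fnorm2 m c = fnorm2 n c.
Proof.
move=> nm c0; rewrite /fnorm2 (@sum_ord_support _ n m (fun k => normc2 (c k)))// => k nk.
by rewrite c0// normc2_0.
Qed.

Lemma hankel_support n c l : (forall k, (n <= k)%N -> c k = 0) ->
  hankel a c l = \sum_(k < n) a (l + k) * c k.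
Proof.
move=> c0; apply: csum_ccvg.
have h m : (n <= m)%N ->
    \sum_(k < m) a (l + k) * c k = \sum_(k < n) a (l + k) * c k.
  move=> nm; rewrite (@sum_ord_support _ n m (fun k => a (l + k)%N * c k))// => k nk.
  by rewrite c0// mulr0.
by split; apply: cvg_near_cst; exists n => // m /= nm; rewrite h.
Qed.

Definition single (l : nat) (w : R[i]) (k : nat) : R[i] := if k == l then w else 0.

Lemma sum_single n l w (F : nat -> R[i]) : (l < n)%N ->
  \sum_(k < n) F k * single l w k = F l * w.
Proof.
move=> ln; rewrite (bigD1 (Ordinal ln))//= /single eqxx big1 ?addr0// => k kl.
rewrite ifF ?mulr0//; apply/negbTE; apply: contra kl => /eqP kl.
by apply/eqP/val_inj.
Qed.

Lemma hform_add_single n c l w : (l < n)%N -> (forall k, (n <= k)%N -> c k = 0) ->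
  hform a n (fun k => c k + single l w k) (fun k => c k + single l w k) =
  hform a n c c + 2 * (w * hankel a c l) + w ^+ 2 * a (l + l).
Proof.
move=> ln c0; rewrite (hankel_support l c0) /hform.
have -> : \sum_(k < n) \sum_(k' < n) a (k + k') *
    ((c k + single l w k) * (c k' + single l w k')) =
    \sum_(k < n) (\sum_(k' < n) a (k + k') * (c k * c k') +
    (a (k + l) * c k * w +
    ((\sum_(k' < n) a (k + k') * c k') + a (k + l) * w) * single l w k)).
  apply: eq_bigr => k _.
  rewrite -(sum_single w (fun k' => a (k + k')%N * c k) ln).
  rewrite -(sum_single w (fun k' => a (k + k')%N) ln).
  rewrite -big_split mulr_suml -!big_split /=; apply: eq_bigr => k' _; ring.
rewrite !big_split /=.
rewrite (sum_single w (fun k => \sum_(k' < n) a (k + k')%N * c k' + a (k + l)%N * w) ln).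
rewrite -mulr_suml.
under [X in _ + (X * w + _)]eq_bigr do rewrite addnC.
set X := \sum_(k < n) _; set Y := \sum_(k < n) _; ring.
Qed.

Lemma fnorm2_add_single n (c : nat -> R[i]) l w : (l < n)%N ->
  fnorm2 n (fun k => c k + single l w k) =
  fnorm2 n c + 2 * re (w * Num.conj (c l)) + normc2 w.
Proof.
move=> ln; rewrite /fnorm2 (bigD1 (Ordinal ln))//= [in RHS](bigD1 (Ordinal ln))//=.
have -> : \sum_(i < n | i != Ordinal ln) normc2 (c i + single l w i) =
    \sum_(i < n | i != Ordinal ln) normc2 (c i).
  apply: eq_bigr => i il; rewrite /single ifF ?addr0//.
  apply/negbTE; apply: contra il => /eqP h; apply/eqP/val_inj; exact: h.
rewrite /single eqxx !normc2E !cE; ring.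
Qed.

Local Notation s := (hsup a).

(* [d] is a coordinatewise limit, along an ultrafilter, of a maximizing sequence
   of the form; the tails of [a] make the form continuous for such limits. *)
Lemma takagi_exists : 0 < s -> exists d : nat -> R[i],
  [/\ forall n, fnorm2 n d <= 1, exists k, d k != 0 &
      forall l, hankel a d l = s%:C * Num.conj (d l)].
Proof.
move=> s0.
have ex (N : nat) : exists p : nat * (nat -> R[i]),
    [/\ fnorm2 p.1 p.2 <= 1, s - N.+1%:R^-1 < re (hform a p.1 p.2 p.2) &
     forall k, (p.1 <= k)%N -> p.2 k = 0].
  have N0 : 0 < (N.+1%:R : R)^-1 by rewrite invr_gt0.
  have [_ [n [c [c1 ->]]] hc] := sup_adherent N0 (hsup_has_sup ha).
  exists (n, fun k => if (k < n)%N then c k else 0); split => /=.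
  - rewrite (_ : fnorm2 _ _ = fnorm2 n c)//; apply: eq_bigr => k _.
    by rewrite ltn_ord.
  - rewrite (_ : hform _ _ _ _ = hform a n c c)//; apply: eq_bigr => k _.
    by apply: eq_bigr => l _; rewrite !ltn_ord.
  - by move=> k nk; rewrite ltnNge nk.
have [p hp] := choice ex.
pose n_ N := (p N).1; pose c_ N := (p N).2.
have c1 N : fnorm2 (n_ N) (c_ N) <= 1 by have [] := hp N.
have cs N : s - N.+1%:R^-1 < re (hform a (n_ N) (c_ N) (c_ N)) by have [] := hp N.
have c0 N k : (n_ N <= k)%N -> c_ N k = 0 by have [_ _] := hp N; exact.
have [U [UU UF]] := @ultraFilterLemma nat \oo _.
have UP : ProperFilter U by exact: ultra_proper.
have fn N m : fnorm2 m (c_ N) <= 1.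
  apply: le_trans (c1 N); have [nm|mn] := leqP (n_ N) m.
    by rewrite (fnorm2_support nm (c0 N)).
  rewrite /fnorm2 (big_ord_widen _ (fun k => normc2 (c_ N k)) (ltnW mn)) big_mkcond.
  by apply: ler_sum => k _; case: ifP => // _; exact: normc2_ge0.
have nk N k : normc2 (c_ N k) <= 1.
  apply: le_trans (fn N k.+1); rewrite /fnorm2 big_ord_recr /= lerDr.
  exact: fnorm2_ge0.
have nk1 N k : normc (c_ N k) <= 1.
  by rewrite -(ler_pXn2r (n := 2)) ?nnegrE ?normc_ge0// expr1n; exact: nk.
have [d hd] := choice (fun k => ultra_ccvg_bounded UU (fun N => nk N k)).
have fd n : fnorm2 n d <= 1.
  have h : fnorm2 n (c_ N) @[N --> U] --> fnorm2 n d.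
    rewrite /fnorm2; apply: cvg_sum_seq => k.
    by apply: cvg_normc2; exact: hd.
  by apply: (cvgr_to_le h); apply: filterE => N; exact: fn.
have nd k : normc (d k) <= 1.
  rewrite -(ler_pXn2r (n := 2)) ?nnegrE ?normc_ge0// expr1n.
  apply: le_trans (fd k.+1); rewrite /fnorm2 big_ord_recr /= lerDr.
  exact: fnorm2_ge0.
have hlim l : ccvg U (fun N => hankel a (c_ N) l) (hankel a d l).
  apply: ccvg_unif_approx => e e0.
  have [|L hL] := l1tail_lt ha (e := e / 2); first by lra.
  exists (fun N => \sum_(k < L) a (l + k) * c_ N k), (\sum_(k < L) a (l + k) * d k).
  split.
  - move=> N; have [_ /(_ L)] := hankel_approx ha l (nk1 N).
    rewrite mulr1 => h; apply: le_trans h _; lra.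
  - apply: ccvg_sum => k; apply: ccvgM; last exact: hd.
    exact: ccvg_cst.
  - have [_ /(_ L)] := hankel_approx ha l nd.
    rewrite mulr1 -normcN opprB => h; apply: le_trans h _; lra.
have inv0 : (N.+1%:R^-1 : R) @[N --> U] --> (0 : R).
  by apply: cvg_trans (@cvg_harmonic R) => A hA; exact: UF.
exists d; split => //.
  (* If the limit vanished, every finite block of the form would tend to 0, and the tail bound would
     make the whole form tend to 0, against [s > 0]. *)
  apply: contrapT => nod.
  have d0 k : d k = 0 by apply: contrapT => /eqP h; apply: nod; exists k.
  have h0 : ccvg U (fun N => hform a (n_ N) (c_ N) (c_ N)) 0.
    apply: ccvg_unif_approx => e e0.
    have [K hK] := l1tail_lt ha e0.
    exists (fun N => \sum_(k < K) \sum_(l < K | (k + l < K)%N) a (k + l) * (c_ N k * c_ N l)).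
    exists (\sum_(k < K) \sum_(l < K | (k + l < K)%N) a (k + l) * (d k * d l)); split.
    - move=> N; pose m := maxn (n_ N) K.
      have nm : (n_ N <= m)%N by rewrite leq_maxl.
      have Km : (K <= m)%N by rewrite leq_maxr.
      rewrite -(hform_support nm (c0 N)).
      have -> : \sum_(k < K) \sum_(l < K | (k + l < K)%N) a (k + l) * (c_ N k * c_ N l) =
          \sum_(k < m) \sum_(l < m | (k + l < K)%N) a (k + l) * (c_ N k * c_ N l).
        rewrite (@sum_ord_support _ K m (fun k => \sum_(l < m | (k + l < K)%N) a (k + l)%N * (c_ N k * c_ N l)))//.
          apply: eq_bigr => k _; rewrite big_mkcond [RHS]big_mkcond.
          rewrite (@sum_ord_support _ K m (fun l => if (k + l < K)%N then a (k + l)%N * (c_ N k * c_ N l) else 0))// => l Kl.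
          by rewrite ltnNge (leq_trans Kl)// leq_addl.
        move=> k Kk; rewrite big1// => l kl; exfalso; move: kl.
        by rewrite ltnNge (leq_trans Kk)// leq_addr.
      have -> : hform a m (c_ N) (c_ N) - \sum_(k < m) \sum_(l < m | (k + l < K)%N) a (k + l) * (c_ N k * c_ N l) =
          \sum_(k < m) \sum_(l < m | (K <= k + l)%N) a (k + l) * (c_ N k * c_ N l).
        rewrite /hform -sumrB; apply: eq_bigr => k _.
        rewrite (bigID (fun l : 'I_m => (k + l < K)%N)) /= addrAC subrr add0r.
        by apply: eq_bigl => l; rewrite -leqNgt.
      apply: le_trans (hform_tail_le ha m (c_ N) K) _.
      by have := fn N m; have := fnorm2_ge0 m (c_ N); have := l1tail_ge0 ha K; nra.
    - apply: ccvg_sum => k; apply: ccvg_sum => l; apply: ccvgM; first exact: ccvg_cst.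
      by apply: ccvgM; exact: hd.
    - rewrite big1; first by rewrite subr0 ComplexField.Normc.normc0 ltW.
      by move=> k _; rewrite big1// => l _; rewrite d0 mul0r mulr0.
  have : s <= 0.
    have lim : s - N.+1%:R^-1 - re (hform a (n_ N) (c_ N) (c_ N)) @[N --> U] --> s - 0 - 0.
      by apply: cvgB; [apply: cvgB => //; exact: cvg_cst|exact: h0.1].
    rewrite !subr0 in lim.
    apply: (cvgr_to_le lim); apply: filterE => N.
    by rewrite subr_le0 ltW.
  by rewrite leNgt s0.
move=> l; pose X := s%:C * Num.conj (d l) - hankel a d l.
suff : X = 0 by move/eqP; rewrite subr_eq0 => /eqP.
pose C w := s * normc2 w - re (w ^+ 2 * a (l + l)).
(* Adding [w] at position [l] to a near-maximizer cannot raise the form above [s] times the squared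
   norm. The defect [1 / (N + 1)] disappears in the limit, and what is left has [2 re (w X)] as its
   linear term. *)
have key w : 0 <= 2 * re (w * X) + C w.
  have step N : 0 <= N.+1%:R^-1 + (2 * re (w * (s%:C * Num.conj (c_ N l) - hankel a (c_ N) l)) + C w).
    pose m := maxn (n_ N) l.+1.
    have lm : (l < m)%N by rewrite leq_maxr.
    have nm : (n_ N <= m)%N by rewrite leq_maxl.
    have c0m k : (m <= k)%N -> c_ N k = 0 by move=> mk; apply: c0; exact: leq_trans mk.
    have := re_hform_le_hsup ha m (fun k => c_ N k + single l w k).
    rewrite hform_add_single// fnorm2_add_single//.
    rewrite (hform_support nm (c0 N)) (fnorm2_support nm (c0 N)).
    have := cs N; have := c1 N; rewrite /C; move: (fnorm2 _ _) => f f1.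
    have : s * f <= s by rewrite ler_piMr// ltW.
    move: (hankel a _ l) => H.
    have -> : re (w * (s%:C * Num.conj (c_ N l) - H)) = s * re (w * Num.conj (c_ N l)) - re (w * H).
      by rewrite !cE; ring.
    have -> x y z : re (x + 2 * y + z : R[i]) = re x + 2 * re y + re z.
      by rewrite !cE /=; ring.
    move: (N.+1%:R^-1) => iN; lra.
  have lim : N.+1%:R^-1 + (2 * re (w * (s%:C * Num.conj (c_ N l) - hankel a (c_ N) l)) + C w)
      @[N --> U] --> 0 + (2 * re (w * X) + C w).
    apply: cvgD => //; apply: cvgD; last exact: cvg_cst.
    apply: cvgMr.
    have cc : ccvg U (fun N => Num.conj (c_ N l)) (Num.conj (d l)).
      exact: ccvg_conj.
    have cs' : ccvg U (fun N => w * (s%:C * Num.conj (c_ N l) - hankel a (c_ N) l)) (w * X).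
      apply: ccvgM; first exact: ccvg_cst.
      apply: ccvgD; first by apply: ccvgM => //; exact: ccvg_cst.
      by apply: ccvgN; exact: hlim.
    exact: cs'.1.
  rewrite add0r in lim.
  by apply: (cvgr_to_ge lim); apply: filterE => N; exact: step.
apply/eqP; rewrite -normc2_eq0 -sqrf_eq0 eq_le sqr_ge0 andbT.
(* Along [w = t conj X] the constant term is 0, so nonnegativity for both signs of [t] forces the
   linear coefficient [normc2 X] to vanish. *)
have quad t : 0 <= 0 + 2 * t * normc2 X + t ^+ 2 * C (Num.conj X).
  have := key (t%:C * Num.conj X).
  have reZ (r : R) z : re (r%:C * z) = r * re z by rewrite reM reC imC mul0r subr0.
  rewrite /C normc2M normc2C exprMn -rmorphXn /= -!mulrA !reZ (mulrC (Num.conj X)).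
  by rewrite mul_conj reC; lra.
rewrite -[leRHS](mul0r (C (Num.conj X))); apply: discriminant_le => //.
by have := quad 1; have := quad (-1); lra.
Qed.

End Takagi.

(** * Maximal con-eigenvectors and the norm of the form *)

Section HankelNorm.
Context {R : realType}.
Local Notation normc := (@ComplexField.Normc.normc R).

Lemma l2norm2_ge0 (u : nat -> R[i]) : (0 <= l2norm2 u)%E.
Proof. by apply: nneseries_ge0 => k _ _; rewrite lee_fin normc2_ge0. Qed.

Lemma l2norm2Z (z : R[i]) u : l2norm2 (fun k => z * u k) = ((normc2 z)%:E * l2norm2 u)%E.
Proof.
rewrite /l2norm2; under eq_eseriesr do rewrite normc2M EFinM.
by rewrite nneseriesZl// => k _; rewrite lee_fin normc2_ge0.
Qed.

Lemma l2norm2_conj (u : nat -> R[i]) : l2norm2 (fun k => Num.conj (u k)) = l2norm2 u.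
Proof. by rewrite /l2norm2; under eq_eseriesr do rewrite normc2_conj. Qed.

Lemma fnorm2_le_l2norm2 n (u : nat -> R[i]) : ((fnorm2 n u)%:E <= l2norm2 u)%E.
Proof.
rewrite /fnorm2 -sumEFin -(big_mkord xpredT (fun k => (normc2 (u k))%:E)).
by apply: nneseries_lim_ge => k _; rewrite lee_fin normc2_ge0.
Qed.

Lemma l2norm2_le (u : nat -> R[i]) (B : R) :
  (forall n, fnorm2 n u <= B) -> (l2norm2 u <= B%:E)%E.
Proof.
move=> h; apply: lime_le.
  by apply: is_cvg_nneseries => k _ _; rewrite lee_fin normc2_ge0.
by apply: nearW => n; rewrite sumEFin lee_fin /= big_mkord; exact: h.
Qed.

Lemma normc_le_l2norm2 (u : nat -> R[i]) (B : R) k : (l2norm2 u <= B%:E)%E ->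
  normc (u k) <= B + 1.
Proof.
move=> h; have : fnorm2 k.+1 u <= B by rewrite -lee_fin (le_trans (fnorm2_le_l2norm2 _ _)).
rewrite /fnorm2 big_ord_recr /= -[X in _ + X]/(normc (u k) ^+ 2) => h1.
have h2 : 0 <= \sum_(i < k) normc2 (u i) by apply: sumr_ge0 => i _; exact: normc2_ge0.
have := sqr_ge0 (normc (u k) - 1); have := normc_ge0 (u k); nra.
Qed.

Variables (a : nat -> R[i]) (P0 : R) (d0 : nat -> R[i]) (alpha : R[i]) (s : R).
Hypothesis ha : (\sum_(0 <= j <oo) (normc (a j))%:E < +oo)%E.
Hypothesis hP0 : 0 < P0.
Hypothesis hd0 : forall k, hankel a d0 k = alpha * Num.conj (d0 k).
Hypothesis nd0 : l2norm2 d0 = P0%:E.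
Hypothesis hmax : forall d, coneigen_sol a P0 d ->
  (l2norm2 (hankel a d) <= l2norm2 (hankel a d0))%E.
Hypotheses (s0 : 0 <= s) (s2 : s ^+ 2 = normc2 alpha).

Lemma l2norm2_coneigen (d : nat -> R[i]) (z : R[i]) :
  (forall k, hankel a d k = z * Num.conj (d k)) ->
  l2norm2 (hankel a d) = ((normc2 z)%:E * l2norm2 d)%E.
Proof.
move=> h; rewrite -(l2norm2_conj d) -l2norm2Z; congr l2norm2.
by apply/funext => k; rewrite h.
Qed.

(* A maximal solution of the con-eigenvalue equation realizes the norm of the
   Hankel form, because the form attains its norm at such a solution. *)
Lemma re_hform_le_coneigen n c : re (hform a n c c) <= s * fnorm2 n c.
Proof.
suff : hsup a <= s.
  move=> h; apply: le_trans (re_hform_le_hsup ha n c) _.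
  by rewrite ler_wpM2r// fnorm2_ge0.
have [/le_trans->//|t0] := leP (hsup a) 0.
have [d [fd [k dk] hd]] := takagi_exists ha t0.
have D1 : (l2norm2 d <= 1%:E)%E by exact: l2norm2_le.
have [D hD] : exists D : R, l2norm2 d = D%:E.
  exists (fine (l2norm2 d)); rewrite fineK// ge0_fin_numE ?l2norm2_ge0//.
  by rewrite (le_lt_trans D1)// ltry.
have D0 : 0 < D.
  rewrite -lte_fin -hD; apply: lt_le_trans (fnorm2_le_l2norm2 k.+1 d).
  rewrite lte_fin /fnorm2 big_ord_recr /= ltr_wpDl//.
    by apply: sumr_ge0 => i _; exact: normc2_ge0.
  by rewrite lt_def normc2_eq0 dk normc2_ge0.
(* The extremal vector is rescaled to squared norm [P0] in order to compete with [d0]. A real factor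
   keeps the con-eigenvalue; a complex [z] would multiply it by [z / conj z]. *)
pose r := Num.sqrt (P0 / D).
have r2 : r ^+ 2 = P0 / D by rewrite sqr_sqrtr// divr_ge0// ltW.
pose e k := r%:C * d k.
have he l : hankel a e l = (hsup a)%:C * Num.conj (e l).
  apply: csum_ccvg.
  have [hc _] := hankel_approx ha l (fun j => normc_le_l2norm2 j D1).
  have -> : (fun m => \sum_(j < m) a (l + j) * e j) =
      (fun m => r%:C * \sum_(j < m) a (l + j) * d j).
    by apply/funext => m; rewrite mulr_sumr; apply: eq_bigr => j _; rewrite mulrCA.
  have -> : (hsup a)%:C * Num.conj (e l) = r%:C * hankel a d l.
    by rewrite hd; apply: complexP; rewrite !cE; ring.
  by apply: ccvgM => //; exact: ccvg_cst.
have ne : l2norm2 e = P0%:E.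
  by rewrite l2norm2Z hD normc2C r2 -EFinM divfK// gt_eqF.
have := hmax (conj (ex_intro _ _ he) ne).
rewrite (l2norm2_coneigen he) (l2norm2_coneigen hd0) ne nd0 -!EFinM lee_fin.
rewrite ler_pM2r// normc2C -s2 ler_pXn2r ?nnegrE//.
exact: ltW.
Qed.

End HankelNorm.

(** * Moving averages *)

Section InnerProductLimits.
Context {R : realType} {d : measure_display} {T : measurableType d}.
Variables (mu : {measure set T -> \bar R}) (D : set T).
Hypothesis mD : measurable D.
Local Notation sq := (sqint mu D).
Local Notation N := (n2 mu D).
Local Notation ip := (cip mu D).

Lemma ecvg0_small (u : nat -> \bar R) e : u n @[n --> \oo] --> 0%E -> 0 < e ->
  exists n0, forall n, (n0 <= n)%N -> (u n < e%:E)%E.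
Proof.
move=> /fine_cvgP [h1 h2] e0; have /cvgr_lt/(_ _ e0) h3 := h2.
have [n0 _ h] : \forall n \near \oo, (u n < e%:E)%E.
  near=> n; have h1n : u n \is a fin_num by near: n.
  by rewrite -(fineK h1n) lte_fin; near: n.
by exists n0 => n hn; exact: h.
Unshelve. all: by end_near.
Qed.

Lemma sq_of_L2limit (f : T -> R[i]) (F : nat -> T -> R[i]) :
  cmeasurable D f -> (forall n, sq (F n)) ->
  (fun n => \int[mu]_(x in D) (normc2 (f x - F n x))%:E)%E @ \oo --> 0%E ->
  sq f /\ forall e, 0 < e -> exists n0, forall n, (n0 <= n)%N ->
    N (fun x => f x - F n x) < e.
Proof.
move=> mf sF lim.
have sB n e : (\int[mu]_(x in D) (normc2 (f x - F n x))%:E < e%:E)%E ->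
    sq (fun x => f x - F n x).
  move=> h; split; first exact: cmeasurableB mf (sF n).1.
  by rewrite (lt_le_trans h)// leey.
split.
  have [n0 /(_ n0 (leqnn _)) h] := ecvg0_small lim ltr01.
  apply: eq_sqint (sqintD mD (sB _ _ h) (sF n0)) => x _.
  by rewrite subrK.
move=> e e0; have [n0 h] := ecvg0_small lim e0; exists n0 => n hn.
by rewrite -lte_fin -integral_n2 ?h//; exact: sB (h n hn).
Qed.

Lemma cip_cont f g e : sq f -> sq g -> 0 < e -> exists2 delta, 0 < delta &
  forall f' g', sq f' -> sq g' -> N (fun x => f x - f' x) < delta ->
    N (fun x => g x - g' x) < delta -> normc2 (ip f g - ip f' g') < e.
Proof.
move=> sf sg e0; have Nf := n2_ge0 mu D f; have Ng := n2_ge0 mu D g.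
(* Cauchy-Schwarz and [N f' <= 2 N f + 2] bound the squared error by [2 N g + 4 N f + 4] times
   delta; the remaining 1 makes the inequality strict. *)
pose c := 2 * N g + 4 * N f + 5; have c0 : 0 < c by rewrite /c; lra.
exists (Num.min 1 (e / c)); first by rewrite lt_min ltr01 divr_gt0.
move=> f' g' sf' sg'; rewrite !lt_min => /andP[f1 fe] /andP[g1 ge].
have -> : ip f g - ip f' g' =
    ip (fun x => f x - f' x) g + ip f' (fun x => g x - g' x).
  by rewrite cipBl// cipBr//; ring.
apply: le_lt_trans (normc2D_le _ _) _.
have h1 := CauchySchwarz mD (sqintB mD sf sf') sg.
have h2 := CauchySchwarz mD sf' (sqintB mD sg sg').
have Nf' : N f' <= 2 * N f + 2 * N (fun x => f x - f' x).
  have -> : N f' = N (fun x => f x - (f x - f' x)).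
    by apply: eq_n2 => x _; rewrite opprB addrC subrK.
  by apply: n2B_le => //; exact: sqintB.
have := n2_ge0 mu D f'; have := n2_ge0 mu D (fun x => f x - f' x).
have := n2_ge0 mu D (fun x => g x - g' x).
rewrite ltr_pdivlMr// in fe; rewrite ltr_pdivlMr// in ge.
move: h1 h2 Nf' f1 fe g1 ge; move: (n2 _ _ (fun _ => f _ - _)) (n2 _ _ (fun _ => g _ - _)) (n2 _ _ f').
rewrite /c; move: (N f) (N g) Nf Ng => F G F0 G0 x y z; nra.
Qed.

Lemma normc2_small_eq (y z : R[i]) : (forall e : R, 0 < e -> normc2 (y - z) < e) -> y = z.
Proof.
move=> h; apply/eqP; rewrite -subr_eq0 -normc2_eq0 eq_le normc2_ge0 andbT.
by apply: ge0_eps => e /h /ltW.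
Qed.

Lemma cip_sums n m (c e : nat -> R[i]) (u v : nat -> T -> R[i]) :
  (forall k, sq (u k)) -> (forall k, sq (v k)) ->
  ip (fun x => \sum_(k < n) c k * u k x) (fun x => \sum_(l < m) e l * v l x) =
  \sum_(k < n) \sum_(l < m) c k * Num.conj (e l) * ip (u k) (v l).
Proof.
move=> su sv; rewrite cip_suml//; last 2 first.
- by move=> k; exact: sqintZ.
- by apply: sqint_sum => // l; exact: sqintZ.
apply: eq_bigr => k _; rewrite cip_sumr//; last 2 first.
- by move=> l; exact: sqintZ.
- exact: sqintZ.
apply: eq_bigr => l _; rewrite cipZl ?cipZr//; last exact: sqintZ.
by rewrite mulrA.
Qed.

End InnerProductLimits.

Section L2Sums.
Context {R : realType}.
Local Notation mu := (@lebesgue_measure R).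
Local Notation circ := (@circ R).
Local Notation sq := (sqint mu circ).
Local Notation N := (n2 mu circ).
Local Notation ip := (cip mu circ).
Local Notation T := (measurableTypeR R).
Let mc : measurable (circ : set T) := @mcirc R.

Lemma expi_negE (k : nat) (x : R) : expi (- (k%:R * x)) = E (- (k : int)) x.
Proof. by rewrite /E mulrNz mulNr. Qed.

Lemma wnorm2_1 (g : T -> R[i]) :
  wnorm2 (fun=> 1) g = (\int[mu]_(x in circ) (normc2 (g x))%:E)%E.
Proof. by apply: eq_integral => x _; rewrite mulr1. Qed.

Lemma is_L2sum_sq (u : nat -> R[i]) (m : nat -> int) (e : nat -> R -> R[i]) phi :
  (forall k x, e k x = E (m k) x) -> is_L2sum u e phi ->
  sq phi /\ forall eps, 0 < eps -> exists n0, forall n, (n0 <= n)%N ->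
    N (fun x => phi x - \sum_(k < n) u k * E (m k) x) < eps.
Proof.
move=> em [mphi lim]; apply: sq_of_L2limit => //.
  by move=> n; apply: sqint_sum => // k; apply: sqintZ => //; exact: sqint_E.
rewrite (_ : (fun n => _) = (fun n => wnorm2 (fun=> 1)
    (fun x => phi x - \sum_(k < n) u k * e k x)))//.
apply/funext => n; rewrite wnorm2_1; apply: eq_integral => x _.
by under eq_bigr do rewrite -em.
Qed.

End L2Sums.

(** * Spectral density of a one-sided moving average *)

Section MovingAverage.
Context {R : realType}.
Local Notation mu := (@lebesgue_measure R).
Local Notation circ := (@circ R).
Local Notation T := (measurableTypeR R).
Let mc : measurable (circ : set T) := @mcirc R.

Lemma density_normc2 (phi : T -> R[i]) : sqint mu circ phi ->
  density (fun x => normc2 (phi x)).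
Proof.
move=> sphi; split; first by move=> x _; exact: normc2_ge0.
exact: (sqint_integrable mu sphi.1).1.
Qed.

(** Sending [eps (j - p)] to [E (- p)] preserves inner products up to the factor [2 pi], and the
    shift by [k] becomes multiplication by [E k]. The covariances of the truncated sums therefore
    agree exactly, and both sides are continuous in mean square. *)
Lemma moving_average_spectral_density (d0 : nat -> R[i]) (phi : R -> R[i])
    (d : measure_display) (W : measurableType d) (P : probability W R)
    (eps xi : int -> W -> R[i]) :
  is_L2sum d0 (fun k x => expi (- (k%:R * x))) phi ->
  white_noise P eps -> moving_average P d0 eps xi ->
  has_spectral_density P xi (fun x => normc2 (phi x)).
Proof.
move=> hphi [weps eps0 epsE] hxi.
have mW : measurable [set: W] by exact: measurableT.
have [sphi aphi] := @is_L2sum_sq _ _ (fun k => - (k : int)) _ _ (@expi_negE R) hphi.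
have seps i : sqint P setT (eps i) := weps i.
have sS j n : sqint P setT (fun t => \sum_(k < n) d0 k * eps (j - k%:Z) t).
  by apply: sqint_sum => // k; exact: sqintZ.
have sxi j : sqint P setT (xi j) := (hxi j).1.
have axi j e : 0 < e -> exists n0, forall n, (n0 <= n)%N ->
    n2 P setT (fun t => xi j t - \sum_(k < n) d0 k * eps (j - k%:Z) t) < e.
  exact: (sq_of_L2limit mW (sxi j).1 (sS j) (hxi j).2).2.
split.
- exact: density_normc2.
- exact: sxi.
- move=> j.
  have s1 : sqint P setT (fun=> 1).
    split; first exact: cmeasurable_cst.
    rewrite (_ : (\int[P]_(x in setT) _)%E = (\int[P]_(x in setT) (cst 1%E) x)%E).
      by rewrite integral_cst// mul1e; apply: le_lt_trans (probability_le1 P mW) _; exact: ltry.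
    by apply: eq_integral => x _; rewrite normc2_1.
  have cE (X : W -> R[i]) : cexpect P X = cip P setT X (fun=> 1).
    by apply: eq_Cintegral => t _; rewrite rmorph1 mulr1.
  rewrite cE; apply: cip_approx => // e e0; have [n0 /(_ n0 (leqnn _)) hn] := axi j e e0.
  exists (fun t => \sum_(k < n0) d0 k * eps (j - k%:Z) t); split => //.
  rewrite cip_suml//; last by move=> k; exact: sqintZ.
  by apply: big1 => k _; rewrite cipZl// -cE eps0 mulr0.
move=> j k.
have -> : (2 * pi)^-1%:C * Cintegral mu circ (fun x => expi (k%:~R * x) * (normc2 (phi x))%:C) =
    (2 * pi)^-1%:C * cip mu circ (fun x => E k x * phi x) phi.
  by congr (_ * _); apply: eq_Cintegral => x _; rewrite -mul_conj mulrA.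
rewrite -[LHS]/(cip P setT (xi (j + k)) (xi j)).
have sE := sqintM_E k sphi.
have sSn n : sqint mu circ (fun x => \sum_(p < n) d0 p * E (- (p : int)) x).
  by apply: sqint_sum => // p; apply: sqintZ => //; exact: sqint_E.
apply: normc2_small_eq => e e0.
have pi0 : 0 < (2 * pi : R) by rewrite mulr_gt0// pi_gt0.
have e4 : 0 < e / 4 by lra.
(* The spectral side carries the factor [1 / (2 pi)], which is squared in [normc2]. *)
have e5 : 0 < e / 4 * (2 * pi) ^+ 2 by rewrite mulr_gt0// exprn_gt0.
have [dl1 dl10 h1] := cip_cont mW (sxi (j + k)) (sxi j) e4.
have [dl2 dl20 h2] := cip_cont mc sE sphi e5.
have [n1 a1] := axi (j + k) _ dl10; have [n2_ a2] := axi j _ dl10.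
have [n3 a3] := aphi _ dl20.
pose n := maxn n1 (maxn n2_ n3).
have ln1 : (n1 <= n)%N by rewrite leq_maxl.
have ln2 : (n2_ <= n)%N by rewrite !leq_max leqnn orbT.
have ln3 : (n3 <= n)%N by rewrite !leq_max leqnn !orbT.
have {}h1 := h1 _ _ (sS (j + k) n) (sS j n) (a1 _ ln1) (a2 _ ln2).
have hf : n2 mu circ (fun x : T => E k x * phi x -
    E k x * \sum_(p < n) d0 p * E (- (p : int)) x) < dl2.
  rewrite (@eq_n2 _ _ _ _ _ _ (fun x : T => E k x *
    (phi x - \sum_(p < n) d0 p * E (- (p : int)) x))); last by move=> x _; rewrite mulrBr.
  by rewrite n2M_E a3.
have {}h2 := h2 _ _ (sqintM_E k (sSn n)) (sSn n) hf (a3 _ ln3).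
have key : cip P setT (fun t => \sum_(p < n) d0 p * eps (j + k - p%:Z) t)
      (fun t => \sum_(q < n) d0 q * eps (j - q%:Z) t) =
    (2 * pi)^-1%:C * cip mu circ (fun x => E k x * \sum_(p < n) d0 p * E (- (p : int)) x)
      (fun x => \sum_(q < n) d0 q * E (- (q : int)) x).
  rewrite (@cip_sums _ _ _ P setT mW n n d0 d0 (fun p => eps (j + k - p%:Z))
    (fun q => eps (j - q%:Z)))//.
  rewrite (@eq_cip _ _ _ _ _ _ (fun x : T => \sum_(p < n) d0 p * E (k - (p : int)) x) _
    (fun x : T => \sum_(q < n) d0 q * E (- (q : int)) x))//; last first.
    move=> x _; rewrite mulr_sumr; apply: eq_bigr => p _.
    by rewrite E_add mulrCA.
  rewrite (@cip_sums _ _ _ mu circ mc n n d0 d0 (fun p => E (k - (p : int)))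
    (fun q => E (- (q : int)))); [|by move=> p; exact: sqint_E..].
  rewrite mulr_sumr; apply: eq_bigr => p _; rewrite mulr_sumr; apply: eq_bigr => q _.
  rewrite -[cip P _ _ _]/(cexpect P _) epsE cip_E -addrA (inj_eq (addrI j)).
  rewrite [RHS]mulrCA; congr (_ * _); rewrite mulrA -rmorphM /=.
  by rewrite mulVf ?mul1r// gt_eqF.
set X := cip P _ _ _ in h1 *; set Y := cip mu _ _ _ in h2 *.
rewrite key in h1.
set Z := cip mu _ _ _ in h1 h2.
have -> : X - (2 * pi)^-1%:C * Y = (X - (2 * pi)^-1%:C * Z) + - ((2 * pi)^-1%:C * (Y - Z)) by ring.
apply: le_lt_trans (normc2D_le _ _) _.
rewrite normc2N normc2M normc2C exprVn.
have p2 : 0 < (2 * pi : R) ^+ 2 by rewrite exprn_gt0.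
have h3 : ((2 * pi) ^+ 2)^-1 * normc2 (Y - Z) < e / 4.
  by rewrite ltr_pdivrMl// mulrC.
lra.
Qed.

End MovingAverage.

(** * The extremal factorization *)

Lemma sqr_add_lt (R : realType) (u v e : R) : 0 < e ->
  u ^+ 2 + v ^+ 2 < e ^+ 2 -> `|u| <= e.
Proof.
move=> e0 h; rewrite -(ler_pXn2r (n := 2)) ?nnegrE// ?(ltW e0)//.
rewrite real_normK ?num_real// (le_trans _ (ltW h))// lerDl.
exact: sqr_ge0.
Qed.

(** * Hankel forms as integrals against the symbol *)

Section Symbol.
Context {R : realType}.
Local Notation normc := (@ComplexField.Normc.normc R).
Local Notation mu := (@lebesgue_measure R).
Local Notation circ := (@circ R).
Local Notation sq := (sqint mu circ).
Local Notation N := (n2 mu circ).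
Local Notation ip := (cip mu circ).
Local Notation T := (measurableTypeR R).
Let mc : measurable (circ : set T) := @mcirc R.

(** The conjugate Hardy space: frequencies at most 0. The constant frequency is kept, whereas
    [L2minus] starts at -1. *)
Definition in_Hminus (g : T -> R[i]) := sq g /\ forall n : nat, ip g (E n.+1) = 0.

Definition anti_poly n (c : nat -> R[i]) (x : R) : R[i] :=
  \sum_(k < n) c k * E (- (k : int)) x.

Lemma sqint_anti_poly n c : sq (anti_poly n c).
Proof. by apply: sqint_sum => // k; apply: sqintZ => //; exact: sqint_E. Qed.

(** Multiplication by [E (-1)] moves the frequencies to at most -1, where density is already
    known. *)
Lemma Hminus_dense (g : T -> R[i]) e : in_Hminus g -> 0 < e ->
  exists n c, N (fun x => g x - anti_poly n c x) < e.
Proof.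
move=> [sg g0] e0.
have [|n [c hc]] := neg_trig_poly_dense (sqintM_E (-1) sg) _ e0.
  by move=> n; rewrite cipM_El opprK -(g0 n); apply: eq_cip => // x _; rewrite -E_add.
exists n, c; rewrite -(n2M_E _ (-1)); apply: le_lt_trans hc.
rewrite le_eqVlt; apply/orP; left; apply/eqP; apply: eq_n2 => x _.
rewrite neg_trig_polyE mulrBr; congr (_ - _); rewrite /anti_poly mulr_sumr.
by apply: eq_bigr => k _; rewrite mulrCA -E_add -opprD.
Qed.

Lemma n2_anti_poly n c : N (anti_poly n c) = 2 * pi * fnorm2 n c.
Proof.
apply: (@complexI R); rewrite -(cip_diag mc (sqint_anti_poly n c)).
rewrite (@cip_sums _ _ _ mu circ mc n n c c (fun k => E (- (k : int)))
  (fun k => E (- (k : int)))); [|by move=> p; exact: sqint_E..].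
rewrite rmorphM /fnorm2 rmorph_sum mulr_sumr; apply: eq_bigr => k _.
rewrite (bigD1 k)//= big1 ?addr0.
  by rewrite cip_E eqxx mulr1 mulrC mul_conj.
move=> l lk; rewrite cip_E eqr_opp eqz_nat eq_sym (_ : (l == k :> nat) = false) ?mulr0//.
exact/negbTE.
Qed.

Variable a : nat -> R[i].
Hypothesis ha : (\sum_(0 <= j <oo) (normc (a j))%:E < +oo)%E.
Local Notation A := (Afun a).

Lemma normc_E n (x : R) : normc (E n x) <= 1.
Proof.
rewrite -(ler_pXn2r (n := 2)) ?nnegrE ?normc_ge0// expr1n.
by rewrite -[leLHS]/(normc2 _) normc2_E.
Qed.

Lemma Afun_approx x : ccvg \oo (fun n => \sum_(j < n) a j * E j x) (A x) /\
  forall L, normc (A x - \sum_(j < L) a j * E j x) <= 2 * l1tail a L.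
Proof.
(* [A x] is the coefficient of index 0 of the Hankel operator applied to the bounded sequence
   [E l x], so the same tail bounds apply. *)
have [h1 h2] := hankel_approx ha 0 (fun l : nat => normc_E l x).
by split => // L; have := h2 L; rewrite mulr1.
Qed.

Definition KA : R := (2 * l1norm a) ^+ 2.

Lemma KA_ge0 : 0 <= KA. Proof. exact: sqr_ge0. Qed.

Lemma normc2_Afun x : normc2 (A x) <= KA.
Proof.
have [_ /(_ 0%N)] := Afun_approx x; rewrite big_ord0 subr0 /l1tail big_ord0 subr0 => h.
by rewrite -[leLHS]/(normc _ ^+ 2) ler_pXn2r ?nnegrE ?normc_ge0 ?mulr_ge0 ?l1norm_ge0.
Qed.

Lemma cmeasurable_Afun : cmeasurable (circ : set T) A.
Proof.
have mE n : cmeasurable (circ : set T) (fun x => \sum_(j < n) a j * E j x).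
  apply: cmeasurable_sum => j; apply: cmeasurableM; last exact: cmeasurable_E.
  exact: cmeasurable_cst.
split.
- apply: (measurable_fun_cvg (fun n => (mE n).1)) => x _.
  exact: (Afun_approx x).1.1.
- apply: (measurable_fun_cvg (fun n => (mE n).2)) => x _.
  exact: (Afun_approx x).1.2.
Qed.

Lemma sqint_AM (g : T -> R[i]) : sq g -> sq (fun x => A x * g x).
Proof.
move=> sg; apply: (sqint_bounded_mul sg cmeasurable_Afun (K := KA)).
by apply: aeW => x _; exact: normc2_Afun.
Qed.

Lemma n2_AM_le (g : T -> R[i]) : sq g -> N (fun x => A x * g x) <= KA * N g.
Proof.
move=> sg; apply: (n2_bounded_mul_le KA_ge0 sg cmeasurable_Afun).
by apply: aeW => x _; exact: normc2_Afun.
Qed.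

Lemma sqint_Afun : sq A.
Proof.
by apply: eq_sqint (sqint_AM (sqint_E 0)) => x _; rewrite E0 mulr1.
Qed.

Lemma cip_Afun_E (m : nat) : ip A (E m) = (2 * pi)%:C * a m.
Proof.
apply: cip_approx => //; [exact: sqint_Afun|exact: sqint_E|].
move=> e e0.
have pi0 : 0 < (2 * pi : R) by rewrite mulr_gt0// pi_gt0.
have [L0 hL0] : exists L0, forall L, (L0 <= L)%N -> (2 * l1tail a L) ^+ 2 * (2 * pi) < e.
  have h : (2 * l1tail a n) * (2 * l1tail a n) * (2 * pi) @[n --> \oo] -->
      (2 * 0) * (2 * 0) * (2 * pi : R).
    apply: cvgMl; apply: cvgM; apply: cvgMr; exact: l1tail_cvg.
  rewrite !mulr0 mul0r in h; have /cvgr_lt/(_ _ e0) [L0 _ hL] := h.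
  by exists L0 => L hL'; rewrite expr2; exact: hL.
pose L := maxn L0 m.+1.
have sL : sq (fun x => \sum_(j < L) a j * E j x).
  by apply: sqint_sum => // j; apply: sqintZ => //; exact: sqint_E.
exists (fun x => \sum_(j < L) a j * E j x); split => //.
- apply: le_lt_trans (hL0 L (leq_maxl _ _)).
  have -> : 2 * pi = N (E 0) :> R.
    by apply: (@complexI R); rewrite -cip_diag ?cip_E ?eqxx ?mulr1//; exact: sqint_E.
  rewrite (@eq_n2 _ _ _ _ _ _ (fun x : T => (A x - \sum_(j < L) a j * E j x) * E 0 x)); last first.
    by move=> x _; rewrite E0 mulr1.
  apply: n2_bounded_mul_le; [exact: sqr_ge0|exact: sqint_E| |].
    by apply: cmeasurableB; [exact: cmeasurable_Afun|exact: sL.1].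
  apply: aeW => x _; have [_ /(_ L) h] := Afun_approx x.
  rewrite -[leLHS]/(normc _ ^+ 2) ler_pXn2r ?nnegrE ?normc_ge0//.
  by rewrite mulr_ge0// l1tail_ge0.
- have mL : (m < L)%N by rewrite leq_maxr.
  rewrite cip_suml//; last 2 first.
  + by move=> j; apply: sqintZ => //; exact: sqint_E.
  + exact: sqint_E.
  rewrite (bigD1 (Ordinal mL))//= big1 ?addr0.
    rewrite cipZl; [|exact: mc|exact: sqint_E|exact: sqint_E].
    by rewrite cip_E eqxx mulr1 mulrC.
  move=> j jm; rewrite cipZl; [|exact: mc|exact: sqint_E|exact: sqint_E].
  rewrite cip_E eqz_nat (_ : (j == m :> nat) = false) ?mulr0//; exact/negbTE.
Qed.

Lemma cip_A_anti_poly n c m : ip (fun x => A x * anti_poly n c x) (E (m : nat)) =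
  (2 * pi)%:C * \sum_(k < n) a (m + k) * c k.
Proof.
rewrite (@eq_cip _ _ _ _ _ _ (fun x : T => \sum_(k < n) c k * (E (- (k : int)) x * A x)) _ (E m))//; last first.
  by move=> x _; rewrite /anti_poly mulr_sumr; apply: eq_bigr => k _; ring.
rewrite cip_suml//; last 2 first.
- by move=> k; apply: sqintZ => //; apply: sqintM_E; exact: sqint_Afun.
- exact: sqint_E.
rewrite mulr_sumr; apply: eq_bigr => k _.
rewrite cipZl; [|exact: mc|by apply: sqintM_E; exact: sqint_Afun|exact: sqint_E].
rewrite cipM_El opprK.
have -> : ip A (fun x => E (k : nat) x * E (m : nat) x) = ip A (E (m + k)%N).
  by apply: eq_cip => // x _; rewrite -E_add addrC PoszD.
by rewrite cip_Afun_E; ring.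
Qed.

Section Coefficients.
Variables (d0 : nat -> R[i]) (phi : T -> R[i]) (B : R).
Hypothesis sphi : sq phi.
Hypothesis nd0 : (l2norm2 d0 <= B%:E)%E.
Hypothesis aphi : forall e, 0 < e -> exists n0, forall n, (n0 <= n)%N ->
  N (fun x => phi x - anti_poly n d0 x) < e.

Lemma cip_anti_poly_E n c (m : int) : ip (anti_poly n c) (E m) =
  (2 * pi)%:C * \sum_(k < n) c k * (- (k : int) == m)%:R.
Proof.
rewrite cip_suml//; last 2 first.
- by move=> k; apply: sqintZ => //; exact: sqint_E.
- exact: sqint_E.
rewrite mulr_sumr; apply: eq_bigr => k _.
rewrite cipZl; [|exact: mc|exact: sqint_E|exact: sqint_E].
by rewrite cip_E mulrCA.
Qed.

Lemma cip_phi_E (k : nat) : ip phi (E (- (k : int))) = (2 * pi)%:C * d0 k.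
Proof.
apply: cip_approx => //; first exact: sqint_E.
move=> e e0; have [n0 hn] := aphi e0; pose n := maxn n0 k.+1.
exists (anti_poly n d0); split; [exact: sqint_anti_poly|by apply: hn; rewrite leq_maxl|].
have kn : (k < n)%N by rewrite leq_maxr.
rewrite cip_anti_poly_E (bigD1 (Ordinal kn))//= big1 ?addr0 ?eqxx ?mulr1// => j jk.
rewrite eqr_opp eqz_nat (_ : (j == k :> nat) = false) ?mulr0//; exact/negbTE.
Qed.

Lemma phi_Hminus : in_Hminus phi.
Proof.
split => // m; apply: cip_approx => //; first exact: sqint_E.
move=> e e0; have [n hn] := aphi e0.
exists (anti_poly n d0); split; [exact: sqint_anti_poly|exact: hn|].
rewrite cip_anti_poly_E big1 ?mulr0// => k _.
by rewrite (_ : (- (k : int) == m.+1) = false) ?mulr0//; case: (k : nat).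
Qed.

(** A coefficient of index [m >= 0] of [A * phi] sees [a] only at the indices [m + k]:
    multiplication by [A] followed by restriction to nonnegative frequencies is the Hankel operator.
    This is a finite computation for truncations of [d0], and both sides pass to the limit. *)
Lemma cip_A_phi (m : nat) : ip (fun x => A x * phi x) (E m) = (2 * pi)%:C * hankel a d0 m.
Proof.
have sA := sqint_AM sphi.
apply: normc2_small_eq => e e0.
have e4 : 0 < e / 4 by lra.
have [dl dl0 hdl] := cip_cont mc sA (sqint_E m) e4.
have KA1 : 0 < KA + 1 by have := KA_ge0; lra.
have [n0 hn0] := aphi (divr_gt0 dl0 KA1).
have [hk _] := hankel_approx ha m (fun k => normc_le_l2norm2 k nd0).
have hk2 : ccvg \oo (fun n => (2 * pi)%:C * \sum_(k < n) a (m + k) * d0 k)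
    ((2 * pi)%:C * hankel a d0 m).
  by apply: ccvgM => //; exact: ccvg_cst.
have hk3 : normc2 ((2 * pi)%:C * hankel a d0 m - (2 * pi)%:C * \sum_(k < n) a (m + k) * d0 k)
    @[n --> \oo] --> normc2 ((2 * pi)%:C * hankel a d0 m - (2 * pi)%:C * hankel a d0 m).
  by apply: cvg_normc2; apply: ccvgD; [exact: ccvg_cst|exact: ccvgN].
rewrite subrr normc2_0 in hk3.
have /cvgr_lt/(_ _ e4) [n1 _ hn1] := hk3.
pose n := maxn n0 n1.
have {}hn1 := hn1 n (leq_maxr _ _).
have sP := sqint_anti_poly n d0.
have := hdl _ (E m) (sqint_AM sP) (sqint_E m) _ _.
have -> : N (fun x => E m x - E m x) = 0.
  by rewrite /n2; under eq_Rintegral do rewrite subrr normc2_0; rewrite Rintegral_cst// mul0r.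
have dA : N (fun x => A x * phi x - A x * anti_poly n d0 x) < dl.
  rewrite (@eq_n2 _ _ _ _ _ _ (fun x : T => A x * (phi x - anti_poly n d0 x))); last first.
    by move=> x _; rewrite mulrBr.
  apply: le_lt_trans (n2_AM_le (sqintB mc sphi sP)) _.
  have := hn0 n (leq_maxl _ _); rewrite ltr_pdivlMr// => h.
  have := n2_ge0 mu circ (fun x => phi x - anti_poly n d0 x); lra.
move=> /(_ dA dl0); rewrite cip_A_anti_poly => h.
set X := ip _ _ in h *; set Y := _ * \sum_(k < n) _ in h hn1.
have -> : X - (2 * pi)%:C * hankel a d0 m = (X - Y) + - ((2 * pi)%:C * hankel a d0 m - Y) by ring.
apply: le_lt_trans (normc2D_le _ _) _; rewrite normc2N.
move: hn1 => /= hn1; lra.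
Qed.

End Coefficients.

Variable s : R.
Hypothesis hs : forall n c, re (hform a n c c) <= s * fnorm2 n c.
Hypothesis s0 : 0 <= s.

(** The second argument is conjugated again inside [cip], so this is the integral of [A] times the
    square of the polynomial, that is [2 pi] times the Hankel form of [c]. *)
Lemma re_A_anti_poly_le n c :
  re (ip (fun x => A x * anti_poly n c x) (fun x => Num.conj (anti_poly n c x))) <=
  s * N (anti_poly n c).
Proof.
have -> : ip (fun x => A x * anti_poly n c x) (fun x => Num.conj (anti_poly n c x)) =
    (2 * pi)%:C * hform a n c c.
  rewrite (@eq_cip _ _ _ _ _ (fun x : T => A x * anti_poly n c x)
    (fun x : T => A x * anti_poly n c x) _
    (fun x : T => \sum_(l < n) Num.conj (c l) * E (l : nat) x))//; last first.
    move=> x _; rewrite /anti_poly rmorph_sum; apply: eq_bigr => l _.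
    by rewrite rmorphM /= E_conj opprK.
  rewrite cip_sumr//; last 2 first.
  - by move=> l; apply: sqintZ => //; exact: sqint_E.
  - by apply: sqint_AM; exact: sqint_anti_poly.
  rewrite /hform exchange_big mulr_sumr /=; apply: eq_bigr => l _.
  rewrite cipZr; [|exact: mc|by apply: sqint_AM; exact: sqint_anti_poly|exact: sqint_E].
  rewrite conjCK cip_A_anti_poly mulrCA; congr (_ * _); rewrite mulr_sumr.
  by apply: eq_bigr => k _; rewrite addnC; ring.
rewrite n2_anti_poly reM reC imC mul0r subr0 mulrCA ler_pM2l ?hs//.
by rewrite mulr_gt0// pi_gt0.
Qed.

Lemma re_A_quad_le (x : T -> R[i]) : in_Hminus x ->
  re (ip (fun t => A t * x t) (fun t => Num.conj (x t))) <= s * N x.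
Proof.
move=> hx; have [sx _] := hx; have sxc := sqint_conj mc sx; have sAx := sqint_AM sx.
rewrite -subr_le0; apply: ge0_eps => e e0.
(* Half of [e] is spent on the form and half on [s] times the squared norm; [s + 1] is used because
   [s] may be 0. *)
pose e1 := (e / (2 * (s + 1))) ^+ 2.
have s0' := s0; have s1 : 0 < s + 1 by lra.
have e10 : 0 < e1 by rewrite exprn_gt0// divr_gt0// mulr_gt0.
have e2 : 0 < (e / 2) ^+ 2 by rewrite exprn_gt0// divr_gt0.
have [dl1 dl10 h1] := cip_cont mc sAx sxc e2.
have [dl2 dl20 h2] := cip_cont mc sx sx e10.
have KA1 : 0 < KA + 1 by have := KA_ge0; lra.
have m0 : 0 < Num.min (dl1 / (KA + 1)) (Num.min dl1 dl2).
  by rewrite !lt_min dl10 dl20 divr_gt0.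
have [n [c]] := Hminus_dense hx m0; rewrite !lt_min => /andP[hA /andP[hd1 hd2]].
have sP := sqint_anti_poly n c.
have := h2 _ _ sP sP hd2 hd2.
rewrite !cip_diag// -rmorphB normc2C => k2.
have hA' : N (fun t => A t * x t - A t * anti_poly n c t) < dl1.
  rewrite (@eq_n2 _ _ _ _ _ _ (fun t : T => A t * (x t - anti_poly n c t))); last first.
    by move=> t _; rewrite mulrBr.
  apply: le_lt_trans (n2_AM_le (sqintB mc sx sP)) _.
  rewrite ltr_pdivlMr// in hA.
  have := n2_ge0 mu circ (fun t => x t - anti_poly n c t); lra.
have hC : N (fun t => Num.conj (x t) - Num.conj (anti_poly n c t)) < dl1.
  rewrite (@eq_n2 _ _ _ _ _ _ (fun t : T => Num.conj (x t - anti_poly n c t))) ?n2_conj//.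
  by move=> t _; rewrite rmorphB.
have := h1 _ _ (sqint_AM sP) (sqint_conj mc sP) hA' hC.
have := re_A_anti_poly_le n c.
set X := ip _ _; set Y := ip _ _ => hY; set q := N (anti_poly n c) in k2 hY; set p := N x in k2 *.
rewrite normc2E reD reN => k1.
have e02 : 0 < e / 2 by rewrite divr_gt0.
have es : 0 < e / (2 * (s + 1)).
  by apply: divr_gt0 => //; apply: mulr_gt0.
have {}k1 := le_trans (ler_norm _) (sqr_add_lt e02 k1).
have {}k2 : q - p <= e / (2 * (s + 1)).
  rewrite -(opprB p q); apply: le_trans (ler_norm _) _; rewrite normrN.
  by apply: (@sqr_add_lt _ _ 0) => //; rewrite expr0n /= addr0.
rewrite ler_pdivlMr ?mulr_gt0// in k2.
have : s * (q - p) <= e / 2.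
  have [qp|qp] := lerP q p; first by apply: (@le_trans _ _ 0); [rewrite mulr_ge0_le0// subr_le0|exact: ltW].
  nra.
lra.
Qed.

Lemma in_HminusD x y : in_Hminus x -> in_Hminus y -> in_Hminus (fun t => x t + y t).
Proof.
move=> [sx x0] [sy y0]; split; first exact: sqintD.
by move=> n; rewrite cipDl// ?x0 ?y0 ?addr0//; exact: sqint_E.
Qed.

Lemma in_HminusZ z x : in_Hminus x -> in_Hminus (fun t => z * x t).
Proof.
move=> [sx x0]; split; first exact: sqintZ.
by move=> n; rewrite cipZl// ?x0 ?mulr0//; exact: sqint_E.
Qed.

Lemma re_A_bilin_le (x y : T -> R[i]) : in_Hminus x -> in_Hminus y ->
  re (ip (fun t => A t * x t) (fun t => Num.conj (y t))) <= s * (N x + N y) / 2.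
Proof.
(* Polarization; the quadratic form changes sign under multiplication by i. *)
pose ii : R[i] := 0 +i* 1.
move=> hx hy; have [sx _] := hx; have [sy _] := hy.
have sAx := sqint_AM sx; have sAy := sqint_AM sy.
have sxc := sqint_conj mc sx; have syc := sqint_conj mc sy.
have q1 := re_A_quad_le (in_HminusD hx hy).
have hw := in_HminusD hx (in_HminusZ (-1) hy).
have q2 := re_A_quad_le (in_HminusZ ii hw).
have sym : ip (fun t => A t * y t) (fun t => Num.conj (x t)) =
    ip (fun t => A t * x t) (fun t => Num.conj (y t)).
  by apply: eq_Cintegral => t _; rewrite !conjCK; ring.
move: q1 q2.
rewrite (@eq_cip _ _ _ _ _ _ (fun t : T => A t * x t + A t * y t) _
  (fun t : T => Num.conj (x t) + Num.conj (y t))); last 2 first.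
- by move=> t _; rewrite mulrDr.
- by move=> t _; rewrite rmorphD.
rewrite cipDl ?cipDr//; last exact: sqintD.
rewrite (@eq_cip _ _ _ _ _ (fun t : T => A t * (ii * _)) (fun t : T => ii * (A t * x t - A t * y t)) _
  (fun t : T => Num.conj ii * (Num.conj (x t) - Num.conj (y t)))); last 2 first.
- by move=> t _; ring.
- by move=> t _; rewrite rmorphM mulN1r rmorphB.
rewrite cipZl ?cipZr ?cipBl ?cipBr//; try exact: sqintB; last by apply: sqintZ => //; exact: sqintB.
rewrite (n2Z mc _ hw.1).
rewrite sym (n2D mc sx sy) (@eq_n2 _ _ _ _ _ (fun t : T => x t + -1 * y t) (fun t => x t - y t)); last first.
  by move=> t _; rewrite mulN1r.
have -> : normc2 ii = 1 by rewrite normc2E /= expr0n expr1n add0r.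
rewrite (n2B mc sx sy) mul1r.
have iiC : Num.conj ii = - ii by apply: complexP; rewrite !cE ?oppr0.
have ii2 : ii * ii = -1 by rewrite /ii; apply: complexP => /=; ring.
rewrite conjCK.
move: (ip (fun t => A t * x t) (fun t => Num.conj (x t))).
move: (ip (fun t => A t * x t) (fun t => Num.conj (y t))).
move: (ip (fun t => A t * y t) (fun t => Num.conj (y t))) (ip x y).
move=> a3 u a2 a1; rewrite mulrA ii2 mulN1r !cE => h1 h2; lra.
Qed.

End Symbol.

Section Inverse.
Context {R : realType} {d : measure_display} {T : measurableType d}.
Variable D : set T.

Lemma measurable_normc2V (f : T -> R[i]) : cmeasurable D f ->
  measurable_fun D (fun x => (normc2 (f x))^-1).
Proof.
move=> mf; under eq_fun do rewrite -powR_inv1 ?normc2_ge0//.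
exact: (measurableT_comp (@measurable_powR R (-1)) (measurable_normc2 mf)).
Qed.

Lemma cmeasurableV (f : T -> R[i]) : cmeasurable D f -> cmeasurable D (fun x => (f x)^-1).
Proof.
move=> mf; have h z : z^-1 = (normc2 z)^-1%:C * Num.conj z :> R[i].
  have [->|z0] := eqVneq z 0; first by rewrite invr0 rmorph0 mulr0.
  by apply: (mulfI z0); rewrite mulfV// mulrCA mul_conj -rmorphM mulVf ?rmorph1// normc2_eq0.
under eq_fun do rewrite h.
apply: cmeasurableM; last exact: cmeasurable_conj.
by apply: cmeasurable_real; exact: measurable_normc2V.
Qed.

End Inverse.

(** * The wandering vector of phi *)

Section Wandering.
Context {R : realType}.
Local Notation mu := (@lebesgue_measure R).
Local Notation circ := (@circ R).
Local Notation sq := (sqint mu circ).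
Local Notation N := (n2 mu circ).
Local Notation ip := (cip mu circ).
Local Notation T := (measurableTypeR R).
Let mc : measurable (circ : set T) := @mcirc R.

Lemma sqint_ntp_mul n c (g : T -> R[i]) : sq g -> sq (fun x => neg_trig_poly n c x * g x).
Proof.
move=> sg; apply: (@eq_sqint _ _ _ _ _ (fun x : T => \sum_(k < n) c k * (E (- (k.+1)%:Z) x * g x))).
  move=> x _; rewrite neg_trig_polyE mulr_suml; apply: eq_bigr => k _.
  by rewrite mulrA.
by apply: sqint_sum => // k; apply: sqintZ => //; exact: sqintM_E.
Qed.

Lemma cip_ntp_mul n c (g h : T -> R[i]) : sq g -> sq h ->
  ip (fun x => neg_trig_poly n c x * g x) h =
  \sum_(k < n) c k * ip g (fun x => E k.+1 x * h x).
Proof.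
move=> sg sh.
have -> : ip (fun x => neg_trig_poly n c x * g x) h =
    ip (fun x : T => \sum_(k < n) c k * (E (- (k.+1)%:Z) x * g x)) h.
  apply: eq_cip => // x _; rewrite neg_trig_polyE mulr_suml; apply: eq_bigr => k _.
  by rewrite mulrA.
rewrite cip_suml//; last by move=> k; apply: sqintZ => //; exact: sqintM_E.
apply: eq_bigr => k _; rewrite cipZl; [|exact: mc|exact: sqintM_E|exact: sh].
by rewrite cipM_El opprK.
Qed.

(* For the weight |phi|^2, the norm of [h] is the L2 norm of [h * phi]. *)
Lemma L2minus_cip_eq0 (phi h : T -> R[i]) : in_Hminus phi ->
  L2minus (fun x => normc2 (phi x)) h ->
  sq (fun x => h x * phi x) /\ forall n : nat, ip (fun x => h x * phi x) (E n) = 0.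
Proof.
move=> [sphi phi0] [[mh wh] happ].
have w2 (g : T -> R[i]) : wnorm2 (fun x => normc2 (phi x)) g =
    (\int[mu]_(x in circ) (normc2 (g x * phi x))%:E)%E.
  by apply: eq_integral => x _; rewrite normc2M.
have shp : sq (fun x => h x * phi x).
  by split; [exact: cmeasurableM mh sphi.1|rewrite -w2].
split=> // n; apply: cip_approx => //; first exact: sqint_E.
move=> e e0; have [m [c hc]] := happ e e0.
exists (fun x => neg_trig_poly m c x * phi x); split.
- exact: sqint_ntp_mul.
- rewrite w2 in hc; rewrite -lte_fin -integral_n2; last first.
    by apply: sqintB => //; exact: sqint_ntp_mul.
  apply: le_lt_trans hc; rewrite le_eqVlt; apply/orP; left; apply/eqP.
  by apply: eq_integral => x _; rewrite mulrBl.
- rewrite cip_ntp_mul//; last exact: sqint_E.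
  apply: big1 => k _; rewrite (_ : ip phi _ = 0) ?mulr0// -(phi0 (k + n)%N).
  by apply: eq_cip => // x _; rewrite -E_add -PoszD addSn.
Qed.

Variables (phi : T -> R[i]) (d0 : nat -> R[i]).
Hypothesis hphi : in_Hminus phi.
Hypothesis phiE : forall k : nat, ip phi (E (- (k : int))) = (2 * pi)%:C * d0 k.
Hypothesis d0_neq0 : exists k, d0 k != 0.

Lemma pi2C_neq0 : (2 * pi : R)%:C != 0.
Proof. by apply: contra (@pi2_neq0 R) => /eqP [->]. Qed.

(* [g] is the component of phi orthogonal to the span of e^{-ikx} phi, k >= 1
   (the wandering vector of Beurling's theorem). It is orthogonal to all its own
   shifts, so |g|^2 has a single nonzero Fourier coefficient. *)
Lemma exists_wandering : exists (g : T -> R[i]) (c : R),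
  [/\ in_Hminus g, 0 < c, {ae mu, forall x, circ x -> normc2 (g x) = c},
      forall e, 0 < e -> exists n p,
        N (fun x => phi x - neg_trig_poly n p x * phi x - g x) < e &
      forall k : nat, ip g (fun x => E (- (k.+1)%:Z) x * phi x) = 0].
Proof.
have [sphi phi0] := hphi.
pose V : set (T -> R[i]) := [set v | exists n p, forall x, v x = neg_trig_poly n p x * phi x].
have V0 : V !=set0 by exists (fun=> 0); exists 0%N, (fun=> 0) => x; rewrite neg_trig_poly0 mul0r.
have sV v : V v -> sq v.
  by move=> [n [p hv]]; apply: eq_sqint (sqint_ntp_mul n p sphi) => x _; rewrite hv.
have VZD z v w : V v -> V w -> V (fun x => z * v x + w x).
  move=> [n [p hv]] [m [q hw]].
  have hp : is_neg_trig_poly (neg_trig_poly n p) by exists n, p.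
  have hq : is_neg_trig_poly (neg_trig_poly m q) by exists m, q.
  have [l [r hr]] := is_neg_trig_polyZD z hp hq.
  by exists l, r => x; rewrite hv hw -hr mulrDl mulrA.
have [g [sg gapp gV]] := exists_projection mc (@mu_circ_fin R) V0 sV VZD sphi.
have gapp' e : 0 < e -> exists n p,
    N (fun x => phi x - neg_trig_poly n p x * phi x - g x) < e.
  move=> e0; have [v [n [p hv]] h] := gapp e e0; exists n, p.
  apply: le_lt_trans h; rewrite le_eqVlt; apply/orP; left; apply/eqP.
  by apply: eq_n2 => x _; rewrite hv.
have VE (k : nat) : V (fun x => E (- (k.+1)%:Z) x * phi x).
  exists k.+1, (fun j => (j == k)%:R) => x; rewrite neg_trig_polyE; congr (_ * _).
  rewrite (bigD1 ord_max)//= eqxx mul1r big1 ?addr0// => j jk.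
  by rewrite (_ : (j == k :> nat) = false) ?mul0r//; apply/negbTE.
(* The span is stable under multiplication by [E (- (k + 1))], which moves the coefficients [k + 1]
   places up. *)
have VEV (k : nat) n p : V (fun x => E (- (k.+1)%:Z) x * (neg_trig_poly n p x * phi x)).
  exists (n + k.+1)%N, (fun j => if (k.+1 <= j)%N then p (j - k.+1)%N else 0) => x.
  rewrite mulrA; congr (_ * _); rewrite !neg_trig_polyE addnC big_split_ord /=.
  rewrite [X in _ = X + _]big1 ?add0r; last first.
    by move=> j _; rewrite ifF ?mul0r//; apply/negbTE; rewrite -ltnNge.
  rewrite mulr_sumr; apply: eq_bigr => j _; rewrite leq_addr addKn mulrCA -E_add.
  by rewrite -opprD -PoszD addnS.
have gk (k : nat) : ip g (fun x => E (- (k.+1)%:Z) x * phi x) = 0 by exact: gV.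
have gEg (k : nat) : ip (fun x => E (- (k.+1)%:Z) x * g x) g = 0.
  apply: cip_approx => //; first exact: sqintM_E.
  move=> e e0; have [n [p hp]] := gapp' e e0.
  have s1 := sqintM_E (- (k.+1)%:Z) sphi.
  have s2 := sqintM_E (- (k.+1)%:Z) (sqint_ntp_mul n p sphi).
  exists (fun x => E (- (k.+1)%:Z) x * phi x - E (- (k.+1)%:Z) x * (neg_trig_poly n p x * phi x)).
  split; first exact: sqintB.
  - apply: le_lt_trans hp; rewrite n2C -[leRHS](n2M_E _ (- (k.+1)%:Z)) le_eqVlt.
    by apply/orP; left; apply/eqP; apply: eq_n2 => x _; ring.
  - rewrite cipBl// (cip_conj mc sg s1) gk (cip_conj mc sg s2) gV// rmorph0 subrr.
    by [].
have H1 (n : nat) : ip g (E n.+1) = 0.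
  apply: cip_approx => //; first exact: sqint_E.
  move=> e e0; have [m [p hp]] := gapp' e e0.
  exists (fun x => phi x - neg_trig_poly m p x * phi x); split.
  - by apply: sqintB => //; exact: sqint_ntp_mul.
  - by rewrite n2C.
  - rewrite cipBl; [|exact: mc|exact: sphi|exact: sqint_ntp_mul|exact: sqint_E].
    rewrite phi0 sub0r cip_ntp_mul//; last exact: sqint_E.
    rewrite big1 ?oppr0// => k _; rewrite (_ : ip phi _ = 0) ?mulr0// -(phi0 (k + n.+1)%N).
    by apply: eq_cip => // x _; rewrite -E_add -PoszD addSn.
(* The mean of [|g|^2], the only possible value of the constant. *)
pose c := N g / (2 * pi).
have pi0 : 0 < (2 * pi : R) by rewrite mulr_gt0// pi_gt0.
have Nc : N g = c * (2 * pi) by rewrite /c divfK// gt_eqF.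
(* This shows that [g] is not 0: with [m] the first index where [d0] is nonzero, what is subtracted
   from [phi] has frequencies at most [- m - 1], so [g] keeps the coefficient of [phi] at [- m]. *)
have [m dm dmin] : exists2 m, d0 m != 0 & forall j, (j < m)%N -> d0 j = 0.
  have [m dm dmin] := ex_minnP d0_neq0.
  exists m => // j jm; apply/eqP; apply: contraTT jm => dj; rewrite -leqNgt.
  exact: dmin.
have gm : ip g (E (- (m : int))) = (2 * pi)%:C * d0 m.
  apply: cip_approx => //; first exact: sqint_E.
  move=> e e0; have [n [p hp]] := gapp' e e0.
  exists (fun x => phi x - neg_trig_poly n p x * phi x); split.
  - by apply: sqintB => //; exact: sqint_ntp_mul.
  - by rewrite n2C.
  - rewrite cipBl; [|exact: mc|exact: sphi|exact: sqint_ntp_mul|exact: sqint_E].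
    rewrite phiE cip_ntp_mul//; last exact: sqint_E.
    rewrite big1 ?subr0// => k _.
    have -> : ip phi (fun x => E k.+1 x * E (- (m : int)) x) = ip phi (E (k.+1%:Z - m%:Z)).
      by apply: eq_cip => // x _; rewrite -E_add.
    have [km|mk] := leqP k.+1 m.
      have -> : k.+1%:Z - m%:Z = - (m - k.+1)%N%:Z by rewrite -subzn// opprB.
      by rewrite phiE dmin ?mulr0// -subSn// subSS leq_subr.
    rewrite subzn; last exact: ltnW.
    by rewrite -[(k.+1 - m)%N]prednK ?subn_gt0// phi0 mulr0.
have Ng0 : 0 < N g.
  rewrite lt_def n2_ge0 andbT; apply/eqP => Ng.
  have := CauchySchwarz mc sg (sqint_E (- (m : int))).
  rewrite Ng mul0r gm normc2M => h.
  have : normc2 ((2 * pi : R)%:C) * normc2 (d0 m) = 0.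
    by apply/eqP; rewrite eq_le h mulr_ge0 ?normc2_ge0.
  move/eqP; rewrite mulf_eq0 !normc2_eq0 (negPf dm) orbF; apply/negP.
  exact: pi2C_neq0.
have c0 : 0 < c by rewrite divr_gt0.
exists g, c; split => //.
(* Orthogonality of [g] to its shifts kills the coefficients of one sign; those of the other sign
   are their conjugates, as [|g|^2] is real. *)
have hE (n : int) : n != 0 -> Cintegral mu circ (fun x => (normc2 (g x))%:C * E n x) = 0.
  have pos (k : nat) : Cintegral mu circ (fun x => (normc2 (g x))%:C * E (- (k.+1)%:Z) x) = 0.
    by rewrite -(gEg k); apply: eq_Cintegral => x _; rewrite -mul_conj; ring.
  case: n => [[|k]|k] // _; last by rewrite NegzE.
  have hi : cintegrable mu circ (fun x => (normc2 (g x))%:C * E (- (k.+1)%:Z) x).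
    have := sqint_mul_cintegrable mc (sqintM_E (- (k.+1)%:Z) sg) (sqint_conj mc sg).
    by apply: eq_cintegrable => // x _; rewrite -mul_conj; ring.
  have := congr1 Num.conj (pos k); rewrite rmorph0 -(Cintegral_conj mc hi) => <-.
  apply: eq_Cintegral => x _; rewrite [RHS]rmorphM /= E_conj opprK; congr (_ * _).
  by apply: complexP; rewrite !cE ?oppr0.
have sg2 : cintegrable mu circ (fun x => (normc2 (g x))%:C).
  have := sqint_mul_cintegrable mc sg (sqint_conj mc sg).
  by apply: eq_cintegrable => // x _; rewrite mul_conj.
have scst : cintegrable mu circ (fun=> - c%:C).
  have := sq_cintegrable (sqintZ mc (- c%:C) (sqint_E 0)).
  by apply: eq_cintegrable => // x _; rewrite E0 mulr1.
have hf := cintegrableD mc sg2 scst.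
have := Fourier_uniqueness hf _.
have -> : {ae mu, forall x, circ x -> normc2 (g x) = c} =
    {ae mu, forall x, circ x -> (normc2 (g x))%:C - c%:C = 0}.
  congr (almost_everywhere _ _); apply/funext => x; apply/propext; split => h cx.
    by rewrite h// subrr.
  by have /eqP := h cx; rewrite subr_eq0 => /eqP [].
apply => n.
have cE2 : Cintegral mu circ (fun x => - c%:C * E n x) = - c%:C * Cintegral mu circ (E n).
  by apply: CintegralZ => //; exact: sq_cintegrable (sqint_E n).
have s3 : cintegrable mu circ (fun x => (normc2 (g x))%:C * E n x).
  have := sqint_mul_cintegrable mc (sqintM_E n sg) (sqint_conj mc sg).
  by apply: eq_cintegrable => // x _; rewrite -mul_conj; ring.
have s4 : cintegrable mu circ (fun x => - c%:C * E n x).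
  by apply: cintegrableZ => //; exact: sq_cintegrable (sqint_E n).
have -> : Cintegral mu circ (fun x => ((normc2 (g x))%:C + - c%:C) * E n x) =
    Cintegral mu circ (fun x => (normc2 (g x))%:C * E n x) - c%:C * Cintegral mu circ (E n).
  rewrite -mulNr -cE2 -CintegralD//; apply: eq_Cintegral => x _.
  by rewrite mulrDl.
have [->|n0] := eqVneq n 0; last by rewrite hE// Cintegral_E// mulr0 subrr.
have -> : Cintegral mu circ (fun x => (normc2 (g x))%:C * E 0 x) = (N g)%:C.
  by rewrite -(cip_diag mc sg); apply: eq_Cintegral => x _; rewrite E0 mulr1 mul_conj.
have -> : Cintegral mu circ (E 0) = (2 * pi)%:C.
  rewrite -[RHS]mulr1 -[X in _ * X]/((0 == 0 :> int)%:R) -cip_E; apply: eq_Cintegral => x _.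
  by rewrite E0 rmorph1 mulr1.
by rewrite Nc rmorphM subrr.
Qed.

(** On the zero set of [phi] all approximants of [g] vanish, hence so does [g]; but its modulus is a
    nonzero constant almost everywhere. *)
Lemma ae_neq0_phi : {ae mu, forall x, circ x -> phi x != 0}.
Proof.
have [sphi phi0] := hphi.
have [g [c [[sg _] c0 gc gapp _]]] := exists_wandering.
pose b (x : T) : R[i] := (normc2 (phi x) == 0)%:R.
have mb : cmeasurable (circ : set T) b.
  (* Since [0^-1 = 0], this formula is the indicator of the zero set, and it is visibly
     measurable. *)
  have -> : b = (fun x => (1 - normc2 (phi x) * (normc2 (phi x))^-1)%:C).
    apply/funext => x; rewrite /b; have [->|n0] := eqVneq (normc2 (phi x)) 0.
      by rewrite mul0r subr0.
    by rewrite mulfV// subrr.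
  apply: cmeasurable_real; apply: measurable_funB => //; apply: measurable_funM.
    exact: measurable_normc2 sphi.1.
  exact: measurable_normc2V sphi.1.
have bK : {ae mu, forall x : T, circ x -> normc2 (b x) <= 1}.
  apply: aeW => x _; rewrite /b; case: (_ == _); rewrite ?normc2_1 ?normc2_0//.
have sbg := sqint_bounded_mul sg mb bK.
have Nbg : N (fun x => b x * g x) = 0.
  apply/eqP; rewrite eq_le n2_ge0 andbT; apply: ge0_eps => e e0.
  have [n [p hp]] := gapp e e0; apply: le_trans (ltW hp).
  have sB : sq (fun x => phi x - neg_trig_poly n p x * phi x - g x).
    by apply: sqintB => //; apply: sqintB => //; exact: sqint_ntp_mul.
  apply: le_Rintegral => //.
  - exact: (sqint_integrable mu sbg.1).1.
  - exact: (sqint_integrable mu sB.1).1.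
  move=> x _; rewrite /b; have [/eqP|_] := eqVneq (normc2 (phi x)) 0; last first.
    by rewrite mul0r normc2_0 normc2_ge0.
  rewrite normc2_eq0 => /eqP ->.
  by rewrite mul1r mulr0 subrr sub0r normc2N.
apply: ae_mono2 gc (n2_eq0_ae mc sbg Nbg) => x gx bgx cx.
have := bgx cx; rewrite /b normc2_eq0; case: eqP => // _ /eqP; rewrite mul1r -normc2_eq0 gx//.
by rewrite gt_eqF.
Qed.

End Wandering.

(** * The con-eigenvalue equation on the circle *)

Section Robust.
Context {R : realType}.
Local Notation normc := (@ComplexField.Normc.normc R).
Local Notation mu := (@lebesgue_measure R).
Local Notation circ := (@circ R).
Local Notation sq := (sqint mu circ).
Local Notation N := (n2 mu circ).
Local Notation ip := (cip mu circ).
Local Notation T := (measurableTypeR R).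
Let mc : measurable (circ : set T) := @mcirc R.

Variables (a : nat -> R[i]) (P0 : R) (d0 : nat -> R[i]) (alpha : R[i]) (s : R).
Hypothesis ha : (\sum_(0 <= j <oo) (normc (a j))%:E < +oo)%E.
Hypothesis hP0 : 0 < P0.
Hypothesis hd0 : forall k, hankel a d0 k = alpha * Num.conj (d0 k).
Hypothesis nd0 : l2norm2 d0 = P0%:E.
Hypothesis hs : forall n c, re (hform a n c c) <= s * fnorm2 n c.
Hypotheses (s0 : 0 <= s) (s2 : s ^+ 2 = normc2 alpha).
Variables (phi psi : T -> R[i]).
Hypothesis hphi : is_L2sum d0 (fun k x => expi (- (k%:R * x))) phi.
Hypothesis hpsi : is_L2sum (hankel a d0) (fun k x => expi (k%:R * x)) psi.
Local Notation A := (Afun a).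

Lemma sqint_phi : sq phi.
Proof. exact: (@is_L2sum_sq _ _ (fun k => - (k : int)) _ _ (@expi_negE R) hphi).1. Qed.

Lemma phi_anti_poly_approx e : 0 < e -> exists n0, forall n, (n0 <= n)%N ->
  N (fun x => phi x - anti_poly n d0 x) < e.
Proof. exact: (@is_L2sum_sq _ _ (fun k => - (k : int)) _ _ (@expi_negE R) hphi).2. Qed.

Lemma l2norm2_d0_le : (l2norm2 d0 <= P0%:E)%E. Proof. by rewrite nd0. Qed.

Lemma phi_in_Hminus : in_Hminus phi.
Proof. exact: phi_Hminus sqint_phi phi_anti_poly_approx. Qed.

Lemma cip_phi_expi (k : nat) : ip phi (E (- (k : int))) = (2 * pi)%:C * d0 k.
Proof. exact: (cip_phi_E sqint_phi phi_anti_poly_approx k). Qed.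

Lemma exists_d0_neq0 : exists k, d0 k != 0.
Proof.
apply: contrapT => h; have := hP0; rewrite -lte_fin -nd0 /l2norm2.
rewrite eseries0 ?ltxx// => k _ _; suff -> : d0 k = 0 by rewrite normc2_0.
by apply: contrapT => /eqP hk; apply: h; exists k.
Qed.

Lemma sqint_conj_phi : sq (fun x => alpha * Num.conj (phi x)).
Proof. by apply: sqintZ => //; apply: sqint_conj => //; exact: sqint_phi. Qed.

Lemma psi_eq_conj_phi_ae : {ae mu, forall x, circ x -> psi x = alpha * Num.conj (phi x)}.
Proof.
have [spsi apsi] := @is_L2sum_sq _ _ (fun k => (k : int)) _ _ (fun k x => erefl) hpsi.
have sB := sqintB mc spsi sqint_conj_phi.
suff h : N (fun x => psi x - alpha * Num.conj (phi x)) = 0.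
  by apply: ae_mono (n2_eq0_ae mc sB h) => x h1 /h1 /eqP; rewrite subr_eq0 => /eqP.
apply/eqP; rewrite eq_le n2_ge0 andbT; apply: ge0_eps => e e0.
have e4 : 0 < e / 4 by rewrite divr_gt0.
have a1 : 0 < normc2 alpha + 1 by rewrite ltr_wpDl ?normc2_ge0.
have [n1 h1] := apsi _ e4; have [n2_ h2] := phi_anti_poly_approx (divr_gt0 e4 a1).
pose n := maxn n1 n2_.
pose Q (x : T) := \sum_(k < n) hankel a d0 k * E (k : nat) x.
have sQ : sq Q by apply: sqint_sum => // k; apply: sqintZ => //; exact: sqint_E.
apply: le_trans (n2_triangle mc spsi sQ sqint_conj_phi) _.
have {}h1 := h1 n (leq_maxl _ _); have {}h2 := h2 n (leq_maxr _ _).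
have h3 : N (fun x => Q x - alpha * Num.conj (phi x)) =
    normc2 alpha * N (fun x => phi x - anti_poly n d0 x).
  rewrite -(n2_conj _ _ (fun x => phi x - anti_poly n d0 x)) -n2Z//; last first.
    by apply: sqint_conj => //; apply: sqintB; [exact: mc|exact: sqint_phi|exact: sqint_anti_poly].
  rewrite n2C; apply: eq_n2 => x _; rewrite rmorphB mulrBr; congr (_ - _).
  rewrite /Q /anti_poly rmorph_sum mulr_sumr; apply: eq_bigr => k _.
  by rewrite hd0 rmorphM /= E_conj opprK mulrA.
rewrite h3; rewrite ltr_pdivlMr// in h2.
have := n2_ge0 mu circ (fun x => phi x - anti_poly n d0 x).
move: h1 h2; rewrite -/Q; move: (N _) (N _) => u v; have := normc2_ge0 alpha; lra.
Qed.

Lemma fnorm2_cvg : fnorm2 n d0 @[n --> \oo] --> P0.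
Proof.
have h : (\sum_(0 <= j < n) (normc2 (d0 j))%:E)%E @[n --> \oo] --> P0%:E.
  rewrite -nd0; apply: (@is_cvg_nneseries R (fun j => (normc2 (d0 j))%:E) xpredT) => j _ _.
  by rewrite lee_fin normc2_ge0.
rewrite (_ : (fun n => fnorm2 n d0) =
    fine \o (fun n => \sum_(0 <= j < n) (normc2 (d0 j))%:E)%E); first exact: fine_cvg.
by apply/funext => n /=; rewrite sumEFin /= big_mkord.
Qed.

Lemma n2_phi : N phi = 2 * pi * P0.
Proof.
have sp := sqint_phi.
apply: (@complexI R); rewrite -(cip_diag mc sp).
apply: normc2_small_eq => e e0; have e4 : 0 < e / 4 by rewrite divr_gt0.
have [dl dl0 hdl] := cip_cont mc sp sp e4.
have [n1 h1] := phi_anti_poly_approx dl0.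
have lim : (2 * pi * P0 - 2 * pi * fnorm2 n d0) * (2 * pi * P0 - 2 * pi * fnorm2 n d0)
    @[n --> \oo] --> (2 * pi * P0 - 2 * pi * P0) * (2 * pi * P0 - 2 * pi * P0).
  by apply: cvgM; apply: cvgB; [exact: cvg_cst|apply: cvgMr; exact: fnorm2_cvg|
    exact: cvg_cst|apply: cvgMr; exact: fnorm2_cvg].
rewrite subrr mul0r in lim; have /cvgr_lt/(_ _ e4) [n2_ _ h2] := lim.
pose n := maxn n1 n2_.
have {}h1 := h1 n (leq_maxl _ _); have {h2} /= h2 := h2 n (leq_maxr _ _).
have sP := sqint_anti_poly n d0.
have := hdl _ _ sP sP h1 h1; rewrite [ip (anti_poly n d0) _](cip_diag mc sP) n2_anti_poly.
set X := ip phi phi; set Y := (_ * fnorm2 n d0)%:C => h3.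
have -> : X - (2 * pi * P0)%:C = (X - Y) + - ((2 * pi * P0)%:C - Y) by ring.
apply: le_lt_trans (normc2D_le _ _) _; rewrite normc2N.
have -> : normc2 ((2 * pi * P0)%:C - Y) =
    (2 * pi * P0 - 2 * pi * fnorm2 n d0) * (2 * pi * P0 - 2 * pi * fnorm2 n d0).
  by rewrite /Y -rmorphB normc2C expr2.
lra.
Qed.

Lemma cip_conj_E (f : T -> R[i]) n : sq f ->
  ip (fun x => Num.conj (f x)) (E n) = Num.conj (ip f (E (- n))).
Proof.
move=> sf; rewrite -(cip_conj mc sf (sqint_E _)); apply: eq_Cintegral => x _.
by rewrite E_conj mulrC.
Qed.

(** The nonnegative coefficients of [A * phi] come from the Hankel operator on [d0], and the
    equation for [d0] equates them with those of [alpha * conj phi]. *)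
Lemma cip_resid_E (n : nat) : ip (fun x => A x * phi x - alpha * Num.conj (phi x)) (E n) = 0.
Proof.
have sp := sqint_phi.
rewrite cipBl; [|exact: mc|exact: sqint_AM|exact: sqint_conj_phi|exact: sqint_E].
rewrite (cip_A_phi ha sp l2norm2_d0_le phi_anti_poly_approx) hd0.
rewrite cipZl; [|exact: mc|exact: sqint_conj|exact: sqint_E].
rewrite cip_conj_E// cip_phi_expi.
have -> : Num.conj ((2 * pi : R)%:C * d0 n) = (2 * pi : R)%:C * Num.conj (d0 n).
  by apply: complexP; rewrite !cE; ring.
by rewrite mulrCA subrr.
Qed.

(** [conj phi] is a mean-square limit of polynomials with nonnegative frequencies. *)
Lemma cip_conj_phi_eq0 (f : T -> R[i]) : sq f ->
  (forall n : nat, ip f (E n) = 0) -> ip f (fun x => Num.conj (phi x)) = 0.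
Proof.
move=> sf f0; have sp := sqint_phi; have spc := sqint_conj mc sp.
rewrite (cip_conj mc spc sf) (_ : ip _ f = 0) ?rmorph0//.
apply: cip_approx => // e e0; have [n hn] := phi_anti_poly_approx e0.
have sP := sqint_anti_poly n d0.
exists (fun x => Num.conj (anti_poly n d0 x)); split; first exact: sqint_conj.
  rewrite (@eq_n2 _ _ _ _ _ _ (fun x : T => Num.conj (phi x - anti_poly n d0 x))); last first.
    by move=> x _; rewrite rmorphB.
  by rewrite n2_conj; exact: hn.
have -> : ip (fun x => Num.conj (anti_poly n d0 x)) f =
    ip (fun x : T => \sum_(k < n) Num.conj (d0 k) * E (k : nat) x) f.
  apply: eq_cip => // x _; rewrite rmorph_sum; apply: eq_bigr => k _.
  by rewrite rmorphM /= E_conj opprK.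
rewrite cip_suml//; last by move=> k; apply: sqintZ => //; exact: sqint_E.
apply: big1 => k _; rewrite cipZl; [|exact: mc|exact: sqint_E|exact: sf].
by rewrite (cip_conj mc sf (sqint_E _)) f0 rmorph0 mulr0.
Qed.

(** The residual is orthogonal to [conj phi], so only the term [alpha * conj phi] contributes. This
    is the extremal value of the bilinear form. *)
Lemma cip_A_phi_conj : ip (fun x => A x * phi x) (fun x => Num.conj (phi x)) =
  alpha * (N phi)%:C.
Proof.
have sp := sqint_phi; have spc := sqint_conj mc sp; have sA := sqint_AM ha sp.
have sr := sqintB mc sA sqint_conj_phi.
have := cip_conj_phi_eq0 sr cip_resid_E.
rewrite (cipBl mc sA sqint_conj_phi spc) => /eqP; rewrite subr_eq0 => /eqP ->.
by rewrite (cipZl mc _ spc spc) (cip_diag mc spc) n2_conj.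
Qed.

(** The form is bounded through its real part; the phase [l] rotates its extremal value onto the
    bound. For [alpha = 0] any unimodular number serves. *)
Lemma exists_phase : exists2 l : R[i], normc2 l = 1 & l * alpha = s%:C.
Proof.
have [a0|an0] := eqVneq alpha 0.
  exists 1; first exact: normc2_1.
  have : s ^+ 2 = 0 by rewrite s2 a0 normc2_0.
  by move/eqP; rewrite sqrf_eq0 => /eqP ->; rewrite a0 mulr0.
exists (s%:C * alpha^-1); last by rewrite divfK.
by rewrite normc2M normc2C normc2V s2 mulfV// normc2_eq0.
Qed.

(** * Variation of the form at the pair (outer, partner) *)

Section Factor.
Variables (g : T -> R[i]) (c : R).
Hypothesis hg : in_Hminus g.
Hypothesis c0 : 0 < c.
Hypothesis gc : {ae mu, forall x, circ x -> normc2 (g x) = c}.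
Hypothesis gapp : forall e, 0 < e -> exists n p,
  N (fun x => phi x - neg_trig_poly n p x * phi x - g x) < e.
Hypothesis gE : forall k : nat, ip g (fun x => E (- (k.+1)%:Z) x * phi x) = 0.

Let mg : cmeasurable (circ : set T) g := hg.1.1.
Let mgc : cmeasurable (circ : set T) (fun x => Num.conj (g x)) := cmeasurable_conj mg.

Let gle : {ae mu, forall x : T, circ x -> normc2 (g x) <= c}.
Proof. by apply: (ae_mono _ gc) => x h /h ->. Qed.

Let gcle : {ae mu, forall x : T, circ x -> normc2 (Num.conj (g x)) <= c}.
Proof. by apply: (ae_mono _ gle) => x h /h; rewrite normc2_conj. Qed.

(* [g] is a constant times the inner factor of [phi], so [outer] is a constant
   times its outer factor. *)
Definition outer (x : T) := Num.conj (g x) * phi x.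
Definition partner (x : T) := g x * phi x.

(** A coefficient of positive index of [conj g * phi] is the conjugate of an inner product of [g]
    with a negative shift of [phi], which is 0 because [g] is wandering. *)
Lemma outer_Hminus : in_Hminus outer.
Proof.
have so := sqint_bounded_mul sqint_phi mgc gcle; split => // k.
have s1 := sqintM_E (- (k.+1)%:Z) sqint_phi.
transitivity (Num.conj (ip g (fun x => E (- (k.+1)%:Z) x * phi x))); last first.
  by rewrite gE rmorph0.
rewrite -(cip_conj mc hg.1 s1); apply: eq_Cintegral => x _.
by rewrite E_conj /outer; ring.
Qed.

(** Both factors have nonpositive frequencies, and boundedness of [g] allows [phi] to be replaced by
    its truncations. *)
Lemma partner_Hminus : in_Hminus partner.
Proof.
have sy := sqint_bounded_mul sqint_phi mg gle; split => // m.
apply: cip_approx => //; first exact: sqint_E.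
move=> e e0; have [n hn] := phi_anti_poly_approx (divr_gt0 e0 c0).
have sP := sqint_anti_poly n d0.
exists (fun x => g x * anti_poly n d0 x); split.
- exact: sqint_bounded_mul sP mg gle.
- rewrite (@eq_n2 _ _ _ _ _ _ (fun x : T => g x * (phi x - anti_poly n d0 x))); last first.
    by move=> x _; rewrite mulrBr.
  apply: le_lt_trans (n2_bounded_mul_le (ltW c0) (sqintB mc sqint_phi sP) mg gle) _.
  by rewrite mulrC -ltr_pdivlMr//; exact: hn.
- have -> : ip (fun x => g x * anti_poly n d0 x) (E m.+1) =
      ip (fun x : T => \sum_(k < n) d0 k * (E (- (k : int)) x * g x)) (E m.+1).
    apply: eq_cip => // x _; rewrite /anti_poly mulr_sumr; apply: eq_bigr => k _.
    by ring.
  rewrite cip_suml//; last 2 first.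
  + by move=> k; apply: sqintZ => //; apply: sqintM_E; exact: hg.1.
  + exact: sqint_E.
  apply: big1 => k _.
  rewrite cipZl; [|exact: mc|by apply: sqintM_E; exact: hg.1|exact: sqint_E].
  rewrite cipM_El opprK (_ : ip g _ = 0) ?mulr0// -(hg.2 (k + m)%N).
  by apply: eq_cip => // x _; rewrite -E_add -PoszD addnS.
Qed.

Lemma N_outer_le : N outer <= c * N phi.
Proof. exact: n2_bounded_mul_le (ltW c0) sqint_phi mgc gcle. Qed.

Lemma N_partner_le : N partner <= c * N phi.
Proof. exact: n2_bounded_mul_le (ltW c0) sqint_phi mg gle. Qed.

(** Only the product of the arguments enters, and [outer * partner = |g|^2 phi^2 = c phi^2] almost
    everywhere. *)
Lemma cip_outer_partner : ip (fun x => A x * outer x) (fun x => Num.conj (partner x)) =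
  c%:C * (alpha * (N phi)%:C).
Proof.
have so := outer_Hminus.1; have sy := partner_Hminus.1; have sp := sqint_phi.
have sAp := sqint_AM ha sp; have spc := sqint_conj mc sp.
rewrite -cip_A_phi_conj -(cipZl mc _ sAp spc).
apply: ae_eq_Cintegral => //.
- apply: cmeasurableM; first exact: (sqint_AM ha so).1.
  by apply: cmeasurable_conj; apply: cmeasurable_conj; exact: sy.1.
- apply: cmeasurableM; first exact: (sqintZ mc _ sAp).1.
  by apply: cmeasurable_conj; exact: spc.1.
- apply: (ae_mono _ gc) => x h cx; rewrite !conjCK /outer /partner -(h cx) -mul_conj.
  by ring.
Qed.

(* The bilinear bound is an equality at the pair (outer, partner), so its first
   variation in the second argument vanishes. *)
Lemma cip_A_outer (n : nat) :
  ip (fun x => A x * outer x) (E n) = alpha * Num.conj (ip partner (E (- (n : int)))).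
Proof.
have so := outer_Hminus; have sy := partner_Hminus.
have [l l1 la] := exists_phase.
set X := ip _ (E n); set Y := ip partner _.
have EH : in_Hminus (E (- (n : int)) : T -> R[i]).
  split; first exact: sqint_E.
  by move=> k; rewrite cip_E (_ : (- (n : int) == k.+1) = false) ?mulr0//; case: n {X Y}.
have sAo := sqint_AM ha so.1.
have pi0 := pi_gt0 R.
(* At [w = 0] the bilinear bound is saturated, as both arguments have squared norm at most
   [c * N phi]. These terms cancel and leave a term linear in [w] below a multiple of [|w|^2], so
   the linear term must vanish. *)
have key (w : R[i]) : re (w * (l * X - s%:C * Num.conj Y)) <= s * pi * normc2 w.
  have hw := in_HminusZ w EH.
  have := re_A_bilin_le ha hs s0 (in_HminusZ l so) (in_HminusD sy hw).
  have -> : ip (fun t => A t * (l * outer t))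
      (fun t => Num.conj (partner t + w * E (- (n : int)) t)) =
      l * (c%:C * (alpha * (N phi)%:C) + w * X).
    have -> : ip (fun t => A t * (l * outer t))
        (fun t => Num.conj (partner t + w * E (- (n : int)) t)) =
      ip (fun t => l * (A t * outer t))
        (fun t => Num.conj (partner t) + Num.conj w * E n t).
      apply: eq_cip => t _; first by ring.
      by rewrite rmorphD /=; congr (_ + _); rewrite rmorphM /= E_conj opprK.
    have syc := sqint_conj mc sy.1; have swE := sqintZ mc (Num.conj w) (sqint_E n).
    rewrite (cipZl mc _ sAo (sqintD mc syc swE)) (cipDr mc sAo syc swE).
    by rewrite (cipZr mc _ sAo (sqint_E n)) conjCK cip_outer_partner.
  rewrite (n2Z mc _ so.1) l1 mul1r (n2D mc sy.1 hw.1) (n2Z mc _ EH.1).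
  rewrite (cipZr mc _ sy.1 EH.1) -/Y.
  have -> : N (E (- (n : int))) = 2 * pi.
    apply: (@complexI R); rewrite -(cip_diag mc (sqint_E _)) cip_E eqxx mulr1.
    by [].
  have -> : l * (c%:C * (alpha * (N phi)%:C) + w * X) =
      (s * (c * N phi))%:C + w * (l * X).
    by rewrite !rmorphM /= -la; ring.
  have hR : re (Num.conj w * Y) = re (w * Num.conj Y) by rewrite !cE; ring.
  have reE : re (w * (l * X - s%:C * Num.conj Y)) = re (w * (l * X)) - s * re (w * Num.conj Y).
    by rewrite !cE; ring.
  rewrite reD reC reE hR; have := N_outer_le; have := N_partner_le.
  move: (N outer) (N partner) (c * N phi) (re _) (re _) (normc2 w) => o p q u v z.
  move=> h1 h2; have : s * (o + p) <= s * (2 * q) by rewrite ler_wpM2l//; lra.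
  lra.
set Z := l * X - s%:C * Num.conj Y in key.
have Z0 : Z = 0.
  apply/eqP; rewrite -normc2_eq0 -sqrf_eq0 eq_le sqr_ge0 andbT.
  have quad t : 0 <= 0 + 2 * t * (- (normc2 Z / 2)) + t ^+ 2 * (s * pi * normc2 Z).
    have := key (t%:C * Num.conj Z).
    rewrite normc2M normc2C normc2_conj -mulrA (mulrC (Num.conj Z)) mul_conj -rmorphM reC.
    lra.
  have hc : 0 <= s * pi * normc2 Z.
    by rewrite mulr_ge0 ?normc2_ge0// mulr_ge0// ltW.
  have := discriminant_le (lexx 0) hc quad; rewrite mul0r sqrrN.
  have := sqr_ge0 (normc2 Z); rewrite expr_div_n; lra.
move: Z0; rewrite /Z => /eqP; rewrite subr_eq0 => /eqP Z0.
(* If [alpha = 0] then [s = 0], and the identity forces the coefficient itself to vanish. *)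
have [a0|an0] := eqVneq alpha 0.
  have sz : s = 0.
    by apply/eqP; rewrite -sqrf_eq0 s2 a0 normc2_0.
  have ln0 : l != 0 by rewrite -normc2_eq0 l1 oner_eq0.
  by rewrite a0 mul0r; apply: (mulfI ln0); rewrite Z0 sz mul0r mulr0.
have sn0 : s%:C != 0.
  by rewrite -normc2_eq0 normc2C s2 normc2_eq0.
apply: (mulfI sn0); rewrite -{1}la [l * alpha]mulrC -mulrA Z0.
by rewrite mulrCA.
Qed.

(** Equal almost everywhere to [h * outer] for any [h] with [h * phi = A * phi - alpha * conj phi],
    but free of division, so that its coefficients can be computed. *)
Definition resid (x : T) := A x * outer x - alpha * Num.conj (partner x).

Lemma sq_resid : sq resid.
Proof.
apply: sqintB => //; first exact: (sqint_AM ha outer_Hminus.1).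
by apply: sqintZ => //; apply: sqint_conj => //; exact: partner_Hminus.1.
Qed.

Lemma cip_resid_eq0 (n : nat) : ip resid (E n) = 0.
Proof.
have syc := sqint_conj mc partner_Hminus.1.
rewrite cipBl; [|exact: mc|exact: (sqint_AM ha outer_Hminus.1)|exact: sqintZ|exact: sqint_E].
rewrite cip_A_outer (cipZl mc _ syc (sqint_E _)) cip_conj_E ?subrr//.
exact: partner_Hminus.1.
Qed.

Variables (h : T -> R[i]) (K : R).
Hypothesis mh : cmeasurable (circ : set T) h.
Hypothesis K0 : 0 <= K.
Hypothesis hK : {ae mu, forall x : T, circ x -> normc2 (h x) <= K}.
Hypothesis hphiE : {ae mu, forall x : T, circ x ->
  h x * phi x = A x * phi x - alpha * Num.conj (phi x)}.

(** [c * h] is [h * conj g * g], and [g] is a limit of [(1 - p) * phi] with [p] of negative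
    frequencies. The product of [h * conj g] with [(1 - p) * phi] is [(1 - p) * resid], which has
    only negative frequencies; boundedness of [h * conj g] carries this to the limit. *)
Lemma cip_bounded_eq0 (n : nat) : ip h (E n) = 0.
Proof.
have cC : c%:C != 0 :> R[i] by rewrite -normc2_eq0 normc2C sqrf_eq0 gt_eqF.
have sh : sq h.
  by apply: eq_sqint (sqint_bounded_mul (sqint_E 0) mh hK) => x _; rewrite E0 mulr1.
pose b (x : T) := h x * Num.conj (g x).
have mb : cmeasurable (circ : set T) b by exact: cmeasurableM.
have bK : {ae mu, forall x : T, circ x -> normc2 (b x) <= K * c}.
  apply: (ae_mono2 _ hK gcle) => x h1 h2 cx.
  by rewrite normc2M ler_pM ?normc2_ge0 ?h1 ?h2.
have sbg := sqint_bounded_mul hg.1 mb bK.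
apply: (mulfI cC); rewrite mulr0 -(cipZl mc _ sh (sqint_E n)).
transitivity (ip (fun x => b x * g x) (E n)).
  apply: ae_eq_Cintegral => //.
  - apply: cmeasurableM; first exact: (sqintZ mc _ sh).1.
    by apply: cmeasurable_conj; exact: cmeasurable_E.
  - apply: cmeasurableM; first exact: sbg.1.
    by apply: cmeasurable_conj; exact: cmeasurable_E.
  - apply: (ae_mono _ gc) => x h1 cx; rewrite /b -(h1 cx) -mul_conj.
    by ring.
apply: cip_approx => //; first exact: sqint_E.
move=> e e0.
have Kc1 : 0 < K * c + 1 by rewrite ltr_wpDl// mulr_ge0// ltW.
have [m [p hp]] := gapp (divr_gt0 e0 Kc1).
have sP := sqint_ntp_mul m p sqint_phi.
have sv := sqintB mc sqint_phi sP.
exists (fun x => b x * (phi x - neg_trig_poly m p x * phi x)); split.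
- exact: sqint_bounded_mul sv mb bK.
- rewrite (@eq_n2 _ _ _ _ _ _ (fun x : T => b x * (g x - (phi x - neg_trig_poly m p x * phi x)))); last first.
    by move=> x _; rewrite [RHS]mulrBr.
  have Kc0 : 0 <= K * c by rewrite mulr_ge0// ltW.
  apply: le_lt_trans (n2_bounded_mul_le Kc0 (sqintB mc hg.1 sv) mb bK) _.
  rewrite n2C; rewrite ltr_pdivlMr// in hp.
  have := n2_ge0 mu circ (fun x => phi x - neg_trig_poly m p x * phi x - g x).
  move: hp; move: (N _) => u; lra.
have sr := sq_resid; have spr := sqint_ntp_mul m p sr.
transitivity (ip (fun x => resid x - neg_trig_poly m p x * resid x) (E n)).
  apply: ae_eq_Cintegral => //.
  - apply: cmeasurableM; first exact: cmeasurableM mb sv.1.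
    by apply: cmeasurable_conj; exact: cmeasurable_E.
  - apply: cmeasurableM; first exact: (sqintB mc sr spr).1.
    by apply: cmeasurable_conj; exact: cmeasurable_E.
  - apply: (ae_mono _ hphiE) => x h1 cx; congr (_ * _).
    transitivity ((h x * phi x) * Num.conj (g x) * (1 - neg_trig_poly m p x)).
      by rewrite /b; ring.
    by rewrite (h1 cx) /resid /outer /partner rmorphM; ring.
rewrite (cipBl mc sr spr (sqint_E n)) cip_resid_eq0 cip_ntp_mul//; last exact: sqint_E.
rewrite big1 ?subrr// => k _; rewrite (_ : ip resid _ = 0) ?mulr0//.
rewrite -(cip_resid_eq0 (k.+1 + n)%N).
by apply: eq_cip => // x _; rewrite -E_add -PoszD.
Qed.

End Factor.

End Robust.

(** * The saddle point and the uniqueness of the robust characteristic *)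

Theorem theorem13 (R : realType) (a : nat -> R[i]) (P0 : R)
  (ha1 : (\sum_(0 <= j <oo) (ComplexField.Normc.normc (a j))%:E < +oo)%E)
  (ha2 : (\sum_(0 <= j <oo) (j.+1%:R * normc2 (a j))%:E < +oo)%E)
  (hP0 : 0 < P0)
  (d0 : nat -> R[i]) (nu : R)
  (hd0 : coneigen_sol a P0 d0)
  (hmax : forall d, coneigen_sol a P0 d ->
     (l2norm2 (hankel a d) <= l2norm2 (hankel a d0))%E)
  (hnu : l2norm2 (hankel a d0) = (nu ^+ 2 * P0)%:E)
  (phi psi : R -> R[i])
  (hphi : is_L2sum d0 (fun k x => expi (- (k%:R * x))) phi)
  (hpsi : is_L2sum (hankel a d0) (fun k x => expi (k%:R * x)) psi) :
  let f0 := fun x => normc2 (phi x) in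
  let h0 := fun x => Afun a x - (phi x)^-1 * psi x in
  [/\ forall (d : measure_display) (T : measurableType d) (P : probability T R)
        (eps xi : int -> T -> R[i]),
        white_noise P eps -> moving_average P d0 eps xi ->
        has_spectral_density P xi f0,
      least_favourable a (D_0 P0) f0,
      minimax_char a (D_0 P0) h0 &
      forall h, minimax_char a (D_0 P0) h ->
        {ae (@lebesgue_measure R), forall x, circ x -> h x = h0 x}].
Proof.
move=> f0 h0.
have [[alpha hd] nd] := hd0.
have s0 : 0 <= Num.sqrt (normc2 alpha) by exact: sqrtr_ge0.
have s2 : Num.sqrt (normc2 alpha) ^+ 2 = normc2 alpha by rewrite sqr_sqrtr// normc2_ge0.
have hs := re_hform_le_coneigen ha1 hP0 hd nd hmax s0 s2.
have mc : measurable (circ : set (measurableTypeR R)) by exact: mcirc.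
have pi0 : 0 < (2 * pi : R) by rewrite mulr_gt0// pi_gt0.
have sp := sqint_phi hphi; have hH := phi_in_Hminus hphi.
have phi_neq0 := ae_neq0_phi hH (cip_phi_expi hphi) (exists_d0_neq0 hP0 nd).
have psiE := psi_eq_conj_phi_ae hd hphi hpsi.
have Np := n2_phi nd hphi.
have B0 := normc2_ge0 alpha.
have h0phi : {ae (@lebesgue_measure R), forall x : measurableTypeR R, circ x ->
    h0 x * phi x = Afun a x * phi x - alpha * Num.conj (phi x)}.
  apply: (ae_mono2 _ phi_neq0 psiE) => x hx px cx.
  by rewrite /h0 px// mulrBl mulrAC mulVf ?mul1r// hx.
(* The bound also holds where [phi] vanishes, since [0^-1 = 0] makes the difference 0 there. *)
have dist : {ae (@lebesgue_measure R), forall x : measurableTypeR R, circ x ->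
    normc2 (Afun a x - h0 x) <= normc2 alpha}.
  apply: (ae_mono _ psiE) => x px cx.
  rewrite /h0 opprB addrC subrK px// !normc2M normc2V normc2_conj.
  have [->|n0] := eqVneq (normc2 (phi x)) 0; first by rewrite !mulr0.
  by rewrite mulrCA mulVf// mulr1.
have mpsi : cmeasurable (circ : set (measurableTypeR R)) psi := hpsi.1.
have mh0 : cmeasurable (circ : set (measurableTypeR R)) h0.
  apply: cmeasurableB; first exact: cmeasurable_Afun ha1.
  by apply: cmeasurableM => //; apply: cmeasurableV; exact: sp.1.
have K0 : 0 <= 2 * KA a + 2 * normc2 alpha.
  by have := KA_ge0 a; lra.
have h0K : {ae (@lebesgue_measure R), forall x : measurableTypeR R, circ x ->
    normc2 (h0 x) <= 2 * KA a + 2 * normc2 alpha}.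
  apply: (ae_mono _ dist) => x dx cx; have := dx cx.
  have := normc2D_le (Afun a x) (- (Afun a x - h0 x)); rewrite normc2N.
  have -> : Afun a x + - (Afun a x - h0 x) = h0 x by ring.
  have := normc2_Afun ha1 x; lra.
have [g [c [hg c0 gc gapp gE]]] := exists_wandering hH (cip_phi_expi hphi) (exists_d0_neq0 hP0 nd).
have h0E : forall n : nat, cip (@lebesgue_measure R) circ h0 (E n) = 0.
  exact: (cip_bounded_eq0 ha1 hd nd hs s0 s2 hphi hg c0 gc gapp gE mh0 K0 h0K h0phi).
have h0L f : density f -> L2minus f h0 by exact: bounded_L2minus K0 mh0 h0K h0E.
have h0H : Hclass (D_0 P0) h0 by move=> f [df _]; exact: h0L.
have upper f : D_0 P0 f -> (Delta a h0 f <= (normc2 alpha * P0)%:E)%E.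
  move=> [[f_ge0 fi] fP].
  have mf : measurable_fun (circ : set (measurableTypeR R)) f.
    by apply/measurable_EFinP; exact: measurable_int fi.
  have ifin := integrable_fin_num mc fi.
  have wle : (wnorm2 f (fun x => Afun a x - h0 x)%R <=
      (normc2 alpha)%:E * \int[@lebesgue_measure R]_(x in circ) (f x)%:E)%E.
    have fE0 x : circ x -> (0 <= (f x)%:E)%E by move=> cx; rewrite lee_fin f_ge0.
    have mfE : measurable_fun (circ : set (measurableTypeR R)) (EFin \o f).
      exact/measurable_EFinP.
    have aE0 : (0 <= (normc2 alpha)%:E)%E by rewrite lee_fin.
    rewrite -(ge0_integralZl (@lebesgue_measure R) mc mfE fE0 aE0).
    apply: ae_ge0_le_integral => //.
    - by move=> x cx; rewrite lee_fin mulr_ge0 ?normc2_ge0 ?f_ge0.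
    - apply/measurable_EFinP; apply: measurable_funM => //.
      by apply: measurable_normc2; apply: cmeasurableB => //; exact: cmeasurable_Afun ha1.
    - by move=> x cx; rewrite mule_ge0// lee_fin f_ge0.
    - by apply: measurable_funeM; exact/measurable_EFinP.
    - apply: (ae_mono _ dist) => x dx cx; rewrite -EFinM lee_fin.
      by apply: ler_wpM2r; [exact: f_ge0|exact: dx].
  rewrite /Delta; apply: (@le_trans _ _ ((2 * pi)^-1%:E *
    ((normc2 alpha)%:E * \int[@lebesgue_measure R]_(x in circ) (f x)%:E))%E).
    by apply: lee_wpmul2l => //; rewrite lee_fin invr_ge0 ltW.
  rewrite -(fineK ifin) -!EFinM lee_fin mulrCA ler_wpM2l//.
have wf0 (k : R -> R[i]) : wnorm2 f0 k =
    (\int[@lebesgue_measure R]_(x in circ) (normc2 (k x * phi x))%:E)%E.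
  by apply: eq_integral => x _; rewrite normc2M.
have sApsi := sqint_conj_phi alpha hphi.
have sAphi := sqint_AM ha1 sp.
have Npsi : n2 (@lebesgue_measure R) circ (fun x => alpha * Num.conj (phi x)) = normc2 alpha * (2 * pi * P0).
  by rewrite (n2Z mc _ (sqint_conj mc sp)) n2_conj Np.
(* [(A - k) * phi] is the sum of [alpha * conj phi] and a function with negative frequencies, and
   these are orthogonal. The remainder is kept exactly, not merely bounded below by 0, because
   uniqueness is read off from it. *)
have lower (k : R -> R[i]) : L2minus f0 k ->
    sqint (@lebesgue_measure R) circ (fun x => (Afun a x * phi x - alpha * Num.conj (phi x)) - k x * phi x) /\
    Delta a k f0 = (normc2 alpha * P0 + (2 * pi)^-1 *
      n2 (@lebesgue_measure R) circ (fun x => (Afun a x * phi x - alpha * Num.conj (phi x)) - k x * phi x))%:E.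
  move=> /(L2minus_cip_eq0 hH) [skp kE].
  have sr := sqintB mc sAphi sApsi.
  have su := sqintB mc sr skp; split => //.
  have uE (n : nat) : cip (@lebesgue_measure R) circ (fun x =>
      (Afun a x * phi x - alpha * Num.conj (phi x)) - k x * phi x) (E n) = 0.
    rewrite (cipBl mc sr skp (sqint_E n)) kE subr0.
    by have := cip_resid_E ha1 hd nd hphi n; exact.
  have uphi := cip_conj_phi_eq0 hphi su uE.
  have sAkp : sqint (@lebesgue_measure R) circ (fun x => (Afun a x - k x) * phi x).
    by apply: eq_sqint (sqintB mc sAphi skp) => x _; rewrite mulrBl.
  rewrite /Delta wf0 (integral_n2 sAkp) -EFinM; congr (_%:E).
  have -> : n2 (@lebesgue_measure R) circ (fun x => (Afun a x - k x) * phi x) =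
      n2 (@lebesgue_measure R) circ (fun x => ((Afun a x * phi x - alpha * Num.conj (phi x)) - k x * phi x)
        + alpha * Num.conj (phi x)).
    by apply: eq_n2 => x _; ring.
  rewrite (n2D mc su sApsi) (cipZr mc _ su (sqint_conj mc sp)) uphi mulr0 mulr0 addr0 Npsi.
  by rewrite mulrDr addrC; congr (_ + _); rewrite mulrCA mulKf// gt_eqF.
have f0D : D_0 P0 f0.
  split; first exact: density_normc2.
  rewrite -[X in _ * X <= _]/(n2 (@lebesgue_measure R) circ phi) Np.
  by rewrite mulrA mulVf ?mul1r// gt_eqF.
have h0f0 : L2minus f0 h0 by exact: h0L f0D.1.
have lower' k : L2minus f0 k -> ((normc2 alpha * P0)%:E <= Delta a k f0)%E.
  move=> /lower [_ ->]; rewrite lee_fin lerDl mulr_ge0 ?n2_ge0//.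
  by rewrite invr_ge0 ltW.
have Dh0 : Delta a h0 f0 = (normc2 alpha * P0)%:E.
  by apply/eqP; rewrite eq_le upper// lower'.
have maxh0 : max_error a (D_0 P0) h0 = (normc2 alpha * P0)%:E.
  apply/eqP; rewrite eq_le; apply/andP; split.
    by apply: ge_ereal_sup => _ [f Df <-]; exact: upper.
  by rewrite -Dh0; apply: ereal_sup_ubound; exists f0.
have infH : ereal_inf [set max_error a (D_0 P0) h | h in Hclass (D_0 P0)] =
    max_error a (D_0 P0) h0.
  apply/eqP; rewrite eq_le; apply/andP; split.
    by apply: ereal_inf_lbound; exists h0.
  (* Every competitor already pays this value at [f0]. *)
  rewrite maxh0; apply: le_ereal_inf_tmp => _ [k Hk <-].
  apply: le_trans (lower' k (Hk _ f0D)) _.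
  by apply: ereal_sup_ubound; exists f0.
split.
- move=> d T P eps xi; exact: moving_average_spectral_density.
- split => //; exists h0; split.
    by split => // k Lk; rewrite Dh0; exact: lower'.
  rewrite Dh0; apply/eqP; rewrite eq_le; apply/andP; split.
    apply: (@le_trans _ _ (min_error a f0)).
      by apply: le_ereal_inf_tmp => _ [k Lk <-]; exact: lower'.
    by apply: ereal_sup_ubound; exists f0.
  (* Each minimal error is at most the error of [h0], which is admissible for all densities at
     once. *)
  apply: ge_ereal_sup => _ [f Df <-]; apply: le_trans (upper f Df).
  by apply: ereal_inf_lbound; exists h0 => //; exact: h0H.
- split => //; exists f0 => //.
  by rewrite Dh0 maxh0.
(* Optimality brings the error of [h] at [f0] down to the common value, so the remainder in [lower]
   is 0 and [h * phi = h0 * phi]; then [phi] cancels almost everywhere. *)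
- move=> h [Hh _ inf_h].
  have hle : (Delta a h f0 <= (normc2 alpha * P0)%:E)%E.
    rewrite -maxh0 -infH inf_h.
    by apply: ereal_sup_ubound; exists f0.
  have [su De] := lower h (Hh _ f0D).
  have u0 : n2 (@lebesgue_measure R) circ (fun x =>
      (Afun a x * phi x - alpha * Num.conj (phi x)) - h x * phi x) = 0.
    apply/eqP; rewrite eq_le n2_ge0 andbT.
    move: hle; rewrite De lee_fin gerDl pmulr_rle0// invr_gt0.
    exact.
  have uae := n2_eq0_ae mc su u0.
  apply: (ae_mono2 _ phi_neq0 (ae_mono2 (fun x p q => conj p q) h0phi uae)) => x px [hx ux] cx.
  apply: (mulIf (px cx)); rewrite hx//.
  by have /eqP := ux cx; rewrite subr_eq0 => /eqP ->.
Qed.
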